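(* Let $(X_n)_{n\ge1}$ be i.i.d. random variables with finite second moment, $f_1(t)={\bf E}e^{itX_1}$, and $Z_n=(X_1+\dots+X_n)/\sqrt n$. The following are equivalent: (a) for some $n_0$, $Z_{n_0}$ has finite Fisher information; (b) for some $n_0$, $Z_{n_0}$ has a density of bounded total variation; (c) for some $n_0$, $Z_{n_0}$ has a continuously differentiable density $p_{n_0}$ with $\int_{-\infty}^{+\infty}|p_{n_0}'(x)|\,dx<+\infty$; (d) for some $\varepsilon>0$, $|f_1(t)|=O(t^{-\varepsilon})$ as $t\to+\infty$; (e) for some $\nu>0$, $\int_{-\infty}^{+\infty}|f_1(t)|^\nu|t|\,dt<+\infty$.
   Context: Fisher information of a random variable $X$: if $X$ has an absolutely continuous density $p$, $I(X)=\int_{\{p>0\}}p'(x)^2/p(x)\,dx$; otherwise $I(X)=+\infty$. The total variation of a density $p$ is $\|p\|_{TV}=\sup\sum_{k=1}^n|p(x_k)-p(x_{k-1})|$ over all finite $x_0<\dots<x_n$, with the convention that $p(x)$ lies in the closed segment between $p(x-)$ and $p(x+)$ for each $x$. *)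

(* Defs.v *)
From HB Require Import structures.
From mathcomp Require Import all_boot all_order all_algebra.
From mathcomp Require Import all_classical all_reals all_analysis.
From mathcomp Require Import complex.
Set Implicit Arguments. Unset Strict Implicit. Unset Printing Implicit Defensive.
Import Order.TTheory GRing.Theory Num.Theory.
Import numFieldNormedType.Exports.
Local Open Scope classical_set_scope.
Local Open Scope ring_scope.

Section Defs.
Context {R : realType}.

Definition mutually_independent {d} {T : measurableType d}
    (P : probability T R) (X : nat -> T -> R) : Prop :=
  forall (s : seq nat) (B : nat -> set R), uniq s ->
    (forall i, measurable (B i)) ->
    P (\bigcap_(i in [set` s]) (X i @^-1` B i)) =
    (\prod_(i <- s) P (X i @^-1` B i))%E.

Definition identically_distributed {d} {T : measurableType d}
    (P : probability T R) (X : nat -> T -> R) : Prop :=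
  forall n (B : set R), measurable B -> P (X n @^-1` B) = P (X 0%N @^-1` B).

Definition charfun {d} {T : measurableType d} (P : probability T R)
    (Y : T -> R) (t : R) : R[i] :=
  (fine ('E_P[fun w => cos (t * Y w)])%E +i* fine ('E_P[fun w => sin (t * Y w)])%E)%C.

Definition cmodulus (z : R[i]) : R := ComplexField.Normc.normc z.

(* Normalized sum Z_n = (X_1 + ... + X_n)/sqrt n ; X_1..X_n are X 0 .. X (n-1). *)
Definition normalized_sum {T : Type} (X : nat -> T -> R) (n : nat) : T -> R :=
  fun w => (\sum_(i < n) X i w) / Num.sqrt (n%:R).

Definition is_density {d} {T : measurableType d} (P : probability T R)
    (Y : T -> R) (p : R -> R) : Prop :=
  (forall x, (0 <= p x)%R) /\ measurable_fun setT p /\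
  forall A : set R, measurable A ->
    P (Y @^-1` A) = (\int[lebesgue_measure]_(x in A) (p x)%:E)%E.

(* Absolute continuity of f on [a, b]: for every e > 0 there is d > 0 such that
   for every finite family of non-overlapping subintervals (u_k, v_k) of [a, b]
   (listed from left to right) of total length < d, sum |f v_k - f u_k| < e. *)
Definition abs_continuous_on (a b : R) (f : R -> R) : Prop :=
  forall e : R, 0 < e -> exists2 dl : R, 0 < dl &
    forall s : seq (R * R),
      path (fun u v : R * R => u.2 <= v.1) (a, a) s ->
      all (fun u : R * R => (u.1 <= u.2) && (u.2 <= b)) s ->
      \sum_(u <- s) (u.2 - u.1) < dl ->
      \sum_(u <- s) `|f u.2 - f u.1| < e.

Definition abs_continuous (f : R -> R) : Prop :=
  forall a b : R, abs_continuous_on a b f.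

Definition finite_fisher_information {d} {T : measurableType d}
    (P : probability T R) (Y : T -> R) : Prop :=
  exists p : R -> R, is_density P Y p /\ abs_continuous p /\
    (\int[lebesgue_measure]_(x in [set x | (0 < p x)%R])
        ((derive1 p x) ^+ 2 / p x)%R%:E < +oo)%E.

Definition between_one_sided_limits (p : R -> R) : Prop :=
  forall x : R, exists l r : R,
    p y @[y --> x^'-] --> l /\ p y @[y --> x^'+] --> r /\
    Num.min l r <= p x <= Num.max l r.

Definition bounded_total_variation (p : R -> R) : Prop :=
  exists M : R, forall s : seq R, sorted <%R s ->
    \sum_(k < (size s).-1) `|p (nth 0 s k.+1) - p (nth 0 s k)| <= M.

End Defs.

(* Main.v *)
(** The conditions imply one another cyclically.

    (a) => (b). An absolutely continuous p is an indefinite integral: its total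
    variation function is absolutely continuous and monotone, hence the
    distribution function of a measure dominated by Lebesgue measure, whose
    Radon-Nikodym derivative is p' almost everywhere.  Then
    |p'| <= p'^2 / p + p where p > 0, and p' = 0 where p = 0 since p >= 0.

    (b) => (d), and (c) => (d) as (c) implies bounded variation. Comparing p with its
    translate by pi / t, the characteristic function f of Z_n satisfies
    |f(t)| <= C TV(p) / t, while |f(t)| = |f_1(t / sqrt n)|^n.

    (d) => (a), (c), (e). The k-th derivatives of f_1^n, k <= 2, are O(|f_1|^(n-2)),
    so for large n they decay like t^-4.  Fourier inversion applied to the measures
    P and Z_n^2 P then gives a C^2 density p of Z_n such that (1 + x^2) p^(j)(x) is
    bounded for j = 1, 2; in particular p' is integrable.  Finally p'^2 / p is
    integrable because a nonnegative p satisfies p'^2 <= 4 M p when |p''| and |p'|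
    are locally at most M.

    (e) => (d). f_1 is Lipschitz, so the integral in (e) over an interval where
    |f_1| >= |f_1(t)| / 2 bounds |f_1(t)|^(1 + nu) by C / t. *)

Require Import Defs.
From HB Require Import structures.
From mathcomp Require Import all_boot all_order all_algebra.
From mathcomp Require Import all_classical all_reals all_analysis.
From mathcomp Require Import measurable_realfun complex ring lra zify.
Import Order.TTheory GRing.Theory Num.Theory.
Import numFieldNormedType.Exports.
Local Open Scope classical_set_scope.
Local Open Scope ring_scope.

Set Implicit Arguments.
Unset Strict Implicit.
Unset Printing Implicit Defensive.

(** * Trigonometric integrals and Fourier inversion *)

(** Everything stays real. For U = E[W cos(tY)] and V = E[W sin(tY)], the function U cos(tx) + V
    sin(tx) is E[W cos(t(x - Y))], and its integral over t >= 0 is pi times the density of the law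
    of Y weighted by W. Fubini does not apply to it directly, since cos(t(x - Y)) is not integrable
    in t. A factor exp(-st) turns the inner integral into the Poisson kernel, whose primitive is an
    arctangent, and s -> 0 leaves a sign function.

    The factor 1 + x^2 is gained without differentiating characteristic functions or integrating by
    parts. Inversion with W = 1 and with W = Z_n^2 gives two functions bounded together with two
    derivatives, and the second is x^2 times the first. Decay t^-4 is what two differentiations in x
    cost: t^2 times it is still integrable. The factor also serves twice: it makes p' integrable,
    and it allows M of order 1/(1 + x^2) in p'^2 <= 4 M p, so that the Fisher integrand is
    integrable however small p is. *)

Section trig_integral.
Context {R : realType}.
Notation mu := (@lebesgue_measure R).
Implicit Types U V : R -> R.

(** The bound is asked for t >= 0 only, because [trig_integral] integrates over that half-line. *)
Definition quad_decay U := measurable_fun setT U /\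
  exists K : R, forall t, 0 <= t -> `|U t| <= K * (1 + t ^+ 2)^-1.

Definition trig_integral U V x :=
  \int[mu]_(t in `[0, +oo[) (U t * cos (t * x) + V t * sin (t * x)).

Lemma oneDsqr_pos (t : R) : 0 < 1 + t ^+ 2.
Proof. by rewrite ltr_pwDl// sqr_ge0. Qed.

Lemma measurable_invD1sqr : measurable_fun setT (fun t : R => (1 + t ^+ 2)^-1).
Proof. by apply: continuous_measurable_fun; exact: continuous_oneDsqrV. Qed.

Lemma integrable_invD1sqr (K : R) :
  mu.-integrable `[0, +oo[ (EFin \o (fun t => K * (1 + t ^+ 2)^-1)).
Proof.
have -> : EFin \o (fun t : R => K * (1 + t ^+ 2)^-1) =
    (fun t => K%:E * ((1 + t ^+ 2)^-1)%:E)%E by apply/funext => t /=; rewrite EFinM.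
apply: integrableZl => //.
apply/integrableP; split.
  by apply/measurable_EFinP; apply: measurable_funTS; exact: measurable_invD1sqr.
under eq_integral => t _ do rewrite gee0_abs ?lee_fin ?invr_ge0 ?ltW ?oneDsqr_pos//.
by rewrite integral0y_oneDsqr ltry.
Qed.

Lemma Rintegral_invD1sqr (K : R) :
  \int[mu]_(t in `[0, +oo[) (K * (1 + t ^+ 2)^-1) = K * (pi / 2).
Proof.
rewrite RintegralZl//; last first.
  by have := integrable_invD1sqr 1; rewrite (_ : (fun t => 1 * _) = fun t => (1 + t ^+ 2)^-1)//; apply/funext => t; rewrite mul1r.
by rewrite /Rintegral integral0y_oneDsqr.
Qed.

Lemma measurable_cosM (x : R) : measurable_fun setT (fun t : R => cos (t * x)).
Proof.
apply: continuous_measurable_fun => t.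
apply: continuous_comp; last exact: continuous_cos.
exact: mulrr_continuous.
Qed.

Lemma measurable_sinM (x : R) : measurable_fun setT (fun t : R => sin (t * x)).
Proof.
apply: continuous_measurable_fun => t.
apply: continuous_comp; last exact: continuous_sin.
exact: mulrr_continuous.
Qed.

Lemma cos_norm_le1 (x : R) : `|cos x| <= 1.
Proof. by rewrite ler_norml cos_geN1 cos_le1. Qed.

Lemma sin_norm_le1 (x : R) : `|sin x| <= 1.
Proof. by rewrite ler_norml sin_geN1 sin_le1. Qed.

Lemma trig_comb_le (a b x : R) : `|a * cos x + b * sin x| <= `|a| + `|b|.
Proof.
apply: (le_trans (ler_normD _ _)); rewrite !normrM.
by apply: lerD; rewrite -[leRHS]mulr1 ler_wpM2l// ?cos_norm_le1// sin_norm_le1.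
Qed.

Lemma quad_decay2 U V : quad_decay U -> quad_decay V ->
  exists2 K : R, 0 <= K & forall t, 0 <= t -> `|U t| + `|V t| <= K * (1 + t ^+ 2)^-1.
Proof.
move=> [_ [K HK]] [_ [L HL]]; exists (Num.max K 0 + Num.max L 0).
  by rewrite addr_ge0// le_max lexx orbT.
move=> t t0; rewrite mulrDl; apply: lerD.
  apply: (le_trans (HK _ t0)); rewrite ler_wpM2r ?invr_ge0 ?(ltW (oneDsqr_pos _))//.
  by rewrite le_max lexx ?orbT.
apply: (le_trans (HL _ t0)); rewrite ler_wpM2r ?invr_ge0 ?(ltW (oneDsqr_pos _))//.
by rewrite le_max lexx ?orbT.
Qed.

Lemma measurable_trig_comb U V x : measurable_fun setT U -> measurable_fun setT V ->
  measurable_fun setT (fun t => U t * cos (t * x) + V t * sin (t * x)).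
Proof.
move=> mU mV; apply: measurable_funD; apply: measurable_funM => //.
  exact: measurable_cosM.
exact: measurable_sinM.
Qed.

Lemma integrable_trig U V x : quad_decay U -> quad_decay V ->
  mu.-integrable `[0, +oo[ (EFin \o (fun t => U t * cos (t * x) + V t * sin (t * x))).
Proof.
move=> dU dV; have [K K0 HK] := quad_decay2 dU dV.
apply: le_integrable (integrable_invD1sqr K) => //.
  apply/measurable_EFinP; apply: measurable_funTS.
  by apply: measurable_trig_comb; [case: dU|case: dV].
move=> t /=; rewrite in_itv/= andbT => t0; rewrite lee_fin.
apply: (le_trans (trig_comb_le _ _ _)).
apply: (le_trans (HK _ t0)); exact: ler_norm.
Qed.

Lemma trig_integral_bounded U V : quad_decay U -> quad_decay V ->
  exists K : R, forall x, `|trig_integral U V x| <= K.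
Proof.
move=> dU dV; have [K K0 HK] := quad_decay2 dU dV.
exists (K * (pi / 2)) => x.
rewrite /trig_integral.
apply: (le_trans (le_normr_Rintegral _ (integrable_trig x dU dV))) => //.
rewrite -Rintegral_invD1sqr; apply: le_Rintegral => //.
- exact: integrable_norm (integrable_trig x dU dV).
- exact: integrable_invD1sqr.
move=> t /=; rewrite in_itv/= andbT => t0.
exact: le_trans (trig_comb_le _ _ _) (HK _ t0).
Qed.

Lemma quad_decayN U : quad_decay U -> quad_decay (fun t => - U t).
Proof.
move=> [mU [K HK]]; split; first exact: measurableT_comp.
by exists K => t t0; rewrite normrN HK.
Qed.

Lemma is_derive_trig_comb (a b t x : R) :
  is_derive x 1 (fun x => a * cos (t * x) + b * sin (t * x))
    (t * b * cos (t * x) + - (t * a) * sin (t * x)).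
Proof.
apply: is_derive_eq.
rewrite /GRing.scale /=; ring.
Qed.

(** Differentiation in x replaces the pair (U, V) by (tV, -tU). The derivative is again a
    trigonometric integral, so the lemma can be iterated as long as the decay lasts. *)
Lemma derivable_trig_integral U V : quad_decay U -> quad_decay V ->
  quad_decay (fun t => t * U t) -> quad_decay (fun t => t * V t) ->
  forall x : R, is_derive x 1 (trig_integral U V)
    (trig_integral (fun t => t * V t) (fun t => - (t * U t)) x).
Proof.
move=> dU dV dtU dtV x.
have [K K0 HK] := quad_decay2 dtU dtV.
pose G t := K * (1 + t ^+ 2)^-1.
pose f (x t : R) := U t * cos (t * x) + V t * sin (t * x).
have Ia : `]x - 1, x + 1[%classic x by rewrite /= in_itv/=; apply/andP; split; lra.
have derf y t : derivable (f ^~ t) y 1.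
  exact: (@ex_derive _ _ _ _ _ _ _ (is_derive_trig_comb (U t) (V t) t y)).
have d1 y t : partial1of2 f y t = t * V t * cos (t * y) + - (t * U t) * sin (t * y).
  by rewrite partial1of2E; exact: (@derive_val _ _ _ _ _ _ _ (is_derive_trig_comb (U t) (V t) t y)).
have G0 t : 0 <= G t by rewrite /G mulr_ge0// invr_ge0 ltW// oneDsqr_pos.
have intf y : `]x - 1, x + 1[%classic y -> mu.-integrable `[0, +oo[ (EFin \o f y).
  by move=> _; exact: integrable_trig.
have dle y t : `]x - 1, x + 1[%classic y -> `[0, +oo[%classic t -> `|partial1of2 f y t| <= G t.
  move=> _; rewrite /= in_itv/= andbT => t0; rewrite d1.
  apply: (le_trans (trig_comb_le _ _ _)); rewrite normrN addrC; exact: HK.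
have mD : measurable (`[0, +oo[%classic : set R) by [].
apply: DeriveDef.
  exact: (@derivable_under_integral _ _ _ mu f _ mD x _ _ Ia intf (fun x y _ _ => derf x y) G G0 (integrable_invD1sqr K) dle).
rewrite -derive1E (@differentiation_under_integral _ _ _ mu f _ mD x _ _ Ia intf (fun x y _ _ => derf x y) G G0 (integrable_invD1sqr K) dle).
by apply: eq_Rintegral => t _; exact: d1.
Qed.

End trig_integral.

Lemma Rintegral_Fubini_dominated {R : realType} {d1 d2 : measure_display}
    {T1 : measurableType d1} {T2 : measurableType d2}
    (m1 : {sigma_finite_measure set T1 -> \bar R})
    (m2 : {sigma_finite_measure set T2 -> \bar R})
    (D : set T1) (f : T1 -> T2 -> R) (a : T1 -> R) (b : T2 -> R) :
  measurable D ->
  measurable_fun setT (fun z : T1 * T2 => f z.1 z.2) ->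
  m1.-integrable D (EFin \o a) -> m2.-integrable setT (EFin \o b) ->
  (forall x y, D x -> `|f x y| <= a x * b y) ->
  \int[m1]_(x in D) \int[m2]_y f x y = \int[m2]_y \int[m1]_(x in D) f x y.
Proof.
move=> mD mf ia ib fab.
(* The indicator moves the restriction to [D] into the integrand, so that Fubini can be used on the
   whole product space. *)
pose F (z : T1 * T2) := (\1_D z.1 * f z.1 z.2)%:E.
have mF : measurable_fun setT F.
  apply/measurable_EFinP; apply: measurable_funM => //.
  apply: (measurableT_comp (f := (\1_D : T1 -> R))) => //; exact: measurable_fst.
have FD y : (fun x => F (x, y)) = (fun x => (f x y)%:E) \_ D.
  by apply/funext => x; rewrite /F /= patchE indicE; case: ifPn => xD; rewrite ?mul1r ?mul0r.
have FD1 x : D x -> (fun y => F (x, y)) = (fun y => (f x y)%:E).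
  by move=> Dx; apply/funext => y; rewrite /F /= indicE mem_set// mul1r.
have FD0 x : ~ D x -> (fun y => F (x, y)) = cst 0%E.
  by move=> Dx; apply/funext => y; rewrite /F /= indicE memNset// mul0r.
have mfx x : measurable_fun setT (f x).
  exact: (measurableT_comp mf (pair1_measurable x)).
have ifx x : D x -> m2.-integrable setT (EFin \o f x).
  move=> Dx; apply: (@le_integrable _ _ _ _ _ _ _ (fun y => (a x)%:E * (b y)%:E)%E) => //.
  - exact/measurable_EFinP.
  - by move=> y _; rewrite -EFinM !abse_EFin lee_fin (le_trans (fab _ y Dx))// ler_norm.
  - exact: integrableZl.
have iF : (m1 \x m2)%E.-integrable setT F.
  apply/(integrable12ltyP m1 m2 mF).
  pose C := fine (\int[m2]_y `|(b y)%:E|)%E.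
  have Cfin : (\int[m2]_y `|(b y)%:E|)%E = C%:E.
    rewrite /C fineK//; apply: (integrable_fin_num (mu := m2) measurableT).
    exact: (integrable_abse ib).
  have : (\int[m1]_x \int[m2]_y `|F (x, y)| <= \int[m1]_(x in D) (`|(a x)%:E| * C%:E))%E.
    rewrite [leRHS]integral_mkcond; apply: ge0_le_integral => //.
    - by move=> x _; exact: integral_ge0.
    - apply: (@measurable_fun_fubini_tonelli_F _ _ _ _ _ m2 (fun z => `|F z|%E)) => //.
      exact: measurableT_comp.
    - apply/(measurable_restrictT _ mD); apply: emeasurable_funM => //.
      by apply: measurableT_comp => //; exact: (measurable_int m1).
    - move=> x _; rewrite patchE; case: ifPn => [/set_mem Dx|/negP].
      + rewrite -Cfin -ge0_integralZl//; last first.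
          by apply: measurableT_comp => //; exact: (measurable_int m2).
        apply: ge0_le_integral => //.
        * by apply: measurableT_comp => //; rewrite FD1//; exact/measurable_EFinP.
        * by apply: emeasurable_funM => //; apply: measurableT_comp => //; exact: (measurable_int m2).
        * move=> y _; rewrite /F /= indicE mem_set// mul1r -?EFinM lee_fin -normrM.
          exact: le_trans (fab _ y Dx) (ler_norm _).
      + rewrite inE => nDx; under eq_integral do rewrite (congr1 (fun h => h _) (FD0 _ nDx)) abse0.
        by rewrite integral0.
  move=> /le_lt_trans; apply.
  rewrite ge0_integralZr//; last 2 first.
  - by apply: measurableT_comp => //; exact: (measurable_int m1).
  - by rewrite -Cfin integral_ge0.
  by rewrite -(fineK (integrable_fin_num mD (integrable_abse ia))) -EFinM ltry.
have := Fubini iF; rewrite /Rintegral => E.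
have L : (\int[m1]_(x in D) (fine (\int[m2]_y (f x y)%:E))%:E = \int[m1]_x \int[m2]_y F (x, y))%E.
  rewrite integral_mkcond; apply: eq_integral => x _; rewrite patchE; case: ifPn => [/set_mem Dx|/negP].
    by rewrite fineK ?FD1// (integrable_fin_num (mu := m2))//; exact: ifx.
  by rewrite inE => nDx; rewrite FD0// integral0.
have Rr : (\int[m2]_y (fine (\int[m1]_(x in D) (f x y)%:E))%:E = \int[m2]_y \int[m1]_x F (x, y))%E.
  apply: eq_integral => y _; rewrite FD -integral_mkcond fineK//.
  apply: (integrable_fin_num (mu := m1)) => //.
  apply: (@le_integrable _ _ _ _ _ _ _ (fun x => (b y)%:E * (a x)%:E)%E) => //.
  - by apply/measurable_EFinP; apply: measurable_funTS; exact: (measurableT_comp mf (pair2_measurable y)).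
  - by move=> x Dx; rewrite -EFinM !abse_EFin lee_fin (le_trans (fab _ y Dx))// mulrC ler_norm.
  - exact: integrableZl.
by rewrite L Rr E.
Qed.

(** * Laplace transforms and the Poisson kernel *)

Section laplace.
Context {R : realType}.
Notation mu := (@lebesgue_measure R).

Lemma cvgy_expRNM (s : R) : 0 < s -> expR (- (s * t)) @[t --> +oo] --> 0.
Proof.
move=> s0; apply: (cvg_comp (fun t => s * t) (fun u => expR (- u)) _ (@cvgr_expR R)).
exact: gt0_cvgMry.
Qed.

Lemma cvgy_expRNM_bounded (s C : R) (g : R -> R) : 0 < s -> (forall t, `|g t| <= C) ->
  expR (- (s * t)) * g t @[t --> +oo] --> 0.
Proof.
move=> s0 gC; apply/cvgr0Pnorm_le => e e0.
have C1 : 0 < C + 1 by rewrite ltr_pwDr// (le_trans _ (gC 0)).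
have /cvgr0Pnorm_le/(_ (e / (C + 1))) H := cvgy_expRNM s0.
have := H (divr_gt0 e0 C1); apply: filterS => t Ht.
rewrite normrM -(@divfK _ (C + 1) _ e) ?gt_eqF//.
apply: ler_pM => //; apply: (le_trans (gC t)); lra.
Qed.

Lemma integral_expRNM (s : R) : 0 < s ->
  (\int[mu]_(t in `[0%R, +oo[) (expR (- (s * t)))%:E = (s^-1)%:E)%E.
Proof.
move=> s0.
pose F t := expR (- (s * t)) * (- s^-1).
have dF (x : R) : is_derive x 1 F (expR (- (s * x))).
  by apply: is_derive_eq; rewrite /GRing.scale /=; field; rewrite gt_eqF.
rewrite (@ge0_continuous_FTC2y _ _ F _ 0).
- by rewrite /F mulr0 oppr0 expR0 mul1r -EFinB sub0r opprK.
- by move=> x _; exact: expR_ge0.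
- apply: continuous_subspaceT => x; apply: differentiable_continuous.
  by apply/derivable1_diffP; exact: ex_derive.
- by apply: (cvgy_expRNM_bounded s0 (C := `|- s^-1|)) => t.
- by move=> x _; exact: ex_derive.
- apply: cvg_at_right_filter; apply: differentiable_continuous.
  by apply/derivable1_diffP; exact: ex_derive.
- by move=> x _; rewrite derive1E; exact: derive_val.
Qed.

Lemma integrable_expRNM (s : R) : 0 < s ->
  mu.-integrable `[0, +oo[ (EFin \o (fun t => expR (- (s * t)))).
Proof.
move=> s0; apply/integrableP; split.
  apply/measurable_EFinP; apply: measurable_funTS; apply: continuous_measurable_fun => x.
  apply: differentiable_continuous.
  by apply/derivable1_diffP; exact: ex_derive.
under eq_integral => t _ do rewrite gee0_abs ?lee_fin ?expR_ge0//.
by rewrite integral_expRNM// ltry.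
Qed.

Lemma integrable_expRNM_cos (s z : R) : 0 < s ->
  mu.-integrable `[0, +oo[ (EFin \o (fun t => expR (- (s * t)) * cos (t * z))).
Proof.
move=> s0; apply: le_integrable (integrable_expRNM s0) => //.
  apply/measurable_EFinP; apply: measurable_funTS; apply: measurable_funM.
    apply: continuous_measurable_fun => x; apply: differentiable_continuous.
    by apply/derivable1_diffP; exact: ex_derive.
  exact: measurable_cosM.
move=> t _ /=; rewrite lee_fin normrM -[leRHS]mulr1; apply: ler_wpM2l => //; exact: cos_norm_le1.
Qed.

(** The right-hand side is, up to a factor pi, the Poisson kernel at height s. *)
Lemma Rintegral_expRNM_cos (s z : R) : 0 < s ->
  \int[mu]_(t in `[0, +oo[) (expR (- (s * t)) * cos (t * z)) = s / (s ^+ 2 + z ^+ 2).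
Proof.
move=> s0.
have sz0 : s ^+ 2 + z ^+ 2 != 0 by rewrite gt_eqF// ltr_pwDl ?sqr_ge0// exprn_gt0.
pose h t := - s^-1 + (z * sin (t * z) - s * cos (t * z)) / (s ^+ 2 + z ^+ 2).
pose F t := expR (- (s * t)) * h t.
have dF (x : R) : is_derive x 1 F (expR (- (s * x)) + expR (- (s * x)) * cos (x * z)).
  apply: is_derive_eq; rewrite /GRing.scale /= /h; field.
  by rewrite sz0 gt_eqF.
(* Adding exp(-st) makes the integrand nonnegative, as the half-line form of the fundamental theorem
   used here requires. Its integral 1/s is cancelled at the end. *)
have I : (\int[mu]_(t in `[0%R, +oo[) (expR (- (s * t)) + expR (- (s * t)) * cos (t * z))%:E =
    (s^-1 + s / (s ^+ 2 + z ^+ 2))%:E)%E.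
  rewrite (@ge0_continuous_FTC2y _ _ F _ 0).
  - rewrite /F /h !(mulr0, mul0r) oppr0 expR0 mul1r sin0 cos0 -EFinB; congr EFin.
    by field; rewrite sz0 gt_eqF.
  - move=> x _; rewrite -[X in X + _]mulr1 -mulrDr mulr_ge0 ?expR_ge0//.
  - apply: continuous_subspaceT => x; apply: differentiable_continuous.
    by apply/derivable1_diffP; exact: ex_derive.
  - apply: (cvgy_expRNM_bounded s0 (C := `|- s^-1| + (`|z| + `|s|) / `|s ^+ 2 + z ^+ 2|)) => t.
    rewrite /h (le_trans (ler_normD _ _))// lerD2l normrM normfV ler_wpM2r ?invr_ge0//.
    rewrite (le_trans (ler_normB _ _))// !normrM lerD//.
      by rewrite -[leRHS]mulr1 ler_wpM2l// sin_norm_le1.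
    by rewrite -[leRHS]mulr1 ler_wpM2l// cos_norm_le1.
  - by move=> x _; exact: ex_derive.
  - apply: cvg_at_right_filter; apply: differentiable_continuous.
    by apply/derivable1_diffP; exact: ex_derive.
  - by move=> x _; rewrite derive1E; exact: derive_val.
have := RintegralD (mu := mu) (D := `[0, +oo[%classic) (measurable_itv _)
  (integrable_expRNM s0) (integrable_expRNM_cos z s0).
rewrite {1}/Rintegral I /= {1}/Rintegral integral_expRNM//= => /addrI <-//.
Qed.

End laplace.

Lemma Rintegral_dominated_cvg {R : realType} {d : measure_display} {T : measurableType d}
    (m : {measure set T -> \bar R}) (D : set T) (f_ : nat -> T -> R) (f g : T -> R) :
  measurable D -> (forall n, measurable_fun D (f_ n)) -> measurable_fun D f ->
  (forall x, D x -> f_ n x @[n --> \oo] --> f x) ->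
  m.-integrable D (EFin \o g) -> (forall n x, D x -> `|f_ n x| <= g x) ->
  \int[m]_(x in D) f_ n x @[n --> \oo] --> \int[m]_(x in D) f x.
Proof.
move=> mD mf_ mf f_f ig f_g.
have fin_near (u : nat -> R) : \forall n \near \oo, (u n)%:E \is a fin_num by exact: nearW.
have [If _ H] := @dominated_convergence _ _ _ m D mD (fun n => EFin \o f_ n) (EFin \o f)
  (EFin \o g) (fun n => (measurable_EFinP _ _).2 (mf_ n)) ((measurable_EFinP _ _).2 mf)
  (aeW _ (fun x Dx => cvg_EFin (fin_near (f_^~ x)) (f_f x Dx))) ig
  (aeW _ (fun x n Dx => (f_g n x Dx))).
by move: H; rewrite -(fineK (integrable_fin_num mD If)) => /fine_cvg.
Qed.

Lemma integrable_mul_bounded {R : realType} {d : measure_display} {T : measurableType d}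
    (m : {measure set T -> \bar R}) (W g : T -> R) (C : R) :
  m.-integrable setT (EFin \o W) -> measurable_fun setT g -> (forall w, `|g w| <= C) ->
  m.-integrable setT (EFin \o (fun w => W w * g w)).
Proof.
move=> iW mg gC.
have mW : measurable_fun setT W by apply/measurable_EFinP; exact: (measurable_int m).
apply: (@le_integrable _ _ _ _ _ _ _ (fun w => C%:E * (W w)%:E)%E) => //.
- by apply/measurable_EFinP; apply: measurable_funM.
- move=> w _; rewrite -EFinM !abse_EFin lee_fin !normrM mulrC ler_wpM2r//.
  exact: le_trans (gC w) (ler_norm _).
- exact: integrableZl.
Qed.

Lemma measurable_expRNM {R : realType} (s : R) : measurable_fun setT (fun t : R => expR (- (s * t))).
Proof.
apply: continuous_measurable_fun => x; apply: differentiable_continuous.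
by apply/derivable1_diffP; exact: ex_derive.
Qed.

Lemma expRNM_le1 {R : realType} (s t : R) : 0 <= s -> 0 <= t -> `|expR (- (s * t))| <= 1.
Proof. by move=> s0 t0; rewrite ger0_norm ?expR_ge0// expR_le1 oppr_le0 mulr_ge0. Qed.

Lemma quad_decay_expRNM {R : realType} (s : R) (f : R -> R) : 0 <= s -> quad_decay f ->
  quad_decay (fun t => expR (- (s * t)) * f t).
Proof.
move=> s0 [mf [K HK]]; split.
  by apply: measurable_funM => //; exact: measurable_expRNM.
exists K => t t0; rewrite normrM; apply: le_trans (HK t t0).
by rewrite -[leRHS]mul1r ler_wpM2r// expRNM_le1.
Qed.

Lemma atan_norm_le {R : realType} (x : R) : `|atan x| <= pi / 2.
Proof. by rewrite ler_norml !ltW ?atan_gtNpi2 ?atan_ltpi2. Qed.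

Lemma is_derive1_continuous {R : realType} (f g : R -> R) : (forall x : R, is_derive x 1 f (g x)) -> continuous f.
Proof.
move=> df x; apply: differentiable_continuous; apply/derivable1_diffP.
exact: (@ex_derive _ _ _ _ _ _ _ (df x)).
Qed.

(** * Fourier inversion for a weighted law *)

Section inversion.
Context {R : realType} {d : measure_display} {T : measurableType d}.
Variables (P : probability T R) (Y W : T -> R).
Hypotheses (mY : measurable_fun setT Y) (iW : P.-integrable setT (EFin \o W)).
Hypothesis W0 : forall w, 0 <= W w.
Notation mu := (@lebesgue_measure R).
Let U t := \int[P]_w (W w * cos (t * Y w)).
Let V t := \int[P]_w (W w * sin (t * Y w)).
Hypotheses (dU : quad_decay U) (dV : quad_decay V).
Hypotheses (dtU : quad_decay (fun t => t * U t)) (dtV : quad_decay (fun t => t * V t)).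
Let mW : measurable_fun setT W.
Proof. by apply/measurable_EFinP; exact: (measurable_int P). Qed.

Let eU s t := expR (- (s * t)) * U t.
Let eV s t := expR (- (s * t)) * V t.

Lemma is_derive_regularized s : 0 <= s -> forall x : R,
  is_derive x 1 (trig_integral (eU s) (eV s))
    (trig_integral (fun t => t * eV s t) (fun t => - (t * eU s t)) x).
Proof.
move=> s0; apply: derivable_trig_integral; [exact: quad_decay_expRNM|exact: quad_decay_expRNM| |].
  rewrite (_ : (fun t => t * eU s t) = fun t => expR (- (s * t)) * (t * U t)).
    exact: quad_decay_expRNM.
  by apply/funext => t; rewrite /eU mulrCA.
rewrite (_ : (fun t => t * eV s t) = fun t => expR (- (s * t)) * (t * V t)).
  exact: quad_decay_expRNM.
by apply/funext => t; rewrite /eV mulrCA.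
Qed.

Lemma measurable_cosMY t : measurable_fun setT (fun w => cos (t * Y w)).
Proof.
apply: (measurableT_comp (f := (@cos R))); first by apply: continuous_measurable_fun; exact: continuous_cos.
exact: measurable_funM.
Qed.

Lemma measurable_sinMY t : measurable_fun setT (fun w => sin (t * Y w)).
Proof.
apply: (measurableT_comp (f := (@sin R))); first by apply: continuous_measurable_fun; exact: continuous_sin.
exact: measurable_funM.
Qed.

Lemma integrable_Wcos t : P.-integrable setT (EFin \o (fun w => W w * cos (t * Y w))).
Proof.
apply: (integrable_mul_bounded iW (C := 1)); first exact: measurable_cosMY.
by move=> w; exact: cos_norm_le1.
Qed.

Lemma integrable_Wsin t : P.-integrable setT (EFin \o (fun w => W w * sin (t * Y w))).
Proof.
apply: (integrable_mul_bounded iW (C := 1)); first exact: measurable_sinMY.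
by move=> w; exact: sin_norm_le1.
Qed.

(** By the subtraction formula for the cosine, the integrand is the expectation of W exp(-st)
    cos(t(x - Y)). It is dominated by exp(-st) W, so the integrals can be exchanged, and the inner
    one is the Poisson kernel. *)
Lemma poisson_trig_integral s x : 0 < s ->
  trig_integral (eU s) (eV s) x = \int[P]_w (W w * (s / (s ^+ 2 + (x - Y w) ^+ 2))).
Proof.
move=> s0.
pose f t w := expR (- (s * t)) * (W w * cos (t * (x - Y w))).
transitivity (\int[mu]_(t in `[0, +oo[) \int[P]_w f t w).
  apply: eq_Rintegral => t _; rewrite /eU /eV /U /V.
  have E w : f t w = expR (- (s * t)) * cos (t * x) * (W w * cos (t * Y w)) +
      expR (- (s * t)) * sin (t * x) * (W w * sin (t * Y w)).
    by rewrite /f mulrBr cosB; ring.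
  under [RHS]eq_Rintegral do rewrite E.
  rewrite RintegralD//.
  - rewrite !RintegralZl//; [ring|exact: integrable_Wsin|exact: integrable_Wcos].
  - exact: (integrableZl measurableT _ (integrable_Wcos t)).
  - exact: (integrableZl measurableT _ (integrable_Wsin t)).
rewrite (Rintegral_Fubini_dominated (m1 := mu) (m2 := P) (a := fun t => expR (- (s * t))) (b := W)) //.
- apply: eq_Rintegral => w _; rewrite -Rintegral_expRNM_cos// -RintegralZl//.
    by apply: eq_Rintegral => t _; rewrite /f mulrCA.
  exact: integrable_expRNM_cos.
- apply: measurable_funM.
    by apply: (measurableT_comp (measurable_expRNM s)); exact: measurable_fst.
  apply: measurable_funM; first by apply: (measurableT_comp mW); exact: measurable_snd.
  apply: (measurableT_comp (f := (@cos R))); first by apply: continuous_measurable_fun; exact: continuous_cos.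
  apply: measurable_funM; first exact: measurable_fst.
  apply: measurable_funB => //; apply: (measurableT_comp mY); exact: measurable_snd.
- exact: integrable_expRNM.
- move=> t w _; rewrite /f !normrM ger0_norm ?expR_ge0// ler_wpM2l ?expR_ge0//.
  by rewrite ger0_norm// -[leRHS]mulr1 ler_wpM2l// cos_norm_le1.
Qed.

Let H s x := \int[P]_w (W w * atan ((x - Y w) / s)).

Lemma measurable_atanY s x : measurable_fun setT (fun w => atan ((x - Y w) / s)).
Proof.
apply: (measurableT_comp (f := (@atan R))); first by apply: continuous_measurable_fun; exact: continuous_atan.
by apply: measurable_funM => //; apply: measurable_funB.
Qed.

Lemma integrable_Watan s x : P.-integrable setT (EFin \o (fun w => W w * atan ((x - Y w) / s))).
Proof.
apply: (integrable_mul_bounded iW (C := pi / 2)); first exact: measurable_atanY.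
by move=> w; exact: atan_norm_le.
Qed.

(** The arctangent of (x - Y)/s is a primitive in x of the Poisson kernel, so [H s] is a primitive
    of the regularized integral. *)
Lemma is_derive_atan_average s (x : R) : 0 < s ->
  is_derive x 1 (H s) (trig_integral (eU s) (eV s) x).
Proof.
move=> s0.
pose f x w := W w * atan ((x - Y w) / s).
have df (y : R) w : is_derive y 1 (fun y => f y w) (W w * (s / (s ^+ 2 + (y - Y w) ^+ 2))).
  have sz0 : s ^+ 2 + (y - Y w) ^+ 2 != 0 by rewrite gt_eqF// ltr_pwDl ?sqr_ge0// exprn_gt0.
  have sz1 : 1 + ((y - Y w) / s) ^+ 2 != 0 by rewrite gt_eqF// oneDsqr_pos.
  rewrite /f; apply: is_derive_eq; rewrite /GRing.scale /=; field.
  by rewrite sz0 gt_eqF.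
have Ia : `]x - 1, x + 1[%classic x by rewrite /= in_itv/=; apply/andP; split; lra.
have d1 y w : partial1of2 f y w = W w * (s / (s ^+ 2 + (y - Y w) ^+ 2)).
  by rewrite partial1of2E; exact: (@derive_val _ _ _ _ _ _ _ (df y w)).
(* 1/s is the maximum of s / (s^2 + z^2) over z, attained at z = 0. *)
pose G w := W w * s^-1.
have G0 w : 0 <= G w by rewrite /G mulr_ge0// invr_ge0 ltW.
have iG : P.-integrable setT (EFin \o G).
  by apply: (integrable_mul_bounded iW (C := `|s^-1|)).
have dle y w : `]x - 1, x + 1[%classic y -> [set: T] w -> `|partial1of2 f y w| <= G w.
  move=> _ _; rewrite d1 /G normrM ger0_norm// ler_wpM2l//.
  have sz0 : 0 < s ^+ 2 + (y - Y w) ^+ 2 by rewrite ltr_pwDl ?sqr_ge0// exprn_gt0.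
  have q0 : 0 <= s / (s ^+ 2 + (y - Y w) ^+ 2) by rewrite divr_ge0// ltW.
  rewrite ger0_norm// ler_pdivrMr// mulrDr.
  have -> : s^-1 * s ^+ 2 = s by field; rewrite gt_eqF.
  by rewrite lerDl mulr_ge0 ?sqr_ge0// invr_ge0 ltW.
have intf y : `]x - 1, x + 1[%classic y -> P.-integrable setT (EFin \o f y).
  by move=> _; exact: integrable_Watan.
have derf (y : R) w : `]x - 1, x + 1[%classic y -> [set: T] w -> derivable (f ^~ w) y 1.
  by move=> _ _; exact: (@ex_derive _ _ _ _ _ _ _ (df y w)).
apply: DeriveDef.
  exact: (@derivable_under_integral _ _ _ P f _ measurableT x _ _ Ia intf derf G G0 iG dle).
rewrite -derive1E (@differentiation_under_integral _ _ _ P f _ measurableT x _ _ Ia intf derf G G0 iG dle).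
rewrite poisson_trig_integral//.
by apply: eq_Rintegral => w _; exact: d1.
Qed.

Lemma Rintegral_regularized s a b : 0 < s -> a < b ->
  \int[mu]_(x in `[a, b]) trig_integral (eU s) (eV s) x =
  \int[P]_w (W w * (atan ((b - Y w) / s) - atan ((a - Y w) / s))).
Proof.
move=> s0 ab.
have cH := is_derive1_continuous (fun x => is_derive_atan_average x s0).
rewrite {1}/Rintegral (@continuous_FTC2 _ _ (H s))//.
- rewrite /= /H -RintegralB//; try exact: integrable_Watan.
  by apply: eq_Rintegral => w _; rewrite mulrBr.
- apply: continuous_subspaceT.
  exact: is_derive1_continuous (is_derive_regularized (ltW s0)).
- split.
  + by move=> x _; exact: (@ex_derive _ _ _ _ _ _ _ (is_derive_atan_average x s0)).
  + by apply: cvg_at_right_filter; exact: cH.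
  + by apply: cvg_at_left_filter; exact: cH.
- by move=> x _; rewrite derive1E; exact: (@derive_val _ _ _ _ _ _ _ (is_derive_atan_average x s0)).
Qed.

End inversion.

(** At z = 0 the limit is 0, halfway between the two other values. This is why endpoints of
    intervals are counted with half weight below. *)
Lemma cvg_atan_sgr {R : realType} (z : R) : atan (z / n.+1%:R^-1) @[n --> \oo] --> Num.sg z * (pi / 2).
Proof.
have key (y : R) : 0 < y -> atan (y / n.+1%:R^-1) @[n --> \oo] --> pi / 2.
  move=> y0; under eq_fun do rewrite invrK.
  have L : y * n.+1%:R @[n --> \oo] --> +oo.
    apply: (@cvg_comp _ _ _ (fun n : nat => n.+1%:R : R) (fun u => y * u) _ +oo%R).
      by have := @cvgr_idn R; rewrite -cvg_shiftS.
    exact: gt0_cvgMry.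
  exact: (cvg_comp _ _ L (@cvgy_atan R)).
have [z0|z0|->] := ltgtP z 0.
- rewrite ltr0_sg// mulN1r.
  have -> : (fun n : nat => atan (z / n.+1%:R^-1)) = (fun n => - atan (- z / n.+1%:R^-1)).
    by apply/funext => n; rewrite mulNr atanN opprK.
  by apply: cvgN; apply: key; rewrite oppr_gt0.
- by rewrite gtr0_sg// mul1r; exact: key.
- rewrite sgr0 mul0r; under eq_fun do rewrite mul0r atan0; exact: cvg_cst.
Qed.

Section inversion_limit.
Context {R : realType} {d : measure_display} {T : measurableType d}.
Variables (P : probability T R) (Y W : T -> R).
Hypotheses (mY : measurable_fun setT Y) (iW : P.-integrable setT (EFin \o W)).
Hypothesis W0 : forall w, 0 <= W w.
Notation mu := (@lebesgue_measure R).
Let U t := \int[P]_w (W w * cos (t * Y w)).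
Let V t := \int[P]_w (W w * sin (t * Y w)).
Hypotheses (dU : quad_decay U) (dV : quad_decay V).
Hypotheses (dtU : quad_decay (fun t => t * U t)) (dtV : quad_decay (fun t => t * V t)).
Let r := trig_integral U V.

Let mW : measurable_fun setT W.
Proof. by apply/measurable_EFinP; exact: (measurable_int P). Qed.

Let r_continuous : continuous r.
Proof.
exact: is_derive1_continuous (derivable_trig_integral dU dV dtU dtV).
Qed.

Let eU s t := expR (- (s * t)) * U t.
Let eV s t := expR (- (s * t)) * V t.

Let cvg_trig_integral (x : R) :
  trig_integral (eU n.+1%:R^-1) (eV n.+1%:R^-1) x @[n --> \oo] --> r x.
Proof.
have [K K0 HK] := quad_decay2 dU dV.
have s0 n : 0 <= n.+1%:R^-1 :> R by rewrite invr_ge0.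
rewrite /r /trig_integral.
apply: (@Rintegral_dominated_cvg _ _ _ mu _ (fun n t => eU n.+1%:R^-1 t * cos (t * x) + eV n.+1%:R^-1 t * sin (t * x)) _ (fun t => K * (1 + t ^+ 2)^-1)) => //.
- move=> n; apply: measurable_funTS; apply: measurable_trig_comb.
    by have [] := quad_decay_expRNM (s0 n) dU.
  by have [] := quad_decay_expRNM (s0 n) dV.
- by apply: measurable_funTS; apply: measurable_trig_comb; [case: dU|case: dV].
- move=> t _.
  have E : expR (- (n.+1%:R^-1 * t)) @[n --> \oo] --> (1 : R).
    have E0 : expR (- (n.+1%:R^-1 * t)) @[n --> \oo] --> expR (- (0 * t) : R).
      apply: (continuous_cvg _ (@continuous_expR R _)).
      by apply: cvgN; apply: cvgM; [exact: cvg_harmonic|exact: cvg_cst].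
    by move: E0; rewrite mul0r oppr0 expR0.
  rewrite -[X in _ --> X]mul1r mulrDr.
  under eq_fun do rewrite /eU /eV -!mulrA.
  by apply: cvgD; apply: cvgM => //; exact: cvg_cst.
- exact: integrable_invD1sqr.
- move=> n t /=; rewrite in_itv/= andbT => t0.
  apply: (le_trans (trig_comb_le _ _ _)); apply: le_trans (HK _ t0).
  by rewrite lerD// normrM -[leRHS]mul1r ler_wpM2r// expRNM_le1.
Qed.

(** Both sides of [Rintegral_regularized] are passed to the limit along s = 1/(n + 1) by dominated
    convergence, the left with a constant majorant on [a, b], the right with pi W. *)
Lemma Rintegral_trig_integral_sgr a b : a < b ->
  \int[mu]_(x in `[a, b]) r x =
  \int[P]_w (W w * (Num.sg (b - Y w) * (pi / 2) - Num.sg (a - Y w) * (pi / 2))).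
Proof.
move=> ab.
have [K K0 HK] := quad_decay2 dU dV.
have s0 n : 0 < n.+1%:R^-1 :> R by rewrite invr_gt0.
have L : \int[mu]_(x in `[a, b]) trig_integral (eU n.+1%:R^-1) (eV n.+1%:R^-1) x @[n --> \oo]
    --> \int[mu]_(x in `[a, b]) r x.
  apply: (@Rintegral_dominated_cvg _ _ _ mu _ (fun n => trig_integral (eU n.+1%:R^-1) (eV n.+1%:R^-1)) _ (cst (K * (pi / 2)))) => //.
  - move=> n; apply: measurable_funTS; apply: continuous_measurable_fun.
    exact: is_derive1_continuous (is_derive_regularized dU dV dtU dtV (ltW (s0 n))).
  - by apply: measurable_funTS; exact: continuous_measurable_fun.
  - apply: continuous_compact_integrable; first exact: segment_compact.
    by apply: continuous_subspaceT; exact: cst_continuous.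
  - move=> n x _; have eUd := quad_decay_expRNM (ltW (s0 n)) dU; have eVd := quad_decay_expRNM (ltW (s0 n)) dV.
    rewrite /trig_integral; apply: (le_trans (le_normr_Rintegral _ (integrable_trig x eUd eVd))) => //.
    rewrite -Rintegral_invD1sqr; apply: le_Rintegral => //.
    + exact: integrable_norm (integrable_trig x eUd eVd).
    + exact: integrable_invD1sqr.
    move=> t /=; rewrite in_itv/= andbT => t0.
    apply: le_trans (trig_comb_le _ _ _) _; apply: le_trans (HK _ t0).
    by rewrite lerD// normrM -[leRHS]mul1r ler_wpM2r// expRNM_le1// ltW.
have RR : \int[P]_w (W w * (atan ((b - Y w) / n.+1%:R^-1) - atan ((a - Y w) / n.+1%:R^-1))) @[n --> \oo]
    --> \int[P]_w (W w * (Num.sg (b - Y w) * (pi / 2) - Num.sg (a - Y w) * (pi / 2))).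
  have mat n : measurable_fun setT (fun w => W w * (atan ((b - Y w) / n.+1%:R^-1) - atan ((a - Y w) / n.+1%:R^-1))).
    by apply: measurable_funM => //; apply: measurable_funB; exact: measurable_atanY.
  have ptw w : W w * (atan ((b - Y w) / n.+1%:R^-1) - atan ((a - Y w) / n.+1%:R^-1)) @[n --> \oo]
     --> W w * (Num.sg (b - Y w) * (pi / 2) - Num.sg (a - Y w) * (pi / 2)).
    by apply: cvgM; [exact: cvg_cst|apply: cvgB; exact: cvg_atan_sgr].
  apply: (@Rintegral_dominated_cvg _ _ _ P _ _ _ (fun w => W w * pi)) => //.
  - by apply: (measurable_fun_cvg mat) => w _; exact: ptw.
  - exact: (integrable_mul_bounded iW (C := `|pi|)).
  - move=> n w _; rewrite normrM ger0_norm// ler_wpM2l//.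
    apply: (le_trans (ler_normB _ _)); rewrite [leRHS](splitr pi).
    by rewrite lerD// atan_norm_le.
apply: (cvg_unique _ L); last first.
  have E : (fun n : nat => \int[mu]_(x in `[a, b]) trig_integral (eU n.+1%:R^-1) (eV n.+1%:R^-1) x) =
      (fun n => \int[P]_w (W w * (atan ((b - Y w) / n.+1%:R^-1) - atan ((a - Y w) / n.+1%:R^-1)))).
    by apply/funext => n; exact: Rintegral_regularized.
  by move: RR; rewrite -E.
exact: Rhausdorff.
Qed.

End inversion_limit.

Lemma integrable_continuous_itv {R : realType} (f : R -> R) (a b : R) : continuous f ->
  lebesgue_measure.-integrable `[a, b] (EFin \o f).
Proof.
move=> cf; apply: continuous_compact_integrable; first exact: segment_compact.
exact: continuous_subspaceT.
Qed.

Lemma Rintegral_cst_itv {R : realType} (a b K : R) : a <= b ->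
  \int[lebesgue_measure]_(x in `[a, b]) K = K * (b - a).
Proof.
move=> ab; transitivity (K * fine (lebesgue_measure (`[a, b]%classic : set R))).
  exact: Rintegral_cst.
rewrite lebesgue_measure_itv/= lte_fin.
by case: ltP => [_|ba] //=; rewrite (@le_anti _ _ a b) ?ab// subrr.
Qed.

Lemma le_Rintegral_itv_cst {R : realType} (f : R -> R) (a b K : R) : continuous f -> a <= b ->
  (forall x, a <= x <= b -> f x <= K) ->
  \int[lebesgue_measure]_(x in `[a, b]) f x <= K * (b - a).
Proof.
move=> cf ab fK; rewrite -Rintegral_cst_itv//; apply: le_Rintegral => //.
- exact: integrable_continuous_itv.
- by apply: integrable_continuous_itv; exact: cst_continuous.
Qed.

(** A negative value f x would keep f below f x / 2 on a short interval to the right of x, whose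
    integral would then be negative. *)
Lemma continuous_ge0_of_Rintegral {R : realType} (f : R -> R) (x e : R) : continuous f -> 0 < e ->
  (forall b, x < b -> b < x + e -> 0 <= \int[lebesgue_measure]_(y in `[x, b]) f y) -> 0 <= f x.
Proof.
move=> cf e0 H; rewrite leNgt; apply/negP => fx.
have /cvgrPdist_lt/(_ (- f x / 2)) := cf x.
have fx2 : 0 < - f x / 2 by rewrite divr_gt0// oppr_gt0.
move=> /(_ fx2) /nbhs_ballP[dl /= dl0 Hd].
pose m := Num.min dl e / 2.
have m0 : 0 < m by rewrite /m divr_gt0// lt_min dl0 e0.
have min_e : Num.min dl e <= e by rewrite ge_min lexx orbT.
have min_d : Num.min dl e <= dl by rewrite ge_min lexx.
have me : m < e by rewrite /m; lra.
have md : m < dl by rewrite /m; lra.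
have := H (x + m); rewrite ltrDl ltrD2l => /(_ m0 me).
apply/negP; rewrite -ltNge.
apply: (@le_lt_trans _ _ (f x / 2 * (x + m - x))).
  apply: le_Rintegral_itv_cst => //; first by rewrite lerDl ltW.
  move=> y /andP[xy yx].
  have bxy : `|x - y| < dl by rewrite distrC ger0_norm ?subr_ge0//; lra.
  by have := Hd y bxy; rewrite /= distrC => /ltr_normlW; lra.
have -> : f x / 2 * (x + m - x) = - (- f x / 2 * m) by ring.
by rewrite oppr_lt0 mulr_gt0.
Qed.

Section inversion_formula.
Context {R : realType} {d : measure_display} {T : measurableType d}.
Variables (P : probability T R) (Y W : T -> R).
Hypotheses (mY : measurable_fun setT Y) (iW : P.-integrable setT (EFin \o W)).
Hypothesis W0 : forall w, 0 <= W w.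
Notation mu := (@lebesgue_measure R).
Let U t := \int[P]_w (W w * cos (t * Y w)).
Let V t := \int[P]_w (W w * sin (t * Y w)).
Hypotheses (dU : quad_decay U) (dV : quad_decay V).
Hypotheses (dtU : quad_decay (fun t => t * U t)) (dtV : quad_decay (fun t => t * V t)).
Let r := trig_integral U V.

Let r_continuous : continuous r.
Proof.
exact: is_derive1_continuous (derivable_trig_integral dU dV dtU dtV).
Qed.

Let M A := \int[P]_w (W w * \1_A (Y w)).

Lemma integrable_Windic A : measurable A ->
  P.-integrable setT (EFin \o (fun w => W w * \1_A (Y w))).
Proof.
move=> mA; apply: (integrable_mul_bounded iW (C := 1)).
  exact: (measurableT_comp (f := (\1_A : R -> R))).
by move=> w; rewrite indicE; case: (_ \in _); rewrite ?normr1 ?normr0.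
Qed.

Let integrable_sgr a b : P.-integrable setT
  (EFin \o (fun w => W w * (Num.sg (b - Y w) * (pi / 2) - Num.sg (a - Y w) * (pi / 2)))).
Proof.
apply: (integrable_mul_bounded iW (C := pi)).
  have msg c : measurable_fun setT (fun w => Num.sg (c - Y w) * (pi / 2)).
    apply: (@measurable_fun_cvg _ _ _ _ (fun n w => atan ((c - Y w) / n.+1%:R^-1))).
      by move=> n; exact: measurable_atanY.
    by move=> w _; exact: cvg_atan_sgr.
  exact: measurable_funB.
move=> w; apply: (le_trans (ler_normB _ _)); rewrite [leRHS](splitr pi).
have h c : `|Num.sg (c - Y w) * (pi / 2)| <= pi / 2.
  rewrite normrM (ger0_norm (_ : 0 <= pi / 2)) ?divr_ge0 ?pi_ge0//.
  rewrite -[leRHS]mul1r ler_wpM2r ?divr_ge0 ?pi_ge0// normr_sg.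
  by case: (_ != 0).
by rewrite lerD.
Qed.

(** The sign differences count both endpoints with half weight; the two singleton terms convert this
    to the half-open interval. *)
Let sgr_indic (a b y : R) : a < b ->
  Num.sg (b - y) * (pi / 2) - Num.sg (a - y) * (pi / 2) =
  pi * \1_`]a, b] y + (pi / 2) * \1_[set a] y - (pi / 2) * \1_[set b] y.
Proof.
move=> ab; rewrite !indicE.
have -> : (y \in `]a, b]%classic) = (a < y <= b) by rewrite mem_setE in_itv.
have -> : (y \in [set a]) = (y == a) by apply/idP/eqP; rewrite inE.
have -> : (y \in [set b]) = (y == b) by apply/idP/eqP; rewrite inE.
have [ya|ya|->] := ltgtP y a.
- rewrite gtr0_sg ?gtr0_sg ?subr_gt0//; last exact: lt_trans ab.
  by rewrite (lt_eqF (lt_trans ya ab))/=; lra.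
- rewrite (ltr0_sg (_ : a - y < 0)) ?subr_lt0//.
  have [yb|yb|->] := ltgtP y b.
  + by rewrite gtr0_sg ?subr_gt0//=; lra.
  + by rewrite ltr0_sg ?subr_lt0//=; lra.
  + by rewrite subrr sgr0/=; lra.
- by rewrite subrr sgr0 gtr0_sg ?subr_gt0// (lt_eqF ab)/=; lra.
Qed.

(** An atom at a forces the integral of r over [a - e, a + e] to be at least pi, hence at least 2,
    times its mass for every e, whereas boundedness of r makes that integral O(e). *)
Let atomless a : M [set a] = 0.
Proof.
have [K HK] := trig_integral_bounded dU dV.
have M0 : 0 <= M [set a].
  by apply: Rintegral_ge0 => w _; rewrite mulr_ge0// indicE.
apply/eqP; rewrite eq_le M0 andbT leNgt; apply/negP => Mgt0.
have K0 : 0 <= K by apply: le_trans (HK 0).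
(* With this radius 2 K e is at most the mass of the atom, contradicting the lower bound by twice
   the mass. K + 1 keeps the denominator positive when K = 0. *)
pose e := M [set a] / (2 * (K + 1)).
have e0 : 0 < e by rewrite divr_gt0// mulr_gt0// ltr_wpDl.
have ae : a - e < a + e by lra.
have h1 : \int[mu]_(x in `[a - e, a + e]) r x <= K * (a + e - (a - e)).
  apply: le_Rintegral_itv_cst => //; first exact: ltW.
  by move=> x _; exact: le_trans (ler_norm _) (HK x).
have h2 : 2 * M [set a] <= \int[mu]_(x in `[a - e, a + e]) r x.
  rewrite /r (Rintegral_trig_integral_sgr mY iW W0 dU dV dtU dtV ae).
  rewrite -RintegralZl//; last exact: integrable_Windic.
  apply: le_Rintegral => //; first exact: (integrableZl measurableT _ (integrable_Windic (measurable_set1 a))).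
  move=> w _; rewrite mulrCA ler_wpM2l//.
  have pi2 := pi_ge2 R.
  rewrite sgr_indic// !indicE.
  have -> : (Y w \in [set a]) = (Y w == a) by apply/idP/eqP; rewrite inE.
  have -> : (Y w \in `]a - e, a + e]%classic) = (a - e < Y w <= a + e) by rewrite mem_setE in_itv.
  have -> : (Y w \in [set a - e]) = (Y w == a - e) by apply/idP/eqP; rewrite inE.
  have -> : (Y w \in [set a + e]) = (Y w == a + e) by apply/idP/eqP; rewrite inE.
  have [->|_] := eqVneq (Y w) a.
    have -> : a - e < a <= a + e by apply/andP; split; lra.
    have -> : (a == a - e) = false by apply: gt_eqF; lra.
    have -> : (a == a + e) = false by apply: lt_eqF; lra.
    by rewrite /=; lra.
  have [->|_] := eqVneq (Y w) (a + e).
    by rewrite ae lexx (gt_eqF ae)/=; lra.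
  by case: (_ && _); case: (_ == _) => /=; lra.
have : 2 * M [set a] <= K * (a + e - (a - e)) by exact: le_trans h2 h1.
have -> : K * (a + e - (a - e)) = 2 * (K * e) by ring.
have : K * e <= M [set a] / 2.
  have K1 : K + 1 != 0 by rewrite gt_eqF// ltr_wpDl.
  have -> : M [set a] / 2 = K * e + e by rewrite /e; field.
  lra.
lra.
Qed.

Lemma inversion_formula a b : a < b ->
  \int[mu]_(x in `[a, b]) r x = pi * \int[P]_w (W w * \1_`]a, b] (Y w)).
Proof.
move=> ab; rewrite /r (Rintegral_trig_integral_sgr mY iW W0 dU dV dtU dtV ab).
transitivity (\int[P]_w (pi * (W w * \1_`]a, b] (Y w)) +
    (pi / 2) * (W w * \1_[set a] (Y w)) - (pi / 2) * (W w * \1_[set b] (Y w)))).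
  by apply: eq_Rintegral => w _; rewrite sgr_indic//; ring.
have i1 c A : measurable A -> P.-integrable setT (EFin \o (fun w => c * (W w * \1_A (Y w)))).
  by move=> mA; exact: (integrableZl measurableT _ (integrable_Windic mA)).
rewrite RintegralB//; [|exact: (integrableD measurableT (i1 _ _ _) (i1 _ _ _))|exact: i1].
rewrite RintegralD//; [|exact: i1|exact: i1].
have z c : \int[P]_w (pi / 2 * (W w * \1_[set c] (Y w))) = 0.
  by rewrite RintegralZl//; [rewrite -/(M [set c]) atomless mulr0|exact: integrable_Windic].
by rewrite !z subr0 addr0 RintegralZl//; exact: integrable_Windic.
Qed.

End inversion_formula.

Lemma RintegralZl_itv {R : realType} (f : R -> R) (a b c : R) : continuous f ->
  \int[lebesgue_measure]_(x in `[a, b]) (c * f x) =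
  c * \int[lebesgue_measure]_(x in `[a, b]) f x.
Proof. by move=> cf; rewrite RintegralZl//; exact: integrable_continuous_itv. Qed.

(** * Densities determined by their integrals over intervals *)

Section density_measure.
Context {R : realType} (p : R -> R) (p_ge0 : forall x, 0 <= p x).
Hypothesis mp : measurable_fun setT p.

Definition density_measure (A : set R) : \bar R :=
  (\int[lebesgue_measure]_(x in A) (p x)%:E)%E.

Let density0 : density_measure set0 = 0%E.
Proof. by rewrite /density_measure integral_set0. Qed.

Let density_ge0 A : (0 <= density_measure A)%E.
Proof. by apply: integral_ge0 => x _; rewrite lee_fin. Qed.

Let density_sigma_additive : semi_sigma_additive density_measure.
Proof.
move=> /= A mA tA mUA.
rewrite /density_measure ge0_integral_bigcup//=.
- by apply: is_cvg_ereal_nneg_natsum_cond => n _ _; exact: density_ge0.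
- by apply/measurable_EFinP; exact: measurable_funTS.
- by move=> x _; rewrite lee_fin.
Qed.

HB.instance Definition _ := isMeasure.Build _ _ _
  density_measure density0 density_ge0 density_sigma_additive.

(** The half-open intervals are stable under intersection and generate the Borel sets, and the
    intervals ]-n, n], of finite measure, exhaust the line. *)
Lemma density_measure_unique (nu : {measure set R -> \bar R}) :
  (forall a b, a < b -> nu `]a, b]%classic = density_measure `]a, b]%classic) ->
  (forall a b, (nu `]a, b]%classic < +oo)%E) ->
  forall A, measurable A -> nu A = density_measure A.
Proof.
move=> H nuoo A mA.
apply: (@measure_unique _ _ R (@ocitv R) (fun n => `]- n%:R, n%:R]%classic)) => //.
- exact: ocitvI.
- by move=> n; exact: is_ocitv.
- apply/seteqP; split => // x _; exists (Num.bound `|x|) => //=.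
  have := archi_boundP (normr_ge0 x); rewrite ltr_norml => /andP[xn nx].
  by rewrite in_itv/= xn ltW.
- move=> _ [[a b] _ <-] /=; have [ab|ba] := ltP a b; first exact: H.
  by rewrite set_itv_ge ?bnd_simp -?leNgt// !measure0.
Qed.

End density_measure.

Lemma is_density_of_itv {R : realType} {d : measure_display} {T : measurableType d}
    (P : probability T R) (Y : {RV P >-> R}) (p : R -> R) :
  (forall x, 0 <= p x) -> continuous p ->
  (forall a b, a < b ->
    \int[lebesgue_measure]_(x in `[a, b]) p x = fine (P (Y @^-1` `]a, b]))) ->
  is_density P Y p.
Proof.
move=> p0 cp H; have mp := continuous_measurable_fun cp.
split => //; split => // A mA.
change (distribution P Y A = density_measure p A).
apply: (density_measure_unique p0 mp) => //.
- move=> a b ab; rewrite /density_measure /distribution /pushforward.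
  rewrite integral_itv_obnd_cbnd; last first.
    by apply/measurable_EFinP; exact: measurable_funTS.
  have fin_p : (\int[lebesgue_measure]_(x in `[a, b]) (p x)%:E)%E \is a fin_num.
    by apply: integrable_fin_num => //; exact: integrable_continuous_itv.
  rewrite -(fineK fin_p).
  have mYab : measurable (Y @^-1` `]a, b]).
    by rewrite -[X in measurable X]setTI; exact: (measurable_funPT Y).
  by have := H _ _ ab; rewrite /Rintegral => ->; rewrite fineK// fin_num_measure.
- by move=> a b; rewrite -ge0_fin_numE// fin_num_measure.
Qed.

(** * Twice differentiable densities from decaying transforms *)

Definition quart_decay {R : realType} (f : R -> R) := measurable_fun setT f /\
  exists K : R, forall t, 0 <= t -> `|f t| <= K * (1 + t ^+ 2)^-1 ^+ 2.

Lemma quad_decay_quart {R : realType} (f g : R -> R) (C : R) : measurable_fun setT g ->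
  quart_decay f -> (forall t, 0 <= t -> `|g t| <= C * (1 + t ^+ 2)) -> quad_decay (fun t => g t * f t).
Proof.
move=> mg [mf [K HK]] gC; split; first exact: measurable_funM.
exists (C * K) => t t0; have p0 := oneDsqr_pos t; rewrite normrM.
have -> : C * K * (1 + t ^+ 2)^-1 = (C * (1 + t ^+ 2)) * (K * (1 + t ^+ 2)^-1 ^+ 2).
  by field; rewrite gt_eqF.
by apply: ler_pM => //; [exact: gC|exact: HK].
Qed.

(** Of the four powers of decay two may be spent on factors t, one for each derivative in x, and the
    other two keep the integral convergent. *)
Lemma quart_decay_moments {R : realType} (f : R -> R) : quart_decay f ->
  [/\ quad_decay f, quad_decay (fun t => t * f t) & quad_decay (fun t => t * (t * f t))].
Proof.
move=> df; split.
- rewrite (_ : f = fun t => 1 * f t); last by apply/funext => t; rewrite mul1r.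
  apply: (quad_decay_quart (C := 1)) => // t _.
  by rewrite normr1 mul1r lerDl sqr_ge0.
- apply: (quad_decay_quart (C := 1)) => // t t0.
  rewrite ger0_norm// mul1r.
  have : 0 <= (t - 1) ^+ 2 by exact: sqr_ge0.
  rewrite sqrrB1; have : 0 <= t ^+ 2 by exact: sqr_ge0.
  lra.
- rewrite (_ : (fun t => _) = fun t => t ^+ 2 * f t); last by apply/funext => t; rewrite mulrA.
  apply: (quad_decay_quart (C := 1)) => //.
  by move=> t t0; rewrite ger0_norm ?sqr_ge0// mul1r lerDr.
Qed.

(** Since |x| <= 1 + x^2, one has |x a| <= |a| + |x^2 a|. This bounds x u, then v' bounds x^2 u' by
    2K + 3L, hence x u' by 3K + 3L, and finally v'' bounds x^2 u'' by L + 2K + 4(3K + 3L) = 14K +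
    13L. *)
Lemma product_derivative_bounds {R : realType} (x u u' u'' v v' v'' K L : R) :
  `|u| <= K -> `|u'| <= K -> `|u''| <= K -> `|v| <= L -> `|v'| <= L -> `|v''| <= L ->
  v = x ^+ 2 * u -> v' = 2 * x * u + x ^+ 2 * u' ->
  v'' = 2 * u + 4 * x * u' + x ^+ 2 * u'' ->
  `|x ^+ 2 * u'| <= 14 * K + 13 * L /\ `|x ^+ 2 * u''| <= 14 * K + 13 * L.
Proof.
move=> h0 h1 h2 k0 k1 k2 e0 e1 e2.
have K0 : 0 <= K by exact: le_trans h0.
have L0 : 0 <= L by exact: le_trans k0.
have xM (a A B : R) : `|a| <= A -> `|x ^+ 2 * a| <= B -> `|x * a| <= A + B.
  move=> aA aB; have a0 : 0 <= `|a| by [].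
  have x2 : `|x| <= 1 + x ^+ 2.
    by have := sqr_ge0 (`|x| - 1); rewrite sqrrB1 real_normK ?num_real//; have := sqr_ge0 x; lra.
  rewrite normrM; apply: (le_trans (ler_wpM2r a0 x2)); rewrite mulrDl mul1r lerD//.
  by rewrite -(ger0_norm (sqr_ge0 x)) -normrM.
have := xM u K L h0; rewrite -e0 => /(_ k0) xu.
have X1 : `|x ^+ 2 * u'| <= 2 * K + 3 * L.
  have -> : x ^+ 2 * u' = v' - 2 * (x * u) by rewrite e1; ring.
  by move: k1 xu; rewrite !ler_norml => /andP[? ?] /andP[? ?]; apply/andP; split; lra.
have xu' := xM u' K _ h1 X1.
split; first by apply: (le_trans X1); lra.
have -> : x ^+ 2 * u'' = v'' - 2 * u - 4 * (x * u') by rewrite e2; ring.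
by move: k2 h0 xu'; rewrite !ler_norml => /andP[? ?] /andP[? ?] /andP[? ?]; apply/andP; split; lra.
Qed.

Section smooth_density.
Context {R : realType} {d : measure_display} {T : measurableType d}.
Variables (P : probability T R) (Y : {RV P >-> R}).
Notation mu := (@lebesgue_measure R).
Hypothesis iY2 : P.-integrable setT (EFin \o (fun w => Y w ^+ 2)).
Let U1 t := \int[P]_w cos (t * Y w).
Let V1 t := \int[P]_w sin (t * Y w).
Let U2 t := \int[P]_w (Y w ^+ 2 * cos (t * Y w)).
Let V2 t := \int[P]_w (Y w ^+ 2 * sin (t * Y w)).
Hypotheses (dU1 : quart_decay U1) (dV1 : quart_decay V1).
Hypotheses (dU2 : quart_decay U2) (dV2 : quart_decay V2).
Let r1 := trig_integral U1 V1.
Let r2 := trig_integral U2 V2.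

Lemma trig_integral_C2_bounded (U V : R -> R) : quart_decay U -> quart_decay V ->
  exists r' r'' : R -> R, exists K : R, [/\
    forall x : R, is_derive x 1 (trig_integral U V) (r' x),
    forall x : R, is_derive x 1 r' (r'' x) &
    forall x, [/\ `|trig_integral U V x| <= K, `|r' x| <= K & `|r'' x| <= K]].
Proof.
move=> /quart_decay_moments[Ua Ub Uc] /quart_decay_moments[Va Vb Vc].
exists (trig_integral (fun t => t * V t) (fun t => - (t * U t))).
exists (trig_integral (fun t => t * (- (t * U t))) (fun t => - (t * (t * V t)))).
have UcN : quad_decay (fun t => t * (- (t * U t))).
  rewrite (_ : (fun t => _) = fun t => - (t * (t * U t))); last by apply/funext => t; rewrite mulrN.
  exact: quad_decayN.
have [K0 H0] := trig_integral_bounded Ua Va.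
have [K1 H1] := trig_integral_bounded Vb (quad_decayN Ub).
have [K2 H2] := trig_integral_bounded UcN (quad_decayN Vc).
exists (Num.max K0 (Num.max K1 K2)); split.
- exact: derivable_trig_integral.
- by apply: derivable_trig_integral => //; exact: quad_decayN.
- move=> x; split; [apply: (le_trans (H0 x))|apply: (le_trans (H1 x))|apply: (le_trans (H2 x))];
  by rewrite !le_max lexx ?orbT.
Qed.

Let mY : measurable_fun setT Y.
Proof. exact: measurable_funPT. Qed.

Let cst1 : P.-integrable setT (EFin \o (fun=> 1 : R)).
Proof. exact: finite_measure_integrable_cst. Qed.

Lemma Rintegral_mul1 (g : T -> R) : \int[P]_w (1 * g w) = \int[P]_w g w.
Proof. by apply: eq_Rintegral => w _; rewrite mul1r. Qed.

Let inv1 a b : a < b -> \int[mu]_(x in `[a, b]) r1 x = pi * \int[P]_w (\1_`]a, b] (Y w)).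
Proof.
move=> ab; have [[U0 U1' _] [V0 V1' _]] := (quart_decay_moments dU1, quart_decay_moments dV1).
rewrite -Rintegral_mul1.
have EU : (fun t => \int[P]_w (1 * cos (t * Y w))) = U1 by apply/funext => t; rewrite Rintegral_mul1.
have EV : (fun t => \int[P]_w (1 * sin (t * Y w))) = V1 by apply/funext => t; rewrite Rintegral_mul1.
have := @inversion_formula _ _ _ P Y (fun=> 1) mY cst1 (fun=> ler01).
have EU' : (fun t => t * \int[P]_w (1 * cos (t * Y w))) = (fun t => t * U1 t).
  by apply/funext => t; rewrite Rintegral_mul1.
have EV' : (fun t => t * \int[P]_w (1 * sin (t * Y w))) = (fun t => t * V1 t).
  by apply/funext => t; rewrite Rintegral_mul1.
by rewrite EU' EV' EU EV => /(_ U0 V0 U1' V1' _ _ ab).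
Qed.

Let inv2 a b : a < b ->
  \int[mu]_(x in `[a, b]) r2 x = pi * \int[P]_w (Y w ^+ 2 * \1_`]a, b] (Y w)).
Proof.
move=> ab; have [[U0 U1' _] [V0 V1' _]] := (quart_decay_moments dU2, quart_decay_moments dV2).
exact: (inversion_formula mY iY2 (fun w => sqr_ge0 (Y w)) U0 V0 U1' V1' ab).
Qed.

Let cr1 : continuous r1.
Proof.
have [r' [r'' [K [D1 _ _]]]] := trig_integral_C2_bounded dU1 dV1.
exact: is_derive1_continuous D1.
Qed.

Let cr2 : continuous r2.
Proof.
have [r' [r'' [K [D1 _ _]]]] := trig_integral_C2_bounded dU2 dV2.
exact: is_derive1_continuous D1.
Qed.

Let r1_ge0 x : 0 <= r1 x.
Proof.
apply: (continuous_ge0_of_Rintegral cr1 ltr01) => b xb _.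
by rewrite inv1// mulr_ge0 ?pi_ge0//; apply: Rintegral_ge0 => w _; rewrite indicE.
Qed.

Let i1 a b : P.-integrable setT (EFin \o (fun w => \1_`]a, b] (Y w) : R)).
Proof.
have := integrable_Windic mY cst1 (measurable_itv `]a, b]).
by under eq_fun do rewrite mul1r.
Qed.

Let i2 a b : P.-integrable setT (EFin \o (fun w => Y w ^+ 2 * \1_`]a, b] (Y w) : R)).
Proof. exact: integrable_Windic. Qed.

(** Up to the factor pi both sides are densities of the law of Y weighted by Y^2. Continuity makes
    them equal at every point, which is needed in order to differentiate the identity. *)
Let r2E x : r2 x = x ^+ 2 * r1 x.
Proof.
suff H e : 0 < e -> `|r2 x - x ^+ 2 * r1 x| <= e * r1 x.
  apply/eqP; rewrite -subr_eq0 -normr_le0; apply/ler_addgt0Pl => e e0; rewrite addr0.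
  have r10 : 0 < r1 x + 1 by have := r1_ge0 x; lra.
  apply: (le_trans (H _ (divr_gt0 e0 r10))).
  by rewrite mulrAC ler_pdivrMr// ler_pM2l// lerDl.
move=> e0.
pose D := 2 * `|x| + 1.
have D0 : 0 < D by rewrite /D ltr_wpDl// mulr_ge0.
(* |y^2 - x^2| = |y - x| |y + x|, and |y + x| <= 1 + 2|x| = D once |y - x| <= 1. *)
pose dl := Num.min 1 (e / D).
have dl0 : 0 < dl by rewrite lt_min ltr01 divr_gt0.
have sq y : x < y -> y < x + dl -> `|y ^+ 2 - x ^+ 2| <= e.
  move=> xy yx; rewrite subr_sqr normrM.
  have h1 : `|y - x| <= e / D.
    rewrite ger0_norm ?subr_ge0 ?ltW//; have : dl <= e / D by rewrite ge_min lexx orbT.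
    lra.
  have h2 : `|y + x| <= D.
    have -> : y + x = (y - x) + 2 * x by ring.
    apply: (le_trans (ler_normD _ _)); rewrite /D addrC lerD//.
      by rewrite normrM ger0_norm.
    rewrite ger0_norm ?subr_ge0 ?ltW//; have : dl <= 1 by rewrite ge_min lexx.
    lra.
  by rewrite -(divfK (lt0r_neq0 D0) e); apply: ler_pM.
(* With x^2 frozen, the integral of this combination over [x, b] is, by inversion, pi times the
   expectation of e + s (Y^2 - x^2) on the event x < Y <= b, where that quantity is nonnegative. The
   values s = 1 and s = -1 give the two halves of the absolute value. *)
have key (s : R) : `|s| <= 1 -> 0 <= e * r1 x + s * (r2 x - x ^+ 2 * r1 x).
  move=> s1.
  have -> : e * r1 x + s * (r2 x - x ^+ 2 * r1 x) = (e - s * x ^+ 2) * r1 x + s * r2 x by ring.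
  apply: (@continuous_ge0_of_Rintegral _ (fun y => (e - s * x ^+ 2) * r1 y + s * r2 y) x dl) => //.
    by move=> y; apply: cvgD; apply: cvgM; [exact: cvg_cst|exact: cr1|exact: cvg_cst|exact: cr2].
  move=> b xb bx.
  have cM (c : R) (f : R -> R) : continuous f -> continuous (fun y : R => c * f y).
    by move=> cf y; apply: cvgM; [exact: cvg_cst|exact: cf].
  rewrite RintegralD//; [|exact: integrable_continuous_itv (cM _ _ cr1)|exact: integrable_continuous_itv (cM _ _ cr2)].
  rewrite (RintegralZl_itv _ _ _ cr1) (RintegralZl_itv _ _ _ cr2) (inv1 xb) (inv2 xb) (mulrCA _ pi) (mulrCA _ pi) -mulrDr mulr_ge0 ?pi_ge0//.
  rewrite -!RintegralZl//.
  rewrite -RintegralD//; [|exact: (integrableZl measurableT _ (i1 _ _))|exact: (integrableZl measurableT _ (i2 _ _))].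
  apply: Rintegral_ge0 => w _; rewrite indicE mem_setE in_itv/=.
  have [/andP[xw wb]|_] := boolP (x < Y w <= b); last by rewrite !mulr0 addr0.
  rewrite !mulr1.
  have : `|s * (Y w ^+ 2 - x ^+ 2)| <= e.
    by rewrite normrM -[leRHS]mul1r; apply: ler_pM => //; apply: sq => //; exact: le_lt_trans bx.
  rewrite ler_norml mulrBr => /andP[+ _]; rewrite -subr_ge0 opprK.
  by have -> : e - s * x ^+ 2 + s * Y w ^+ 2 = s * Y w ^+ 2 - s * x ^+ 2 + e by ring.
rewrite ler_norml; apply/andP; split.
- by have := key 1; rewrite normr1 lexx mul1r => /(_ isT); lra.
- by have := key (-1); rewrite normrN1 lexx mulN1r => /(_ isT); lra.
Qed.

Lemma smooth_density : exists p p' p'' : R -> R, exists K : R, [/\ is_density P Y p,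
  forall x : R, is_derive x 1 p (p' x), forall x : R, is_derive x 1 p' (p'' x) &
  forall x, `|p' x| <= K * (1 + x ^+ 2)^-1 /\ `|p'' x| <= K * (1 + x ^+ 2)^-1].
Proof.
have [r1' [r1'' [K1 [D1 D1' B1]]]] := trig_integral_C2_bounded dU1 dV1.
have [r2' [r2'' [K2 [D2 D2' B2]]]] := trig_integral_C2_bounded dU2 dV2.
have pi0 := pi_gt0 R.
exists (fun x => pi^-1 * r1 x), (fun x => pi^-1 * r1' x), (fun x => pi^-1 * r1'' x).
have r2'E x : r2' x = 2 * x * r1 x + x ^+ 2 * r1' x.
  have E : r2 = fun x => x ^+ 2 * r1 x by apply/funext => y; exact: r2E.
  have h : is_derive x 1 r2 (2 * x * r1 x + x ^+ 2 * r1' x).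
    by rewrite E; apply: is_derive_eq; rewrite /GRing.scale /=; ring.
  by rewrite -(@derive_val _ _ _ _ _ _ _ (D2 x)) (@derive_val _ _ _ _ _ _ _ h).
have r2''E x : r2'' x = 2 * r1 x + 4 * x * r1' x + x ^+ 2 * r1'' x.
  have E : r2' = fun x => 2 * x * r1 x + x ^+ 2 * r1' x by apply/funext => y; exact: r2'E.
  have h : is_derive x 1 r2' (2 * r1 x + 4 * x * r1' x + x ^+ 2 * r1'' x).
    by rewrite E; apply: is_derive_eq; rewrite /GRing.scale /=; ring.
  by rewrite -(@derive_val _ _ _ _ _ _ _ (D2' x)) (@derive_val _ _ _ _ _ _ _ h).
have D x : `|x ^+ 2 * r1' x| <= 14 * K1 + 13 * K2 /\ `|x ^+ 2 * r1'' x| <= 14 * K1 + 13 * K2.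
  have [a0 a1 a2] := B1 x; have [b0 b1 b2] := B2 x.
  apply: (product_derivative_bounds (v := r2 x) a0 a1 a2 b0 b1 b2).
  - exact: r2E.
  - exact: r2'E.
  - exact: r2''E.
have K10 : 0 <= K1 by have [b0 _ _] := B1 0; exact: le_trans b0.
have K20 : 0 <= K2 by have [b0 _ _] := B2 0; exact: le_trans b0.
(* The bounds on f and on x^2 f add up to a bound on (1 + x^2) f. *)
have bound f x : `|f x| <= K1 -> `|x ^+ 2 * f x| <= 14 * K1 + 13 * K2 ->
    `|pi^-1 * f x| <= (pi^-1 * (15 * K1 + 13 * K2)) * (1 + x ^+ 2)^-1.
  move=> h1 h2; have ipi : 0 <= pi^-1 :> R by rewrite invr_ge0 ltW.
  rewrite normrM (ger0_norm ipi) -mulrA; apply: ler_wpM2l => //.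
  rewrite ler_pdivlMr ?oneDsqr_pos// mulrDr mulr1.
  move: h2; rewrite normrM (ger0_norm (sqr_ge0 x)) mulrC => h2.
  apply: (le_trans (lerD h1 h2)); lra.
exists (pi^-1 * (15 * K1 + 13 * K2)); split.
- apply: is_density_of_itv.
  + by move=> x; rewrite mulr_ge0// invr_ge0 ltW.
  + by move=> x; apply: cvgM; [exact: cvg_cst|exact: cr1].
  + move=> a b ab; rewrite (RintegralZl_itv _ _ _ cr1).
    rewrite (inv1 ab) mulKf ?gt_eqF// /Rintegral.
    have mYab : measurable (Y @^-1` `]a, b]) by rewrite -[X in measurable X]setTI; exact: mY.
    transitivity (fine (\int[P]_w (\1_(Y @^-1` `]a, b]) w)%:E)%E) => //.
    by rewrite integral_indic// setIT.
- by move=> x; apply: is_derive_eq.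
- by move=> x; apply: is_derive_eq.
- move=> x; have [b0 b1 b2] := B1 x; have [e1 e2] := D x.
  by split; [exact: (bound r1' x b1 e1)|exact: (bound r1'' x b2 e2)].
Qed.

End smooth_density.

(** * Sums of independent random variables *)

Section joint_law.
Context {R : realType} {d : measure_display} {T : measurableType d}.
Variables (P : probability T R) (S Z : {RV P >-> R}).

Lemma measurable_pair : measurable_fun setT (fun w => (S w, Z w)).
Proof. by apply: measurable_fun_pair; exact: measurable_funPT. Qed.

Definition pairRV : {mfun T >-> (R * R)%type} := mfun_Sub (mem_set measurable_pair).

(** [E] is meant for an event of probability c that is independent of the pair (S, Z). As functions
    of [C] both sides are finite measures, and the hypothesis says that they agree on rectangles. *)
Lemma measure_rectangles (E : set T) (c : R) (C : set (R * R)) :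
  measurable E -> 0 <= c -> measurable C ->
  (forall A B, measurable A -> measurable B ->
    P (S @^-1` A `&` Z @^-1` B `&` E) = (P (S @^-1` A) * P (Z @^-1` B) * c%:E)%E) ->
  P (pairRV @^-1` C `&` E) = (c%:E * (distribution P S \x distribution P Z)%E C)%E.
Proof.
move=> mE c0 mC H.
pose m1 := mscale (NngNum c0) (distribution P S).
have E1 : (m1 \x distribution P Z)%E C = P (pairRV @^-1` C `&` E).
  pose nu := pushforward (mrestr P mE) pairRV.
  rewrite (@product_measure_unique _ _ _ _ _ _ _ nu)// => A B mA mB.
  change (P (S @^-1` A `&` Z @^-1` B `&` E) = (c%:E * P (S @^-1` A) * P (Z @^-1` B))%E).
  by rewrite H// muleC muleA.
rewrite -E1 /product_measure1 ge0_integral_mscale//.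
exact: measurable_fun_xsection.
Qed.

Lemma joint_law : (forall A B, measurable A -> measurable B ->
    P (S @^-1` A `&` Z @^-1` B) = (P (S @^-1` A) * P (Z @^-1` B))%E) ->
  forall C, measurable C -> distribution P pairRV C = (distribution P S \x distribution P Z)%E C.
Proof.
move=> H C mC; have := @measure_rectangles setT 1 C measurableT ler01 mC.
rewrite mul1e setIT; apply => A B mA mB.
by rewrite setIT mule1 H.
Qed.

Lemma Rintegral_product_law (m1 m2 : {sigma_finite_measure set R -> \bar R}) (g h : R -> R) :
  m1.-integrable setT (EFin \o g) -> m2.-integrable setT (EFin \o h) ->
  (m1 \x m2)%E.-integrable setT (EFin \o (fun z => g z.1 * h z.2)) /\
  \int[(m1 \x m2)%E]_z (g z.1 * h z.2) = \int[m1]_x g x * \int[m2]_y h y.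
Proof.
move=> ig ih.
have mg : measurable_fun setT g by apply/measurable_EFinP; exact: (measurable_int m1).
have mh : measurable_fun setT h by apply/measurable_EFinP; exact: (measurable_int m2).
have mF : measurable_fun setT (EFin \o (fun z : R * R => g z.1 * h z.2)).
  apply/measurable_EFinP; apply: measurable_funM.
    by apply: (measurableT_comp mg); exact: measurable_fst.
  by apply: (measurableT_comp mh); exact: measurable_snd.
have fing := integrable_fin_num measurableT ig.
have finh := integrable_fin_num measurableT ih.
have finag := integrable_fin_num measurableT (integrable_abse ig).
have finah := integrable_fin_num measurableT (integrable_abse ih).
have iF : (m1 \x m2)%E.-integrable setT (EFin \o (fun z => g z.1 * h z.2)).
  apply/(integrable12ltyP m1 m2 mF).
  have -> : (\int[m1]_x \int[m2]_y `|(EFin \o (fun z : R * R => (g z.1 * h z.2)%R)) (x, y)| =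
      \int[m1]_x (`|(g x)%:E| * (\int[m2]_y `|(h y)%:E|)))%E.
    apply: eq_integral => x _; rewrite -ge0_integralZl//; last first.
      by apply: measurableT_comp => //; exact/measurable_EFinP.
    by apply: eq_integral => y _; rewrite /= normrM EFinM.
  rewrite ge0_integralZr//; last 2 first.
  - by apply: measurableT_comp => //; exact/measurable_EFinP.
  - exact: integral_ge0.
  by rewrite -(fineK finag) -(fineK finah) -EFinM ltry.
split => //; rewrite /Rintegral -(integral12_prod_meas1 iF).
have -> : (\int[m1]_x fubini_F m2 (EFin \o (fun z : R * R => (g z.1 * h z.2)%R)) x =
    \int[m1]_x ((g x)%:E * (\int[m2]_y (h y)%:E)))%E.
  apply: eq_integral => x _; rewrite /fubini_F -integralZl//.
by rewrite -(fineK finh) integralZr// -(fineK fing) -EFinM/=.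
Qed.

Lemma integrable_distribution (V : {RV P >-> R}) (g : R -> R) : measurable_fun setT g ->
  P.-integrable setT (EFin \o (g \o V)) -> (distribution P V).-integrable setT (EFin \o g).
Proof.
move=> mg ig; apply: (@integrable_pushforward _ _ _ _ _ V) => //.
exact/measurable_EFinP.
Qed.

Lemma Rintegral_distribution (V : {RV P >-> R}) (g : R -> R) : measurable_fun setT g ->
  P.-integrable setT (EFin \o (g \o V)) -> \int[distribution P V]_y g y = \int[P]_w g (V w).
Proof.
move=> mg ig; rewrite /Rintegral integral_distribution//.
exact/measurable_EFinP.
Qed.

Lemma Rintegral_independent (g h : R -> R) :
  (forall A B, measurable A -> measurable B ->
    P (S @^-1` A `&` Z @^-1` B) = (P (S @^-1` A) * P (Z @^-1` B))%E) ->
  measurable_fun setT g -> measurable_fun setT h ->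
  P.-integrable setT (EFin \o (g \o S)) -> P.-integrable setT (EFin \o (h \o Z)) ->
  P.-integrable setT (EFin \o (fun w => g (S w) * h (Z w))) /\
  \int[P]_w (g (S w) * h (Z w)) = \int[P]_w g (S w) * \int[P]_w h (Z w).
Proof.
move=> H mg mh ig ih.
have [iF E] := Rintegral_product_law (integrable_distribution mg ig) (integrable_distribution mh ih).
rewrite !Rintegral_distribution// in E.
pose F (z : R * R) := g z.1 * h z.2.
have mF : measurable_fun setT (EFin \o F).
  exact: (measurable_int _ iF).
have eqm (G : R * R -> \bar R) :
    (\int[distribution P pairRV]_z G z = \int[(distribution P S \x distribution P Z)%E]_z G z)%E.
  by apply: eq_measure_integral => A mA _; exact: joint_law.
have iD : (distribution P pairRV).-integrable setT (EFin \o F).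
  by apply/integrableP; split => //; rewrite eqm; case/integrableP: iF.
have iP : P.-integrable setT ((EFin \o F) \o pairRV).
  apply/integrableP; split; first by apply: measurableT_comp => //; exact: measurable_pair.
  have := ge0_integral_distribution pairRV (f := fun z => `|(EFin \o F) z|%E).
  case/integrableP: iD => _ h1 <- //; last exact: measurableT_comp.
split; first exact: iP.
rewrite -E /Rintegral -eqm integral_distribution//.
Qed.

End joint_law.

(** * Independence of partial sums from later terms *)

Section partial_sums.
Context {R : realType} {d : measure_display} {T : measurableType d}.
Variables (P : probability T R) (X : nat -> {RV P >-> R}).
Hypothesis Hind : mutually_independent P (fun n => X n : T -> R).

Lemma measurable_partial_sum n : measurable_fun setT (fun w => \sum_(i < n) X i w).
Proof. by apply: measurable_sum => i; exact: measurable_funPT. Qed.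

Definition partial_sum n : {RV P >-> R} := mfun_Sub (mem_set (measurable_partial_sum n)).

Lemma measurable_preimage (V : {RV P >-> R}) (A : set R) : measurable A -> measurable (V @^-1` A).
Proof. by move=> mA; rewrite -[X in measurable X]setTI; exact: (measurable_funPT V). Qed.

(** Independence from a single later variable would not survive the induction, so all finite
    families of later variables are treated at once. The pair (S_n, X_n) is independent of the
    events indexed by [s] by the induction hypothesis for n :: s, and the next partial sum is a
    function of that pair. *)
Lemma partial_sum_independent_seq n (s : seq nat) (A : set R) (B : nat -> set R) :
  {in s, forall i, (n <= i)%N} -> uniq s -> measurable A -> (forall i, measurable (B i)) ->
  P (partial_sum n @^-1` A `&` \bigcap_(i in [set` s]) (X i @^-1` B i)) =
  (P (partial_sum n @^-1` A) * \prod_(i <- s) P (X i @^-1` B i))%E.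
Proof.
elim: n s A B => [|n IH] s A B sn us mA mB.
  have [A0|A0] := pselect (A 0).
    have -> : partial_sum 0 @^-1` A = setT.
      by apply/seteqP; split => // w _ /=; rewrite big_ord0.
    by rewrite setTI probability_setT mul1e Hind.
  have -> : partial_sum 0 @^-1` A = set0.
    by apply/seteqP; split => // w /=; rewrite big_ord0.
  by rewrite set0I measure0 mul0e.
set E := \bigcap_(i in [set` s]) (X i @^-1` B i).
have mE : measurable E.
  by apply: fin_bigcap_measurable => // i _; exact: measurable_preimage.
have ns : n \notin s by apply/negP => /sn; rewrite ltnn.
have PE : P E = (\prod_(i <- s) P (X i @^-1` B i))%E by exact: Hind.
pose c := fine (P E).
have cE : P E = c%:E by rewrite fineK// fin_num_measure.
have c0 : 0 <= c by rewrite -lee_fin -cE.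
pose C : set (R * R) := (fun z => z.1 + z.2) @^-1` A.
have mC : measurable C.
  rewrite /C -[X in measurable X]setTI; exact: measurable_funD.
have SC : partial_sum n.+1 @^-1` A = pairRV (partial_sum n) (X n) @^-1` C.
  by apply/seteqP; split => w /=; rewrite big_ord_recr.
have rect (s' : seq nat) A' B' : {in s', forall i, (n < i)%N} -> uniq s' ->
    measurable A' -> measurable B' ->
    P (partial_sum n @^-1` A' `&` X n @^-1` B' `&` \bigcap_(i in [set` s']) (X i @^-1` B i)) =
    (P (partial_sum n @^-1` A') * P (X n @^-1` B') * \prod_(i <- s') P (X i @^-1` B i))%E.
  move=> s'n us' mA' mB'; have ns' : n \notin s' by apply/negP => /s'n; rewrite ltnn.
  (* Changing the family at n alone makes the induction hypothesis for n :: s' speak of the extra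
     event that X_n lies in B'. *)
  pose B2 i := if i == n then B' else B i.
  have := IH (n :: s') A' B2 _ _ mA' _.
  have -> : \bigcap_(i in [set` n :: s']) (X i @^-1` B2 i) =
      X n @^-1` B' `&` \bigcap_(i in [set` s']) (X i @^-1` B i).
    apply/seteqP; split => w.
      move=> H; split.
        by have := H n; rewrite /B2 eqxx; apply; rewrite /= mem_head.
      move=> i /= si; have := H i; rewrite /B2; case: eqP => [e|_]; last by apply; rewrite /= inE si orbT.
      by move: ns'; rewrite -e si.
    move=> [Hn H] i /=; rewrite inE /B2 => /orP[/eqP ->|si]; first by rewrite eqxx.
    by case: eqP => [e|_]; [rewrite e|exact: H].
  rewrite setIA => ->.
  - rewrite big_cons {1}/B2 eqxx muleA; congr (_ * _)%E.
    rewrite !big_seq; apply: eq_bigr => i si; rewrite /B2; case: eqP => // e.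
    by move: ns'; rewrite -e si.
  - by move=> i; rewrite inE => /orP[/eqP ->//|/s'n/ltnW].
  - by rewrite /= ns' us'.
  - by move=> i; rewrite /B2; case: ifP.
rewrite SC (measure_rectangles mE c0 mC); last first.
  by move=> A' B' mA' mB'; rewrite rect// -PE cE.
(* With no later events the same argument identifies the product measure of [C] with the probability
   that the next partial sum lies in [A]. *)
have J := @measure_rectangles _ _ _ P (partial_sum n) (X n) setT 1 C measurableT ler01 mC.
rewrite setIT mul1e in J; rewrite -J; first by rewrite -PE cE muleC.
move=> A' B' mA' mB'; have := rect [::] A' B'; rewrite big_nil => <- //.
by congr (P (_ `&` _)); apply/seteqP; split => // w _ i.
Qed.

Lemma partial_sum_independent n A B : measurable A -> measurable B ->
  P (partial_sum n @^-1` A `&` X n @^-1` B) = (P (partial_sum n @^-1` A) * P (X n @^-1` B))%E.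
Proof.
move=> mA mB; have := @partial_sum_independent_seq n [:: n] A (fun=> B).
rewrite big_seq1 => <- //; last by move=> i; rewrite inE => /eqP ->.
congr (P (_ `&` _)); apply/seteqP; split => w.
  by move=> Bw i; rewrite /= inE => /eqP ->.
by move=> /(_ n); apply; rewrite /= inE.
Qed.

End partial_sums.

(** * Trigonometric moments and their addition formulas *)

Section expectation_value.
Context {R : realType} {d : measure_display} {T : measurableType d}.
Variable P : probability T R.

(** Integrability is carried along with the value because linearity of [Rintegral] needs it at every
    stage. *)
Definition has_expectation (f : T -> R) (v : R) :=
  P.-integrable setT (EFin \o f) /\ \int[P]_w f w = v.

Lemma has_expectation_ext f g v : f =1 g -> has_expectation f v -> has_expectation g v.
Proof. by move=> /funext ->. Qed.

Lemma has_expectationD f g u v : has_expectation f u -> has_expectation g v ->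
  has_expectation (fun w => f w + g w) (u + v).
Proof.
move=> [fi <-] [gi <-]; split; first exact: (integrableD measurableT fi gi).
by rewrite RintegralD.
Qed.

Lemma has_expectationZ f c u : has_expectation f u ->
  has_expectation (fun w => c * f w) (c * u).
Proof.
move=> [fi <-]; split; first exact: (integrableZl measurableT _ fi).
by rewrite RintegralZl.
Qed.

Lemma has_expectation_sum (I : Type) (s : seq I) (f : I -> T -> R) (v : I -> R) :
  (forall i, has_expectation (f i) (v i)) ->
  has_expectation (fun w => \sum_(i <- s) f i w) (\sum_(i <- s) v i).
Proof.
move=> fv; elim: s => [|i s IH].
  rewrite big_nil; apply: (@has_expectation_ext (fun=> 0)); first by move=> w; rewrite big_nil.
  split; last by rewrite Rintegral_cst// mul0r.
  exact: finite_measure_integrable_cst.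
rewrite big_cons; apply: has_expectation_ext (has_expectationD (fv i) IH).
by move=> w; rewrite big_cons.
Qed.

End expectation_value.

Section trigonometric_moments.
Context {R : realType} {d : measure_display} {T : measurableType d}.
Variable P : probability T R.

(** Up to sign and order, [cos_moment] and [sin_moment] are the real and imaginary parts of the k-th
    derivative of the characteristic function of [V], written without any differentiation. *)
Definition cos_moment (V : T -> R) k t := \int[P]_w (V w ^+ k * cos (t * V w)).
Definition sin_moment (V : T -> R) k t := \int[P]_w (V w ^+ k * sin (t * V w)).

Lemma measurable_XMcos (k : nat) (t : R) : measurable_fun setT (fun x : R => x ^+ k * cos (t * x)).
Proof.
apply: measurable_funM.
  by apply: continuous_measurable_fun => x; exact: exprn_continuous.
by under eq_fun do rewrite mulrC; exact: measurable_cosM.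
Qed.

Lemma measurable_XMsin (k : nat) (t : R) : measurable_fun setT (fun x : R => x ^+ k * sin (t * x)).
Proof.
apply: measurable_funM.
  by apply: continuous_measurable_fun => x; exact: exprn_continuous.
by under eq_fun do rewrite mulrC; exact: measurable_sinM.
Qed.

Definition trig_moments_exist (V : T -> R) k := forall t,
  has_expectation P (fun w => V w ^+ k * cos (t * V w)) (cos_moment V k t) /\
  has_expectation P (fun w => V w ^+ k * sin (t * V w)) (sin_moment V k t).

Lemma trig_moments_integrable (V : {RV P >-> R}) k :
  P.-integrable setT (EFin \o (fun w => V w ^+ k)) -> trig_moments_exist V k.
Proof.
move=> ik t; split; split => //; apply: (integrable_mul_bounded ik (C := 1)).
- exact: (measurable_cosMY (measurable_funPT V)).
- by move=> w; exact: cos_norm_le1.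
- exact: (measurable_sinMY (measurable_funPT V)).
- by move=> w; exact: sin_norm_le1.
Qed.

Section independent_sum.
Variables S Z : {RV P >-> R}.
Hypothesis SZ : forall A B, measurable A -> measurable B ->
  P (S @^-1` A `&` Z @^-1` B) = (P (S @^-1` A) * P (Z @^-1` B))%E.
Variable k : nat.
Hypotheses (Sk : forall j, (j <= k)%N -> trig_moments_exist S j).
Hypotheses (Zk : forall j, (j <= k)%N -> trig_moments_exist Z j).
Let W w := S w + Z w.

Let prod_exp (g h : R -> R) u v : measurable_fun setT g -> measurable_fun setT h ->
  has_expectation P (fun w => g (S w)) u -> has_expectation P (fun w => h (Z w)) v ->
  has_expectation P (fun w => g (S w) * h (Z w)) (u * v).
Proof.
by move=> mg mh [ig <-] [ih <-]; exact: (Rintegral_independent SZ mg mh ig ih).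
Qed.

(** Common pattern of the next two lemmas: the binomial theorem for (S + Z)^k times an addition
    formula, [s] being the sign in it, -1 for the cosine and 1 for the sine. *)
Let sum_exp (a1 b1 a2 b2 : nat -> R -> R) (u1 v1 u2 v2 : nat -> R) (f : T -> R) (s : R) :
  (forall i, measurable_fun setT (a1 i)) -> (forall i, measurable_fun setT (b1 i)) ->
  (forall i, measurable_fun setT (a2 i)) -> (forall i, measurable_fun setT (b2 i)) ->
  (forall i, (i <= k)%N -> has_expectation P (fun w => a1 i (S w)) (u1 i)) ->
  (forall i, (i <= k)%N -> has_expectation P (fun w => b1 i (Z w)) (v1 i)) ->
  (forall i, (i <= k)%N -> has_expectation P (fun w => a2 i (S w)) (u2 i)) ->
  (forall i, (i <= k)%N -> has_expectation P (fun w => b2 i (Z w)) (v2 i)) ->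
  (forall w, f w = \sum_(i < k.+1) (a1 (k - i)%N (S w) * b1 i (Z w) + s * (a2 (k - i)%N (S w) * b2 i (Z w))) *+ 'C(k, i)) ->
  has_expectation P f (\sum_(i < k.+1) 'C(k, i)%:R * (u1 (k - i)%N * v1 i + s * (u2 (k - i)%N * v2 i))).
Proof.
move=> ma1 mb1 ma2 mb2 h1 h2 h3 h4 E.
pose F (i : 'I_k.+1) w := 'C(k, i)%:R * (a1 (k - i)%N (S w) * b1 i (Z w) + s * (a2 (k - i)%N (S w) * b2 i (Z w))).
apply: (@has_expectation_ext _ _ _ _ (fun w => \sum_(i < k.+1) F i w)).
  by move=> w; rewrite E; apply: eq_bigr => i _; rewrite /F mulr_natl.
apply: has_expectation_sum => i; apply: has_expectationZ.
have ik : (i <= k)%N by rewrite -ltnS.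
apply: has_expectationD; first by apply: prod_exp => //; [apply: h1; exact: leq_subr|exact: h2].
by apply: has_expectationZ; apply: prod_exp => //; [apply: h3; exact: leq_subr|exact: h4].
Qed.

Lemma cos_moment_sum t :
  has_expectation P (fun w => W w ^+ k * cos (t * W w))
  (\sum_(i < k.+1) 'C(k, i)%:R * (cos_moment S (k - i) t * cos_moment Z i t
    + (-1) * (sin_moment S (k - i) t * sin_moment Z i t))).
Proof.
apply: (@sum_exp (fun j x => x ^+ j * cos (t * x)) (fun j x => x ^+ j * cos (t * x))
  (fun j x => x ^+ j * sin (t * x)) (fun j x => x ^+ j * sin (t * x))
  (fun j => cos_moment S j t) (fun j => cos_moment Z j t)
  (fun j => sin_moment S j t) (fun j => sin_moment Z j t)).
- by move=> i; exact: measurable_XMcos.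
- by move=> i; exact: measurable_XMcos.
- by move=> i; exact: measurable_XMsin.
- by move=> i; exact: measurable_XMsin.
- by move=> i /Sk/(_ t)[].
- by move=> i /Zk/(_ t)[].
- by move=> i /Sk/(_ t)[].
- by move=> i /Zk/(_ t)[].
move=> w; rewrite /W exprDn mulrDr cosD mulr_suml; apply: eq_bigr => i _.
by rewrite mulrnAl; congr (_ *+ _); ring.
Qed.

Lemma sin_moment_sum t :
  has_expectation P (fun w => W w ^+ k * sin (t * W w))
  (\sum_(i < k.+1) 'C(k, i)%:R * (sin_moment S (k - i) t * cos_moment Z i t
    + 1 * (cos_moment S (k - i) t * sin_moment Z i t))).
Proof.
apply: (@sum_exp (fun j x => x ^+ j * sin (t * x)) (fun j x => x ^+ j * cos (t * x))
  (fun j x => x ^+ j * cos (t * x)) (fun j x => x ^+ j * sin (t * x))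
  (fun j => sin_moment S j t) (fun j => cos_moment Z j t)
  (fun j => cos_moment S j t) (fun j => sin_moment Z j t)).
- by move=> i; exact: measurable_XMsin.
- by move=> i; exact: measurable_XMcos.
- by move=> i; exact: measurable_XMcos.
- by move=> i; exact: measurable_XMsin.
- by move=> i /Sk/(_ t)[].
- by move=> i /Zk/(_ t)[].
- by move=> i /Sk/(_ t)[].
- by move=> i /Zk/(_ t)[].
move=> w; rewrite /W exprDn mulrDr sinD mulr_suml; apply: eq_bigr => i _.
by rewrite mulrnAl; congr (_ *+ _); ring.
Qed.

End independent_sum.

(** With m the square root, m^2 = c^2 + s^2 is the expectation of c cos(tV) + s sin(tV), which is at
    most m pointwise by Cauchy-Schwarz. Hence m^2 <= m. *)
Lemma cos_sin_moment0_le1 (V : {RV P >-> R}) t :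
  Num.sqrt (cos_moment V 0 t ^+ 2 + sin_moment V 0 t ^+ 2) <= 1.
Proof.
set c := cos_moment V 0 t; set s := sin_moment V 0 t; set m := Num.sqrt _.
have i0 : P.-integrable setT (EFin \o (fun w => V w ^+ 0)).
  exact: finite_measure_integrable_cst.
have [hc hs] := trig_moments_integrable i0 t.
have [icc e] := has_expectationD (has_expectationZ c hc) (has_expectationZ s hs).
have m0 : 0 <= m by exact: sqrtr_ge0.
have mm : m ^+ 2 = c ^+ 2 + s ^+ 2 by rewrite sqr_sqrtr// addr_ge0// sqr_ge0.
have h : c * c + s * s <= m.
  rewrite -e -[leRHS]mulr1 -(_ : fine (P setT) = 1); last by rewrite probability_setT.
  rewrite -Rintegral_cst//; apply: le_Rintegral => //; first exact: finite_measure_integrable_cst.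
  move=> w _; rewrite expr0 !mul1r; apply: le_trans (ler_norm _) _.
  rewrite -(@ler_pXn2r _ 2) ?nnegrE// mm real_normK ?num_real//.
  have := sqr_ge0 (c * sin (t * V w) - s * cos (t * V w)).
  have := cos2Dsin2 (t * V w); set C := cos _; set D := sin _ => CD.
  have -> : c ^+ 2 + s ^+ 2 = (c ^+ 2 + s ^+ 2) * (C ^+ 2 + D ^+ 2) by rewrite CD mulr1.
  by rewrite -subr_ge0 => h; rewrite -subr_ge0; apply: le_trans h _; rewrite le_eqVlt; apply/orP; left; apply/eqP; ring.
have : m * m <= m by rewrite -expr2 mm !expr2.
have [->//|mn0] := eqVneq m 0.
by rewrite -subr_ge0 -{1}[m]mulr1 -mulrBr pmulr_rge0 ?subr_ge0// lt_neqAle eq_sym mn0.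
Qed.

End trigonometric_moments.

Lemma Rintegral_cst_probability {R : realType} {d : measure_display} {T : measurableType d}
    (P : probability T R) (c : R) : \int[P]_w (fun=> c) w = c.
Proof.
transitivity (c * fine (P setT)); first exact: Rintegral_cst.
by rewrite probability_setT mulr1.
Qed.

Lemma continuous_moment {R : realType} {d : measure_display} {T : measurableType d}
    (P : probability T R) (W Y : T -> R) (g : R -> R) :
  P.-integrable setT (EFin \o W) -> measurable_fun setT Y ->
  continuous g -> (forall x, `|g x| <= 1) -> continuous (fun t : R => \int[P]_w (W w * g (t * Y w))).
Proof.
move=> iW mY cg g1 t.
have mg s : measurable_fun setT (fun w => g (s * Y w)).
  apply: (measurableT_comp (continuous_measurable_fun cg)); exact: measurable_funM.
have iWn : P.-integrable setT (EFin \o (fun w => `|W w|)) by exact: integrable_norm iW.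
have It : t \in `]t - 1, t + 1[%classic by rewrite inE /= in_itv/=; apply/andP; split; lra.
apply: (@continuity_under_integral _ _ _ P (fun s w => W w * g (s * Y w)) setT measurableT (t - 1) (t + 1) _ _ (fun w => `|W w|) iWn _ t It).
- by move=> x _; exact: (integrable_mul_bounded iW (mg x) (fun w => g1 _)).
- apply: aeW => w _ s _; apply: cvgM; first exact: cvg_cst.
  apply: continuous_comp; last exact: cg.
  exact: mulrr_continuous.
- move=> x _; apply: aeW => w _; rewrite normrM -[leRHS]mulr1 ler_wpM2l//.
Qed.

(** * Moments of partial sums against powers of |f_1| *)

Section iid_decay.
Context {R : realType} {d : measure_display} {T : measurableType d}.
Variables (P : probability T R) (X : nat -> {RV P >-> R}).
Hypothesis Hind : mutually_independent P (fun n => X n : T -> R).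
Hypothesis Hid : identically_distributed P (fun n => X n : T -> R).
Hypothesis iX2 : P.-integrable setT (EFin \o (fun w => X 0%N w ^+ 2)).

Let eq_law n (G : R -> \bar R) :
  (\int[distribution P (X n)]_x G x = \int[distribution P (X 0%N)]_x G x)%E.
Proof. by apply: eq_measure_integral => A mA _; exact: Hid. Qed.

Lemma iid_integrable n (g : R -> R) : measurable_fun setT g ->
  P.-integrable setT (EFin \o (g \o X 0%N)) -> P.-integrable setT (EFin \o (g \o X n)).
Proof.
move=> mg ig; apply/integrableP; split.
  by apply/measurable_EFinP; apply: measurableT_comp => //; exact: measurable_funPT.
have mag : measurable_fun setT (fun x => `|(g x)%:E|%E).
  by apply: measurableT_comp => //; exact/measurable_EFinP.
have E m := ge0_integral_distribution (X m) (f := fun x => `|(g x)%:E|%E) mag (fun x => abse_ge0 _).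
by have := E n; rewrite /= => <-; rewrite eq_law E; case/integrableP : ig.
Qed.

Lemma iid_Rintegral n (g : R -> R) : measurable_fun setT g ->
  P.-integrable setT (EFin \o (g \o X 0%N)) -> \int[P]_w g (X n w) = \int[P]_w g (X 0%N w).
Proof.
move=> mg ig; rewrite -!Rintegral_distribution//; last exact: iid_integrable.
by rewrite /Rintegral eq_law.
Qed.

Lemma integrable_X0X k : (k <= 2)%N -> P.-integrable setT (EFin \o (fun w => X 0%N w ^+ k)).
Proof.
move=> k2; pose g w := 1 + X 0%N w ^+ 2.
have ig : P.-integrable setT (EFin \o g).
  have i1 : P.-integrable setT (EFin \o (fun=> 1 : R)) by exact: finite_measure_integrable_cst.
  exact: (integrableD measurableT i1 iX2).
apply: le_integrable ig => //.
  apply/measurable_EFinP; apply: measurable_funX; exact: measurable_funPT.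
move=> w _; rewrite lee_fin /g [leRHS]ger0_norm; last by rewrite addr_ge0// sqr_ge0.
case: k k2 => [|[|[|//]]] _.
- by rewrite expr0 normr1 lerDl sqr_ge0.
- have := sqr_ge0 (`|X 0%N w| - 1); rewrite sqrrB1 real_normK ?num_real// expr1.
  by have := sqr_ge0 (X 0%N w); lra.
- by rewrite ger0_norm ?sqr_ge0// lerDr.
Qed.

Lemma iid_trig_moments_exist n k : (k <= 2)%N -> trig_moments_exist P (X n) k.
Proof.
move=> k2; apply: trig_moments_integrable.
apply: (@iid_integrable n (fun x => x ^+ k)); last exact: integrable_X0X.
by apply: continuous_measurable_fun => x; exact: exprn_continuous.
Qed.

Lemma iid_cos_moment n k t : (k <= 2)%N -> cos_moment P (X n) k t = cos_moment P (X 0%N) k t.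
Proof.
move=> k2; apply: (@iid_Rintegral n (fun x => x ^+ k * cos (t * x))).
  exact: measurable_XMcos.
by have [[]] := iid_trig_moments_exist 0 k2 t.
Qed.

Lemma iid_sin_moment n k t : (k <= 2)%N -> sin_moment P (X n) k t = sin_moment P (X 0%N) k t.
Proof.
move=> k2; apply: (@iid_Rintegral n (fun x => x ^+ k * sin (t * x))).
  exact: measurable_XMsin.
by have [_ []] := iid_trig_moments_exist 0 k2 t.
Qed.

(** This is |f_1(t)| in real terms; see [cmodulus_charfun]. *)
Definition modulus t := Num.sqrt (cos_moment P (X 0%N) 0 t ^+ 2 + sin_moment P (X 0%N) 0 t ^+ 2).

Lemma modulus_ge0 t : 0 <= modulus t. Proof. exact: sqrtr_ge0. Qed.

Lemma modulus_le1 t : modulus t <= 1. Proof. exact: cos_sin_moment0_le1. Qed.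

Lemma sqr_modulus t :
  modulus t ^+ 2 = cos_moment P (X 0%N) 0 t ^+ 2 + sin_moment P (X 0%N) 0 t ^+ 2.
Proof. by rewrite sqr_sqrtr// addr_ge0// sqr_ge0. Qed.

Definition modulus_dominated (e : nat) (F : R -> R) :=
  exists2 K : R, 0 <= K & forall t, `|F t| <= K * modulus t ^+ e.

Lemma modulus_dominatedW e e' F : (e' <= e)%N -> modulus_dominated e F -> modulus_dominated e' F.
Proof.
move=> ee [K K0 H]; exists K => // t; apply: (le_trans (H t)); rewrite ler_wpM2l//.
by apply: ler_wiXn2l => //; [exact: modulus_ge0|exact: modulus_le1].
Qed.

Lemma modulus_dominatedD e F G : modulus_dominated e F -> modulus_dominated e G ->
  modulus_dominated e (fun t => F t + G t).
Proof.
move=> [K K0 H] [L L0 H']; exists (K + L); first exact: addr_ge0.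
by move=> t; rewrite mulrDl (le_trans (ler_normD _ _))// lerD.
Qed.

Lemma modulus_dominatedM e e' F G : modulus_dominated e F -> modulus_dominated e' G ->
  modulus_dominated (e + e') (fun t => F t * G t).
Proof.
move=> [K K0 H] [L L0 H']; exists (K * L); first exact: mulr_ge0.
by move=> t; rewrite normrM exprD mulrACA ler_pM.
Qed.

Lemma modulus_dominatedZ e (c : R) F : modulus_dominated e F ->
  modulus_dominated e (fun t => c * F t).
Proof.
move=> [K K0 H]; exists (`|c| * K); first exact: mulr_ge0.
by move=> t; rewrite normrM -mulrA ler_wpM2l.
Qed.

Lemma modulus_dominated_sum e n (F : 'I_n -> R -> R) : (forall i, modulus_dominated e (F i)) ->
  modulus_dominated e (fun t => \sum_(i < n) F i t).
Proof.
elim: n F => [|n IH] F H.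
  by exists 0 => // t; rewrite big_ord0 normr0 mul0r.
under eq_fun do rewrite big_ord_recr.
by apply: modulus_dominatedD => //; exact: IH.
Qed.

(** The exponent is the boolean i == 0 read as a number: for i = 0 the moment is controlled by |f_1|
    itself, and for i > 0 it is only bounded. *)
Lemma single_moment_dominated i n : (i <= 2)%N ->
  modulus_dominated (i == 0)%N (cos_moment P (X n) i) /\
  modulus_dominated (i == 0)%N (sin_moment P (X n) i).
Proof.
move=> i2; case: i i2 => [|i] i2.
  split; exists 1 => // t; rewrite eqxx expr1 mul1r.
    rewrite iid_cos_moment// -(@ler_pXn2r _ 2) ?nnegrE ?modulus_ge0//.
    by rewrite real_normK ?num_real// sqr_modulus lerDl sqr_ge0.
  rewrite iid_sin_moment// -(@ler_pXn2r _ 2) ?nnegrE ?modulus_ge0//.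
  by rewrite real_normK ?num_real// sqr_modulus lerDr sqr_ge0.
have ii : P.-integrable setT (EFin \o (fun w => X n w ^+ i.+1)).
  apply: (@iid_integrable n (fun x => x ^+ i.+1)); last exact: integrable_X0X.
  by apply: continuous_measurable_fun => x; exact: exprn_continuous.
have K0 : 0 <= \int[P]_w `|X n w ^+ i.+1| by apply: Rintegral_ge0.
have bd (g : T -> R) : measurable_fun setT g -> (forall w, `|g w| <= 1) ->
    `|\int[P]_w (X n w ^+ i.+1 * g w)| <= \int[P]_w `|X n w ^+ i.+1|.
  move=> mg g1; have ig := integrable_mul_bounded ii mg g1.
  apply: (le_trans (le_normr_Rintegral measurableT ig)).
  apply: le_Rintegral => //; [exact: integrable_norm ig|exact: integrable_norm ii|].
  by move=> w _; rewrite normrM -[leRHS]mulr1 ler_wpM2l.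
split; exists (\int[P]_w `|X n w ^+ i.+1|) => // t; rewrite /= expr0 mulr1; apply: bd.
- exact: (measurable_cosMY (measurable_funPT (X n))).
- by move=> w; exact: cos_norm_le1.
- exact: (measurable_sinMY (measurable_funPT (X n))).
- by move=> w; exact: sin_norm_le1.
Qed.

(** When the k-th power of the sum is expanded, each term involves at most k of the n variables, and
    every other variable contributes a factor |f_1|. The subtraction is truncated, so for n <= k the
    claim is mere boundedness. *)
Lemma partial_sum_moments n k : (k <= 2)%N ->
  [/\ trig_moments_exist P (partial_sum X n) k,
    modulus_dominated (n - k) (cos_moment P (partial_sum X n) k) &
    modulus_dominated (n - k) (sin_moment P (partial_sum X n) k)].
Proof.
elim: n k => [|n IH] k k2.
  have S0 w : partial_sum X 0 w = 0 by rewrite /= big_ord0.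
  have i0 : P.-integrable setT (EFin \o (fun w => partial_sum X 0 w ^+ k)).
    rewrite (_ : (fun w => _) = cst (0 ^+ k)); last by apply/funext => w; rewrite S0.
    exact: finite_measure_integrable_cst.
  have le1 : `|0 ^+ k : R| <= 1 by rewrite expr0n; case: (k == 0)%N; rewrite ?normr1 ?normr0.
  split; first exact: trig_moments_integrable.
    exists 1 => // t; rewrite sub0n expr0 mulr1 /cos_moment.
    under eq_Rintegral do rewrite S0 mulr0 cos0 mulr1.
    by rewrite Rintegral_cst_probability.
  exists 1 => // t; rewrite sub0n expr0 mulr1 /sin_moment.
  under eq_Rintegral do rewrite S0 mulr0 sin0 mulr0.
  by rewrite Rintegral_cst_probability normr0.
have SW : (partial_sum X n.+1 : T -> R) = (fun w => partial_sum X n w + X n w).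
  by apply/funext => w; rewrite /= big_ord_recr.
have Sk j : (j <= k)%N -> trig_moments_exist P (partial_sum X n) j.
  by move=> jk; have [] := IH j (leq_trans jk k2).
have Zk j : (j <= k)%N -> trig_moments_exist P (X n) j.
  by move=> jk; exact: iid_trig_moments_exist (leq_trans jk k2).
have ind A B : measurable A -> measurable B -> P (partial_sum X n @^-1` A `&` X n @^-1` B) =
    (P (partial_sum X n @^-1` A) * P (X n @^-1` B))%E by exact: partial_sum_independent.
have cosE t := cos_moment_sum ind Sk Zk t.
have sinE t := sin_moment_sum ind Sk Zk t.
(* For i = 0 the exponents add up to (n - k) + 1; for i > 0 the second is 0, but the first is
   already at least n + 1 - k. *)
have prod_dom (i : 'I_k.+1) F G : modulus_dominated (n - (k - i)) F ->
    modulus_dominated (i == 0 :> nat)%N G -> modulus_dominated (n.+1 - k) (fun t => F t * G t).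
  move=> dF dG; apply: modulus_dominatedW (modulus_dominatedM dF dG).
  have := ltn_ord i; case: (val i) => [|j] /= jk; rewrite ?eqxx/=; lia.
have dS (i : 'I_k.+1) : modulus_dominated (n - (k - i)) (cos_moment P (partial_sum X n) (k - i)) /\
    modulus_dominated (n - (k - i)) (sin_moment P (partial_sum X n) (k - i)).
  by have [] := IH (k - i)%N (leq_trans (leq_subr _ _) k2).
have dZ (i : 'I_k.+1) : modulus_dominated (i == 0 :> nat)%N (cos_moment P (X n) i) /\
    modulus_dominated (i == 0 :> nat)%N (sin_moment P (X n) i).
  by apply: single_moment_dominated; rewrite (leq_trans _ k2)// -ltnS.
split.
- move=> t; rewrite /cos_moment /sin_moment SW.
  by have [[ic _] [jc _]] := (cosE t, sinE t).
- have -> : cos_moment P (partial_sum X n.+1) k = (fun t => \sum_(i < k.+1) 'C(k, i)%:R *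
      (cos_moment P (partial_sum X n) (k - i) t * cos_moment P (X n) i t
      + (-1) * (sin_moment P (partial_sum X n) (k - i) t * sin_moment P (X n) i t))).
    by apply/funext => t; rewrite /cos_moment SW; have [_ ->] := cosE t.
  apply: modulus_dominated_sum => i; apply: modulus_dominatedZ; have [? ?] := dS i; have [? ?] := dZ i.
  by apply: modulus_dominatedD; [|apply: modulus_dominatedZ]; exact: (prod_dom i).
- have -> : sin_moment P (partial_sum X n.+1) k = (fun t => \sum_(i < k.+1) 'C(k, i)%:R *
      (sin_moment P (partial_sum X n) (k - i) t * cos_moment P (X n) i t
      + 1 * (cos_moment P (partial_sum X n) (k - i) t * sin_moment P (X n) i t))).
    by apply/funext => t; rewrite /sin_moment SW; have [_ ->] := sinE t.
  apply: modulus_dominated_sum => i; apply: modulus_dominatedZ; have [? ?] := dS i; have [? ?] := dZ i.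
  by apply: modulus_dominatedD; [|apply: modulus_dominatedZ]; exact: (prod_dom i).
Qed.

(** For k = 0 the addition formulas multiply the two moments like real and imaginary parts, so their
    sums of squares multiply. *)
Lemma partial_sum_modulus n t :
  cos_moment P (partial_sum X n) 0 t ^+ 2 + sin_moment P (partial_sum X n) 0 t ^+ 2 =
  (modulus t ^+ 2) ^+ n.
Proof.
elim: n => [|n IH].
  have S0 w : partial_sum X 0 w = 0 by rewrite /= big_ord0.
  rewrite /cos_moment /sin_moment.
  under eq_Rintegral do rewrite S0 mulr0 cos0 mulr1.
  under [X in _ + X ^+ 2]eq_Rintegral do rewrite S0 mulr0 sin0 mulr0.
  by rewrite !Rintegral_cst_probability !expr0 expr1n expr0n addr0.
have SW : (partial_sum X n.+1 : T -> R) = (fun w => partial_sum X n w + X n w).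
  by apply/funext => w; rewrite /= big_ord_recr.
have ind A B : measurable A -> measurable B -> P (partial_sum X n @^-1` A `&` X n @^-1` B) =
    (P (partial_sum X n @^-1` A) * P (X n @^-1` B))%E by exact: partial_sum_independent.
have Sk j : (j <= 0)%N -> trig_moments_exist P (partial_sum X n) j.
  by rewrite leqn0 => /eqP ->; have [] := @partial_sum_moments n 0 isT.
have Zk j : (j <= 0)%N -> trig_moments_exist P (X n) j.
  by rewrite leqn0 => /eqP ->; exact: iid_trig_moments_exist.
have [_] := cos_moment_sum ind Sk Zk t; have [_] := sin_moment_sum ind Sk Zk t.
rewrite !big_ord1 !bin0 !mul1r mulN1r iid_cos_moment// iid_sin_moment// subn0.
rewrite /cos_moment /sin_moment SW -!/(cos_moment _ _ _ _) -!/(sin_moment _ _ _ _) => -> ->.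
rewrite [RHS]exprS -IH sqr_modulus; ring.
Qed.

End iid_decay.

(** * Smooth densities of the normalized sums *)

Section smooth_normalized_sum.
Context {R : realType} {d : measure_display} {T : measurableType d}.
Variables (P : probability T R) (X : nat -> {RV P >-> R}).
Hypothesis Hind : mutually_independent P (fun n => X n : T -> R).
Hypothesis Hid : identically_distributed P (fun n => X n : T -> R).
Hypothesis iX2 : P.-integrable setT (EFin \o (fun w => X 0%N w ^+ 2)).

Let Z := normalized_sum (fun n => X n : T -> R).

Lemma measurable_normalized_sum n : measurable_fun setT (Z n).
Proof. by apply: measurable_funM => //; exact: measurable_partial_sum. Qed.

Definition normalized_RV n : {RV P >-> R} := mfun_Sub (mem_set (measurable_normalized_sum n)).

Let a n : R := (Num.sqrt n%:R)^-1.

Let scaled_moments n k (t : R) : (k <= 2)%N ->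
  cos_moment P (Z n) k t = a n ^+ k * cos_moment P (partial_sum X n) k (t * a n) /\
  sin_moment P (Z n) k t = a n ^+ k * sin_moment P (partial_sum X n) k (t * a n).
Proof.
move=> k2; have [+ _ _] := partial_sum_moments Hind Hid iX2 n k2.
move=> /(_ (t * a n))[[ic _] [jc _]]; split.
  rewrite /cos_moment -RintegralZl//; apply: eq_Rintegral => w _.
  by rewrite /Z /normalized_sum exprMn [_ * a n ^+ k]mulrC -!mulrA [a n * _]mulrC mulrA.
rewrite /sin_moment -RintegralZl//; apply: eq_Rintegral => w _.
by rewrite /Z /normalized_sum exprMn [_ * a n ^+ k]mulrC -!mulrA [a n * _]mulrC mulrA.
Qed.

Lemma normalized_sum_integrable n : P.-integrable setT (EFin \o (fun w => Z n w ^+ 2)).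
Proof.
have [+ _ _] := @partial_sum_moments _ _ _ P X Hind Hid iX2 n 2 isT.
move=> /(_ 0)[[ic _] _].
have E : EFin \o (fun w => Z n w ^+ 2) =
    (fun w => (a n ^+ 2)%:E * (partial_sum X n w ^+ 2 * cos (0 * partial_sum X n w))%:E)%E.
  by apply/funext => w; rewrite /= mul0r cos0 mulr1 -EFinM /Z /normalized_sum exprMn mulrC.
by rewrite E; exact: integrableZl.
Qed.

Lemma normalized_sum_modulus n t :
  cos_moment P (Z n) 0 t ^+ 2 + sin_moment P (Z n) 0 t ^+ 2 = (modulus X (t * a n) ^+ 2) ^+ n.
Proof.
have [-> ->] := @scaled_moments n 0 t isT.
by rewrite !expr0 !mul1r (partial_sum_modulus Hind Hid iX2).
Qed.

Variables (N : nat) (K : R).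
Hypothesis modulus_decay : forall t, 0 <= t -> modulus X t ^+ N <= K * (1 + t ^+ 2)^-1 ^+ 2.

(** Moments of order at most 2 cost at most two powers of |f_1|, so the N powers of the hypothesis
    remain. *)
Let n := N.+2.

Let a_gt0 : 0 < a n. Proof. by rewrite invr_gt0 sqrtr_gt0 ltr0n. Qed.

Let a_le1 : a n <= 1.
Proof.
rewrite invf_le1 ?sqrtr_gt0 ?ltr0n// -[leLHS]sqrtr1 ler_wsqrtr// ler1n//.
Qed.

Lemma quart_decay_scaled k (F G : R -> R) : (k <= 2)%N -> modulus_dominated X (n - k) F ->
  (forall t, G t = a n ^+ k * F (t * a n)) -> measurable_fun setT G -> quart_decay G.
Proof.
move=> k2 dF E mG; split => //.
have : modulus_dominated X N F by apply: modulus_dominatedW dF; rewrite /n; lia.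
(* Since a <= 1, one has 1 + t^2 <= a^-2 (1 + (ta)^2); its square is the price of rescaling the
   argument. *)
move=> [L L0 HL]; exists (L * K * (a n ^- 2) ^+ 2) => t t0.
have a0 := a_gt0; have a1 := a_le1.
have ta0 : 0 <= t * a n by rewrite mulr_ge0// ltW.
have K0 : 0 <= K.
  have := modulus_decay (lexx 0); rewrite expr0n addr0 invr1 expr1n mulr1.
  by apply: le_trans; rewrite exprn_ge0// modulus_ge0.
rewrite E normrM.
have ak : `|a n ^+ k| <= 1 by rewrite ger0_norm ?exprn_ge0 ?exprn_ile1// ltW.
apply: (le_trans (ler_wpM2r (normr_ge0 _) ak)); rewrite mul1r.
apply: (le_trans (HL _)).
have -> : L * K * (a n ^- 2) ^+ 2 * (1 + t ^+ 2)^-1 ^+ 2 =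
    L * (K * (a n ^- 2 * (1 + t ^+ 2)^-1) ^+ 2) by rewrite [in RHS]exprMn !mulrA.
rewrite ler_wpM2l//; apply: (le_trans (modulus_decay ta0)); rewrite ler_wpM2l//.
rewrite ler_pXn2r ?nnegrE ?mulr_ge0 ?invr_ge0 ?exprn_ge0 ?(ltW (oneDsqr_pos _)) ?(ltW a0)//.
rewrite -invfM lef_pV2 ?posrE ?mulr_gt0 ?exprn_gt0 ?oneDsqr_pos//.
rewrite exprMn mulrDr mulr1 mulrC lerD2r exprn_ile1// ltW//.
Qed.

Lemma smooth_normalized_sum : exists2 n0 : nat, (0 < n0)%N &
  exists p p' p'' : R -> R, exists L : R, [/\ is_density P (Z n0) p,
  forall x : R, is_derive x 1 p (p' x), forall x : R, is_derive x 1 p' (p'' x) &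
  forall x, `|p' x| <= L * (1 + x ^+ 2)^-1 /\ `|p'' x| <= L * (1 + x ^+ 2)^-1].
Proof.
exists n => //; rewrite -/(normalized_RV n : T -> R).
have iZ2 := normalized_sum_integrable n.
have mZ := measurable_normalized_sum n.
have cM k : P.-integrable setT (EFin \o (fun w => Z n w ^+ k)) ->
    measurable_fun setT (cos_moment P (Z n) k).
  move=> ik; apply: continuous_measurable_fun.
  exact: (continuous_moment ik mZ (@continuous_cos R) (@cos_norm_le1 R)).
have sM k : P.-integrable setT (EFin \o (fun w => Z n w ^+ k)) ->
    measurable_fun setT (sin_moment P (Z n) k).
  move=> ik; apply: continuous_measurable_fun.
  exact: (continuous_moment ik mZ (@continuous_sin R) (@sin_norm_le1 R)).
have i0 : P.-integrable setT (EFin \o (fun w => Z n w ^+ 0)).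
  exact: finite_measure_integrable_cst.
have qc k : (k <= 2)%N -> P.-integrable setT (EFin \o (fun w => Z n w ^+ k)) ->
    quart_decay (cos_moment P (Z n) k).
  move=> k2 ik; have [_ H _] := partial_sum_moments Hind Hid iX2 n k2.
  by apply: (quart_decay_scaled k2 H) (cM k ik) => t; have [] := scaled_moments n t k2.
have qs k : (k <= 2)%N -> P.-integrable setT (EFin \o (fun w => Z n w ^+ k)) ->
    quart_decay (sin_moment P (Z n) k).
  move=> k2 ik; have [_ _ H] := partial_sum_moments Hind Hid iX2 n k2.
  by apply: (quart_decay_scaled k2 H) (sM k ik) => t; have [] := scaled_moments n t k2.
have ec : cos_moment P (Z n) 0 = (fun t => \int[P]_w cos (t * normalized_RV n w)).
  by apply/funext => t; exact: Rintegral_mul1.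
have es : sin_moment P (Z n) 0 = (fun t => \int[P]_w sin (t * normalized_RV n w)).
  by apply/funext => t; exact: Rintegral_mul1.
have q1 := qc 0%N isT i0; have q2 := qs 0%N isT i0; rewrite ec in q1; rewrite es in q2.
exact: (@smooth_density _ _ _ P (normalized_RV n) iZ2 q1 q2 (qc 2%N isT iZ2) (qs 2%N isT iZ2)).
Qed.

End smooth_normalized_sum.

Lemma powR_decay {R : realType} (m : R -> R) (C t0 eps : R) : 0 < eps ->
  (forall t, 0 <= m t) -> (forall t, m t <= 1) ->
  (forall t, t0 <= t -> m t <= C * t `^ (- eps)) ->
  exists N (K : R), forall t, 0 <= t -> m t ^+ N <= K * (1 + t ^+ 2)^-1 ^+ 2.
Proof.
move=> eps0 m0 m1 H.
(* N eps >= 4, so the N-th power of t^(-eps) is at most t^-4 for t >= 1. *)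
pose N := Num.bound (4 / eps); exists N.
have Neps : 4 <= N%:R * eps.
  by rewrite -ler_pdivrMr// ltW// archi_boundP// divr_ge0// ltW.
(* Beyond D the hypothesis holds and t >= 1, so that 1 + t^2 <= 2 t^2; this produces the factor 4 in
   the constant. Up to D only m^N <= 1 is known, and (1 + D^2)^2 compensates. Since t0 may be
   negative, D also keeps away from bases where [powR] is not a genuine power. *)
pose D := Num.max 1 t0.
have D1 : 1 <= D by rewrite le_max lexx.
have Dt : t0 <= D by rewrite le_max lexx orbT.
have D0 : 0 < D by exact: lt_le_trans D1.
have C0 : 0 <= C.
  have := le_trans (m0 D) (H D Dt).
  by rewrite pmulr_lge0// powR_gt0.
exists (4 * C ^+ N + (1 + D ^+ 2) ^+ 2) => t t_ge0.
have t2 := oneDsqr_pos t.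
have i2 : 0 <= (1 + t ^+ 2)^-1 ^+ 2 by rewrite exprn_ge0// invr_ge0 ltW.
have CN : 0 <= C ^+ N by exact: exprn_ge0.
rewrite mulrDl; have [tD|Dt'] := leP t D.
  apply: (@le_trans _ _ ((1 + D ^+ 2) ^+ 2 * (1 + t ^+ 2)^-1 ^+ 2)); last by rewrite lerDr mulr_ge0// mulr_ge0.
  apply: (le_trans (exprn_ile1 _ (m0 t) (m1 t))).
  rewrite -exprMn -[leLHS](expr1n _ 2) ler_pXn2r ?nnegrE ?mulr_ge0 ?invr_ge0 ?(ltW t2) ?(ltW (oneDsqr_pos D))//.
  by rewrite ler_pdivlMr// mul1r lerD2l ler_pXn2r ?nnegrE// ltW.
apply: (@le_trans _ _ (4 * C ^+ N * (1 + t ^+ 2)^-1 ^+ 2)); last by rewrite lerDl mulr_ge0// exprn_ge0// addr_ge0// sqr_ge0.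
have t1 : 1 <= t by exact: le_trans D1 (ltW Dt').
have tp : 0 < t by exact: lt_le_trans t1.
apply: (@le_trans _ _ ((C * t `^ (- eps)) ^+ N)).
  have mt := H t (le_trans Dt (ltW Dt')).
  by apply: lerXn2r => //; rewrite nnegrE//; exact: le_trans mt.
rewrite exprMn -[(t `^ _) ^+ N]powR_mulrn ?powR_ge0// -powRrM.
rewrite [4 * _]mulrC -mulrA ler_wpM2l//.
apply: (@le_trans _ _ (t ^- 4)).
  have -> : t ^- 4 = t `^ (- 4) by rewrite powRN powR_mulrn// ltW.
  apply: ler_powR => //.
  by rewrite mulNr lerN2 mulrC.
rewrite -exprVn -(@ler_pM2r _ (t ^+ 4 * (1 + t ^+ 2) ^+ 2)) ?mulr_gt0 ?exprn_gt0//.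
have -> : t^-1 ^+ 4 * (t ^+ 4 * (1 + t ^+ 2) ^+ 2) = (1 + t ^+ 2) ^+ 2 by field; rewrite gt_eqF.
have -> : 4 * (1 + t ^+ 2)^-1 ^+ 2 * (t ^+ 4 * (1 + t ^+ 2) ^+ 2) = (2 * t ^+ 2) ^+ 2 by field; rewrite gt_eqF.
rewrite ler_pXn2r ?nnegrE ?mulr_ge0 ?exprn_ge0 ?(ltW t2)//.
by rewrite mulr2n mulrDl mul1r lerD2r -(expr1n _ 2) ler_pXn2r ?nnegrE.
Qed.

(** * Fisher information and variation of smooth densities *)

Lemma integral_invD1sqr_lty {R : realType} (K : R) : 0 <= K ->
  (\int[lebesgue_measure]_x (K * (1 + x ^+ 2)^-1)%:E < +oo)%E.
Proof.
move=> K0; have f0 (x : R) : 0 <= K * (1 + x ^+ 2)^-1.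
  by rewrite mulr_ge0// invr_ge0 ltW// oneDsqr_pos.
rewrite ge0_symfun_integralT//.
- have -> : [set x : R | 0 <= x] = `[0, +oo[%classic.
    by apply/seteqP; split => x /=; rewrite in_itv/= andbT.
  have [_] := integrableP _ _ _ (integrable_invD1sqr K).
  under eq_integral => x _ do rewrite /= ger0_norm//.
  by move=> h; rewrite lte_mul_pinfty.
- by move=> x; apply: cvgM; [exact: cvg_cst|exact: continuous_oneDsqrV].
- by move=> x /=; rewrite sqrrN.
Qed.

Section lipschitz_integral.
Context {R : realType}.

Lemma derive_bound_lipschitz (p p' : R -> R) (K : R) : (forall x : R, is_derive x 1 p (p' x)) ->
  (forall x, `|p' x| <= K) -> forall x y, x <= y -> `|p y - p x| <= K * (y - x).
Proof.
move=> dp pK x y xy.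
have [c _ ->] := @MVT_segment _ p p' x y xy (fun z _ => dp z)
  (continuous_subspaceT (is_derive1_continuous dp)).
by rewrite normrM (ger0_norm (_ : 0 <= y - x)) ?subr_ge0// ler_wpM2r// subr_ge0.
Qed.

Lemma lipschitz_abs_continuous (f : R -> R) (K : R) :
  (forall x y, x <= y -> `|f y - f x| <= K * (y - x)) -> abs_continuous f.
Proof.
move=> fK a b e e0.
pose L := Num.max K 1; have L0 : 0 < L by rewrite lt_max ltr01 orbT.
exists (e / L); first exact: divr_gt0.
move=> s _ sb sdl; apply: (@le_lt_trans _ _ (L * \sum_(u <- s) (u.2 - u.1))).
  rewrite mulr_sumr !big_seq; apply: ler_sum => u us.
  have /andP[u12 _] := allP sb u us.
  by apply: (le_trans (fK _ _ u12)); rewrite ler_wpM2r ?subr_ge0// le_max lexx.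
by rewrite mulrC -ltr_pdivlMr.
Qed.

(* Minimising the second-order upper bound p + h p' + M h^2 of p(x + h) >= 0 over
   |h| <= 1/2 gives p'^2 <= 4 M p as soon as M dominates |p'(x)| and |p''| near x. *)
Lemma sqr_derive_le (p p' p'' : R -> R) (x M : R) : 0 < M ->
  (forall y, 0 <= p y) ->
  (forall x : R, is_derive x 1 p (p' x)) -> (forall x : R, is_derive x 1 p' (p'' x)) ->
  `|p' x| <= M -> (forall y, `|y - x| <= 1 -> `|p'' y| <= M) ->
  p' x ^+ 2 <= 4 * M * p x.
Proof.
move=> M0 p0 dp dp' pM p''M.
have cp := is_derive1_continuous dp; have cp' := is_derive1_continuous dp'.
have near_lip y : `|y - x| <= 1 -> `|p' y - p' x| <= M * `|y - x|.
  move=> yx; have [xy|/ltW yx'] := leP x y.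
    have [c + ->] := @MVT_segment _ p' p'' x y xy (fun z _ => dp' z) (continuous_subspaceT cp').
    rewrite in_itv/= => /andP[xc cy]; rewrite normrM ler_wpM2r// p''M//.
    move: yx; rewrite !ger0_norm ?subr_ge0//; lra.
  have [c + e] := @MVT_segment _ p' p'' y x yx' (fun z _ => dp' z) (continuous_subspaceT cp').
  rewrite distrC [`|y - x|]distrC e in_itv/= => /andP[xc cy]; rewrite normrM ler_wpM2r// p''M//.
  by move: yx; rewrite distrC [`|c - x|]distrC !ger0_norm ?subr_ge0//; lra.
have taylor h : `|h| <= 1 -> p (x + h) <= p x + h * p' x + M * h ^+ 2.
  move=> h1; have [h0|/ltW h0] := leP 0 h.
    have xh : x <= x + h by rewrite lerDl.
    have [c + e] := @MVT_segment _ p p' x (x + h) xh (fun z _ => dp z) (continuous_subspaceT cp).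
    rewrite in_itv/= => /andP[xc cy].
    have cx1 : `|c - x| <= h by rewrite ger0_norm ?subr_ge0//; lra.
    have h1' : h <= 1 by move: h1; rewrite ger0_norm.
    have := near_lip c (le_trans cx1 h1') => /(le_trans (ler_norm _)) l1.
    have l2 : p' c - p' x <= M * h by apply: (le_trans l1); rewrite ler_wpM2l// ltW.
    have l3 := ler_wpM2r h0 l2.
    have -> : p (x + h) = p x + p' c * h by rewrite -(subrK (p x) (p (x + h))) e; ring.
    by rewrite -subr_ge0; move: l3; rewrite -subr_ge0 => l3; apply: le_trans l3 _; rewrite le_eqVlt; apply/orP; left; apply/eqP; ring.
  have xh : x + h <= x by rewrite gerDl.
  have [c + e] := @MVT_segment _ p p' (x + h) x xh (fun z _ => dp z) (continuous_subspaceT cp).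
  rewrite in_itv/= => /andP[xc cy].
  have cx1 : `|c - x| <= - h by rewrite ler0_norm ?subr_le0//; lra.
  have h1' : - h <= 1 by move: h1; rewrite ler0_norm.
  have := near_lip c (le_trans cx1 h1'); rewrite distrC => /(le_trans (ler_norm _)) l1.
  have l2 : p' x - p' c <= M * (- h) by apply: (le_trans l1); rewrite ler_wpM2l// ltW.
  have nh0 : 0 <= - h by rewrite oppr_ge0.
  have l3 := ler_wpM2r nh0 l2.
  have -> : p (x + h) = p x + p' c * h by rewrite -(subKr (p x) (p (x + h))) e; ring.
  by rewrite -subr_ge0; move: l3; rewrite -subr_ge0 => l3; apply: le_trans l3 _; rewrite le_eqVlt; apply/orP; left; apply/eqP; ring.
pose h := - p' x / (2 * M).
have M2 : 0 < 2 * M by rewrite mulr_gt0.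
have h1 : `|h| <= 1.
  rewrite /h mulNr normrN normrM (ger0_norm (_ : 0 <= (2 * M)^-1)) ?invr_ge0 ?(ltW M2)//.
  rewrite ler_pdivrMr// mul1r; apply: (le_trans pM); lra.
have := le_trans (p0 _) (taylor h h1).
have -> : p x + h * p' x + M * h ^+ 2 = p x - p' x ^+ 2 / (4 * M).
  by rewrite /h; field; rewrite gt_eqF.
by rewrite subr_ge0 ler_pdivrMr ?mulr_gt0// mulrC.
Qed.

(** The previous lemma is applied with M = 3K/(1 + x^2). If |y - x| <= 1 then x^2 <= 2 y^2 + 2,
    hence 1 + x^2 <= 3(1 + y^2), so this M dominates |p''| near x. The integrand is then at most 4M
    = 12K/(1 + x^2). Taking K = max(L, 1) makes M positive. *)
Lemma fisher_integral_lty (p p' p'' : R -> R) (L : R) :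
  measurable_fun setT p -> (forall y, 0 <= p y) ->
  (forall x : R, is_derive x 1 p (p' x)) -> (forall x : R, is_derive x 1 p' (p'' x)) ->
  (forall x, `|p' x| <= L * (1 + x ^+ 2)^-1 /\ `|p'' x| <= L * (1 + x ^+ 2)^-1) ->
  (\int[lebesgue_measure]_(x in [set x | (0 < p x)%R]) ((derive1 p x) ^+ 2 / p x)%R%:E < +oo)%E.
Proof.
move=> mp p0 dp dp' H.
pose K := Num.max L 1; have K0 : 0 < K by rewrite lt_max ltr01 orbT.
have mD : measurable [set x | 0 < p x].
  have := mp measurableT `]0, +oo[%classic (measurable_itv _); rewrite setTI.
  by congr measurable; apply/seteqP; split => x /=; rewrite in_itv/= andbT.
have derE x : derive1 p x = p' x by rewrite derive1E; exact: (@derive_val _ _ _ _ _ _ _ (dp x)).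
have mp' : measurable_fun setT p' by apply: continuous_measurable_fun; exact: is_derive1_continuous dp'.
apply: (@le_lt_trans _ _ (\int[lebesgue_measure]_x (12 * K * (1 + x ^+ 2)^-1)%:E)%E); last first.
  by apply: integral_invD1sqr_lty; rewrite mulr_ge0// ltW.
have b0 (x : R) : 0 <= 12 * K * (1 + x ^+ 2)^-1.
  by rewrite mulr_ge0 ?invr_ge0 ?(ltW (oneDsqr_pos _))// mulr_ge0// ltW.
have mb : measurable_fun setT (fun x : R => 12 * K * (1 + x ^+ 2)^-1).
  by apply: measurable_funM => //; exact: measurable_invD1sqr.
apply: (@le_trans _ _ (\int[lebesgue_measure]_(x in [set x | (0 < p x)%R]) (12 * K * (1 + x ^+ 2)^-1)%:E)%E); last first.
  apply: ge0_subset_integral => //; first exact/measurable_EFinP.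
  by move=> x _; rewrite lee_fin.
apply: ge0_le_integral => //.
- by move=> x px; rewrite lee_fin divr_ge0 ?sqr_ge0.
- apply/measurable_EFinP; apply: measurable_funTS.
  rewrite (_ : (fun x => _) = (fun x => p' x ^+ 2 * (p x)^-1)); last by apply/funext => x; rewrite derE.
  apply: measurable_funM; first exact: measurable_funX.
  rewrite (_ : (fun x => _) = (fun x => p x `^ (- 1))); last by apply/funext => x; rewrite powR_inv1.
  exact: (measurableT_comp (measurable_powR (- 1)) mp).
- by apply/measurable_EFinP; exact: measurable_funTS.
- move=> x px; rewrite lee_fin derE ler_pdivrMr//.
  have i0 y : 0 < (1 + y ^+ 2)^-1 :> R by rewrite invr_gt0 oneDsqr_pos.
  have M0 : 0 < 3 * K * (1 + x ^+ 2)^-1 by rewrite !mulr_gt0.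
  have LK y : L * (1 + y ^+ 2)^-1 <= K * (1 + y ^+ 2)^-1 by rewrite ler_wpM2r ?(ltW (i0 y))// le_max lexx.
  have := @sqr_derive_le p p' p'' x (3 * K * (1 + x ^+ 2)^-1) M0 p0 dp dp'.
  have -> : 12 * K * (1 + x ^+ 2)^-1 = 4 * (3 * K * (1 + x ^+ 2)^-1) by ring.
  apply.
    have [h _] := H x; apply: (le_trans h); apply: (le_trans (LK x)).
    by rewrite ler_wpM2r ?(ltW (i0 x))//; lra.
  move=> y yx; have [_ h] := H y; apply: (le_trans h); apply: (le_trans (LK y)).
  rewrite [3 * K]mulrC -mulrA ler_wpM2l ?(ltW K0)//.
  rewrite ler_pdivlMr ?oneDsqr_pos// mulrC ler_pdivrMr ?oneDsqr_pos//.
  have : x ^+ 2 <= 2 * y ^+ 2 + 2 * (y - x) ^+ 2.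
    rewrite -subr_ge0 (_ : _ - _ = (2 * y - x) ^+ 2) ?sqr_ge0//; ring.
  have : (y - x) ^+ 2 <= 1.
    by rewrite -[leLHS]real_normK ?num_real// -(expr1n _ 2) ler_pXn2r ?nnegrE.
  have := sqr_ge0 y; lra.
Qed.

(** Used with G = |p'| for C^1 functions, and for absolutely continuous ones with a majorant that is
    only constructed relative to a window [A, B]; hence the window in the hypothesis. *)
Lemma variation_le_integral (p : R -> R) (G : R -> \bar R) (A B : R) :
  measurable_fun setT G -> (forall x, 0 <= G x)%E ->
  (forall x y, A <= x -> x < y -> y <= B ->
    (`|p y - p x|%:E <= \int[lebesgue_measure]_(z in `]x, y]) G z)%E) ->
  forall s, sorted <%R s -> all (fun x => A <= x <= B) s ->
  ((\sum_(k < (size s).-1) `|p (nth 0 s k.+1) - p (nth 0 s k)|)%:E <=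
    \int[lebesgue_measure]_z G z)%E.
Proof.
move=> mG G0 H [_ _|x s /= xs] /=; first by rewrite big_ord0 integral_ge0.
move=> /andP[/andP[Ax xB] sAB].
apply: (@le_trans _ _ (\int[lebesgue_measure]_(z in `]x, last x s]) G z)%E); last first.
  by apply: ge0_subset_integral.
elim: s x Ax xB xs sAB => [|y s IH] x Ax xB /=.
  by move=> _ _; rewrite big_ord0 integral_ge0.
move=> /andP[xy ys] /andP[/andP[Ay yB] sAB].
rewrite big_ord_recl /= EFinD.
have yl : y <= last y s.
  have : all (<%R y) s by apply: order_path_min ys; exact: lt_trans.
  by case: (s) => [//|z s'] /allP/(_ (last z s')); rewrite mem_last => /(_ isT)/ltW.
have -> : (\int[lebesgue_measure]_(z in `]x, last y s]) G z =
    \int[lebesgue_measure]_(z in `]x, y]) G z + \int[lebesgue_measure]_(z in `]y, last y s]) G z)%E.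
  rewrite -ge0_integral_setU//=.
  - congr integral; apply/seteqP; split => z /=; rewrite !in_itv/=.
      by move=> /andP[xz zl]; case: (leP z y) => zy; [left|right]; apply/andP.
    by case=> /andP[h1 h2]; apply/andP; split => //; [exact: le_trans yl|exact: lt_trans h1].
  - exact: measurable_funTS.
  - apply/disj_setPS => z [] /=; rewrite !in_itv/= => /andP[_ zy] /andP[yz _].
    by move: (lt_le_trans yz zy); rewrite ltxx.
by apply: leeD; [exact: H|exact: IH].
Qed.

Lemma seq_in_itv (s : seq R) : exists A B, A < B /\ all (fun x => A <= x <= B) s.
Proof.
elim: s => [|x s [A [B [AB sAB]]]]; first by exists 0, 1; rewrite ltr01.
exists (Num.min x A), (Num.max x B); split.
  by rewrite lt_max !gt_min AB !orbT.
rewrite /= ge_min lexx le_max lexx /=; apply: sub_all sAB => y /andP[Ay yB].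
by rewrite ge_min Ay orbT le_max yB orbT.
Qed.

Lemma continuous_between (p : R -> R) : continuous p -> between_one_sided_limits p.
Proof.
move=> cp x; exists (p x), (p x); split; first by apply: cvg_at_left_filter; exact: cp.
split; first by apply: cvg_at_right_filter; exact: cp.
by rewrite minxx maxxx lexx.
Qed.

Lemma C1_bounded_variation (p : R -> R) : (forall x, derivable p x 1) ->
  continuous (derive1 p) -> (\int[lebesgue_measure]_x (`|derive1 p x|)%:E < +oo)%E ->
  bounded_total_variation p.
Proof.
move=> dp cp' pfin.
have cp : continuous p by move=> x; apply: differentiable_continuous; apply/derivable1_diffP.
have mp' : measurable_fun setT (fun x => (`|derive1 p x|)%:E).
  by apply/measurable_EFinP; apply: measurableT_comp => //; exact: continuous_measurable_fun.
exists (fine (\int[lebesgue_measure]_x (`|derive1 p x|)%:E)) => s ss.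
have fn : (\int[lebesgue_measure]_x (`|derive1 p x|)%:E)%E \is a fin_num.
  by rewrite ge0_fin_numE// integral_ge0.
rewrite -lee_fin fineK//.
have [A [B [_ sAB]]] := seq_in_itv s.
apply: (@variation_le_integral p _ A B) => // x y _ xy _.
rewrite integral_itv_obnd_cbnd; last by apply: measurable_funTS.
have cpi : {within `[x, y], continuous (derive1 p)} by exact: continuous_subspaceT.
have E : (\int[lebesgue_measure]_(z in `[x, y]) (derive1 p z)%:E = (p y - p x)%:E)%E.
  rewrite (continuous_FTC2 xy cpi (F := p)) ?EFinB//.
  by split; [move=> z _; exact: dp|apply: cvg_at_right_filter; exact: cp|apply: cvg_at_left_filter; exact: cp].
rewrite -abse_EFin -E; apply: le_abse_integral => //.
by apply/measurable_EFinP; apply: measurable_funTS; exact: continuous_measurable_fun.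
Qed.

End lipschitz_integral.

(** * Densities of bounded variation *)

Section density_expectation.
Context {R : realType} {d : measure_display} {T : measurableType d}.
Variables (P : probability T R) (Y : {RV P >-> R}) (p : R -> R).
Hypothesis pY : is_density P Y p.
Notation mu := (@lebesgue_measure R).

Let p_ge0 x : 0 <= p x. Proof. by case: pY. Qed.

Let mp : measurable_fun setT p. Proof. by case: pY => _ []. Qed.

Let int_p A : measurable A -> distribution P Y A = (\int[mu]_(x in A) (p x)%:E)%E.
Proof. by case: pY => _ [_]; apply. Qed.

Lemma integral_density : (\int[mu]_x (p x)%:E = 1)%E.
Proof. by rewrite -int_p// probability_setT. Qed.

Lemma integrable_density : mu.-integrable setT (EFin \o p).
Proof.
apply/integrableP; split; first exact/measurable_EFinP.
under eq_integral => x _ do rewrite /= ger0_norm//.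
by rewrite integral_density ltry.
Qed.

(** A density is defined by its integrals over sets. The law is therefore dominated by Lebesgue
    measure, and its Radon-Nikodym derivative, having the same integrals as [p] over all measurable
    sets, equals [p] almost everywhere. *)
Lemma ge0_integral_density (g : R -> \bar R) : measurable_fun setT g -> (forall x, 0 <= g x)%E ->
  (\int[P]_w g (Y w) = \int[mu]_x (g x * (p x)%:E))%E.
Proof.
move=> mg g0.
have mY : @measurable_fun _ _ T (measurableTypeR R) setT Y by exact: (measurable_funPT Y).
pose Y' : {RV P >-> measurableTypeR R} := @mfun_Sub _ _ T (measurableTypeR R) Y (mem_set mY).
have dom : distribution P Y' `<< mu.
  apply/null_content_dominatesP => A mA A0.
  transitivity (\int[mu]_(x in A) (p x)%:E)%E; first exact: int_p.
  rewrite null_set_integral//.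
  by apply/measurable_EFinP; exact: measurable_funTS.
have := @Radon_Nikodym_SigmaFinite.change_of_variables _ _ _ (distribution P Y') mu dom g setT g0 measurableT mg.
rewrite ge0_integral_distribution// => <-.
set f := Radon_Nikodym_SigmaFinite.f _ _.
have mf : measurable_fun setT f by exact: (measurable_int _ (Radon_Nikodym_SigmaFinite.f_integrable dom)).
apply: ge0_ae_eq_integral => //.
- exact: emeasurable_funM.
- by apply: emeasurable_funM => //; exact/measurable_EFinP.
- by move=> x _; rewrite mule_ge0// Radon_Nikodym_SigmaFinite.f_ge0.
- by move=> x _; rewrite mule_ge0// lee_fin.
have fp : ae_eq mu setT f (EFin \o p).
  apply: integral_ae_eq => //.
  - exact: Radon_Nikodym_SigmaFinite.f_integrable.
  - exact/measurable_EFinP.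
  - by move=> A _ mA; rewrite -Radon_Nikodym_SigmaFinite.f_integral//; exact: int_p.
by move: fp; apply: filterS => x /(_ I) fx _; rewrite /= fx.
Qed.

Lemma Rintegral_density (g : R -> R) : measurable_fun setT g -> (forall x, `|g x| <= 1) ->
  \int[P]_w g (Y w) = \int[mu]_x (g x * p x).
Proof.
move=> mg g1.
have g1' x : 0 <= g x + 1 by have := g1 x; rewrite ler_norml => /andP[]; lra.
have igp : mu.-integrable setT (EFin \o (fun x => p x * g x)).
  apply: le_integrable integrable_density => //.
    by apply/measurable_EFinP; exact: measurable_funM.
  by move=> x _; rewrite lee_fin normrM -[leRHS]mulr1 ler_wpM2l.
have igP : P.-integrable setT (EFin \o (fun w => g (Y w))).
  apply: (@le_integrable _ _ _ _ _ _ _ (EFin \o (fun=> 1 : R))) => //.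
  - by apply/measurable_EFinP; apply: measurableT_comp => //; exact: measurable_funPT.
  - by move=> w _; rewrite lee_fin normr1.
  - exact: finite_measure_integrable_cst.
(* g + 1 is nonnegative, so the formula for nonnegative functions applies; the added terms are both
   1 and cancel. *)
have E : \int[P]_w (g (Y w) + 1) = \int[mu]_x (p x * g x + p x).
  rewrite /Rintegral (@ge0_integral_density (fun x => (g x + 1)%:E)).
  - by congr fine; apply: eq_integral => x _; rewrite -EFinM; congr EFin; ring.
  - by apply/measurable_EFinP; exact: measurable_funD.
  - by move=> x; rewrite lee_fin.
rewrite RintegralD// in E; last exact: finite_measure_integrable_cst.
rewrite RintegralD// in E; last exact: integrable_density.
have I1 : \int[mu]_x p x = 1 by rewrite /Rintegral integral_density.
rewrite Rintegral_cst_probability I1 in E.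
by rewrite (addIr _ E); apply: eq_Rintegral => x _; rewrite mulrC.
Qed.

End density_expectation.

(** * Translations and mean increments *)

Section translation.
Context {R : realType}.
Notation mu := (@lebesgue_measure R).

Lemma measurable_shift (h : R) : measurable_fun setT (fun x : R => x + h).
Proof. exact: measurable_funD. Qed.

Definition shift_fun (h : R) : {mfun measurableTypeR R >-> measurableTypeR R} :=
  @mfun_Sub _ _ (measurableTypeR R) (measurableTypeR R) _ (mem_set (measurable_shift h)).

Lemma preimage_shift_itv (h a b : R) :
  (fun x : R => x + h) @^-1` `]a, b] = `]a - h, b - h]%classic.
Proof. by apply/seteqP; split => x /=; rewrite !in_itv/= ltrBlDr lerBrDr. Qed.

Lemma ge0_integral_shift (f : R -> \bar R) (h : R) (D : set R) : measurable D ->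
  measurable_fun setT f -> (forall x, 0 <= f x)%E ->
  (\int[mu]_(x in D) f x = \int[mu]_(x in (fun x : R => (x + h)%R) @^-1` D) f (x + h)%R)%E.
Proof.
move=> mD mf f0.
rewrite -(@ge0_integral_pushforward _ _ (measurableTypeR R) (measurableTypeR R) R _ (measurable_shift h) mu D f mD)//; last exact: measurable_funTS.
apply: eq_measure_integral => [|mphi A mA _]; first exact: measurable_shift.
apply: (@lebesgue_measure_unique _ (pushforward mu (shift_fun h))) => // _ [[a b] _ <-].
rewrite /= /pushforward preimage_shift_itv !lebesgue_measure_itv/= !lte_fin ltrD2r.
by case: ifP => // _; rewrite -!EFinB; congr EFin; ring.
Qed.

(** Folding n consecutive cells onto one turns the integral into sums of f along arithmetic
    progressions, where the variation of a function can be used. *)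
Lemma integral_cells (f : R -> \bar R) (a h : R) (n : nat) : 0 < h ->
  measurable_fun setT f -> (forall x, 0 <= f x)%E ->
  (\int[mu]_(x in `]a, (a + n%:R * h)%R]) f x =
   \int[mu]_(x in `]0%R, h]) \sum_(k < n) f (x + (a + k%:R * h))%R)%E.
Proof.
move=> h0 mf f0.
have mfs (c : R) : measurable_fun setT (fun x : R => f (x + c)%R).
  exact: (measurableT_comp mf (measurable_shift c)).
elim: n => [|n IH].
  rewrite mul0r addr0 set_itvoc0 integral_set0.
  under eq_integral do rewrite big_ord0.
  by rewrite integral0.
have an : a <= a + n%:R * h by rewrite lerDl mulr_ge0// ltW.
have ann : a + n%:R * h <= a + n.+1%:R * h by rewrite lerD2l ler_wpM2r ?(ltW h0)// ler_nat.
have -> : `]a, a + n.+1%:R * h]%classic = `]a, a + n%:R * h] `|` `]a + n%:R * h, a + n.+1%:R * h].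
  apply/seteqP; split => z /=; rewrite !in_itv/=.
    by move=> /andP[xz zl]; case: (leP z (a + n%:R * h)) => zy; [left|right]; apply/andP.
  case=> /andP[h1 h2]; apply/andP; split => //; first exact: le_trans ann.
  exact: le_lt_trans h1.
rewrite ge0_integral_setU//=; last 2 first.
- exact: measurable_funTS.
- apply/disj_setPS => z [] /=; rewrite !in_itv/= => /andP[_ zy] /andP[yz _].
  by move: (lt_le_trans yz zy); rewrite ltxx.
rewrite IH (@ge0_integral_shift f (a + n%:R * h) `](a + n%:R * h), (a + n.+1%:R * h)])// preimage_shift_itv subrr.
have -> : a + n.+1%:R * h - (a + n%:R * h) = h by rewrite -natr1; ring.
rewrite -ge0_integralD//; last 3 first.
- by move=> x _; apply: sume_ge0.
- by apply: measurable_funTS; apply: emeasurable_sum => k; exact: mfs.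
- by apply: measurable_funTS; exact: mfs.
by apply: eq_integral => x _; rewrite big_ord_recr.
Qed.

Lemma integral_le_cells (f : R -> \bar R) (h c : R) : 0 < h ->
  measurable_fun setT f -> (forall x, 0 <= f x)%E ->
  (forall N : nat, (\int[mu]_(x in `](- (N%:R * h))%R, (N%:R * h)%R]) f x <= c%:E)%E) ->
  (\int[mu]_x f x <= c%:E)%E.
Proof.
move=> h0 mf f0 H.
pose F (N : nat) := `](- (N%:R * h))%R, (N%:R * h)%R]%classic.
have -> : [set: R] = \bigcup_N F N.
  apply/seteqP; split => // x _; exists (Num.bound (`|x| / h)) => //=.
  have : `|x| / h < (Num.bound (`|x| / h))%:R by rewrite archi_boundP// divr_ge0// ltW.
  by rewrite ltr_pdivrMr// ltr_norml /F /= in_itv/= => /andP[-> /ltW ->].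
have ndF : {homo F : n m / (n <= m)%N >-> (n <= m)%O}.
  move=> n m nm; apply/subsetPset => x; rewrite /F /= !in_itv/= => /andP[h1 h2].
  have nh : n%:R * h <= m%:R * h by rewrite ler_wpM2r ?(ltW h0)// ler_nat.
  by rewrite (le_trans h2 nh) andbT (le_lt_trans _ h1)// lerN2.
have cv := @ge0_nondecreasing_set_cvg_integral _ (measurableTypeR R) R F f mu ndF (fun i => measurable_itv _) (fun i => measurable_funTS mf) (fun i x _ => f0 x).
rewrite -(cvg_lim _ cv)//; apply: lime_le; first by apply/cvg_ex; eexists; exact: cv.
by apply: nearW => N; exact: H.
Qed.

(** For fixed x, the increments of p along a progression of step h add up to at most M. Integrating
    over one cell of length h gives M h, whatever the number of cells. *)
Lemma integral_increment_le (p : R -> R) (M h : R) : 0 < h -> measurable_fun setT p ->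
  (forall s : seq R, sorted <%R s ->
    \sum_(k < (size s).-1) `|p (nth 0 s k.+1) - p (nth 0 s k)| <= M) ->
  (\int[mu]_x (`|p (x + h) - p x|)%:E <= (M * h)%:E)%E.
Proof.
move=> h0 mp BV.
have mf : measurable_fun setT (fun x : R => (`|p (x + h) - p x|)%:E).
  apply/measurable_EFinP; apply: measurableT_comp => //; apply: measurable_funB => //.
  exact: (measurableT_comp mp (measurable_shift h)).
apply: (integral_le_cells h0) => // N.
have f0 (x : R) : (0 <= (`|p (x + h) - p x|)%:E)%E by rewrite lee_fin.
have := integral_cells (- (N%:R * h)) (N + N) h0 mf f0.
have -> : - (N%:R * h) + (N + N)%:R * h = N%:R * h by rewrite natrD; ring.
move=> ->.
have M0 : 0 <= M by have := BV [::] isT; rewrite big_ord0.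
apply: (@le_trans _ _ (\int[mu]_(x in `]0%R, h]) M%:E)%E).
  apply: ge0_le_integral => //.
  - by move=> x _; apply: sume_ge0 => k _; rewrite lee_fin.
  - apply: measurable_funTS; apply: emeasurable_sum => k.
    exact: (measurableT_comp mf (measurable_shift _)).
  move=> x _; rewrite sumEFin lee_fin.
  set a := - _; set n := (N + N)%N.
  pose s := [seq x + (a + k%:R * h) | k <- iota 0 n.+1].
  have ss : sorted <%R s.
    rewrite sorted_map; apply: (@sub_sorted _ ltn); last exact: iota_ltn_sorted.
    by move=> i j /= ij; rewrite !ltrD2l ltr_pM2r// ltr_nat.
  have := BV s ss; rewrite size_map size_iota /=; apply: le_trans.
  rewrite le_eqVlt; apply/orP; left; apply/eqP; apply: eq_bigr => k _.
  rewrite !(nth_map 0%N) ?size_iota ?ltnS ?ltn_ord ?(ltnW (ltn_ord k))//.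
  rewrite !nth_iota ?ltnS ?ltn_ord ?(ltnW (ltn_ord k))// !add0n.
  by congr (`|p _ - p _|); rewrite -natr1; ring.
have -> : (\int[mu]_(x in `]0%R, h]) M%:E = M%:E * lebesgue_measure (`]0%R, h]%classic : set R))%E.
  exact: integral_cst.
rewrite lebesgue_measure_itv/= lte_fin h0 -EFinB subr0 -EFinM//.
Qed.

End translation.

Section bounded_variation_decay.
Context {R : realType} {d : measure_display} {T : measurableType d}.
Variables (P : probability T R) (Y : {RV P >-> R}) (p : R -> R).
Hypothesis pY : is_density P Y p.
Notation mu := (@lebesgue_measure R).

(* With h = pi / t, translating by h changes the sign of cos (t x), so that
   2 E cos(tY) = int cos(t x) (p x - p (x + h)) dx. *)
Lemma antiperiodic_mean_le (M t : R) (g : R -> R) : 0 < t -> measurable_fun setT g ->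
  (forall x, `|g x| <= 1) -> (forall x, g (x + pi / t) = - g x) ->
  (forall s : seq R, sorted <%R s ->
    \sum_(k < (size s).-1) `|p (nth 0 s k.+1) - p (nth 0 s k)| <= M) ->
  `|\int[P]_w g (Y w)| <= M * pi / t.
Proof.
move=> t0 mg g1 gN BV.
pose h := pi / t; have h0 : 0 < h by rewrite divr_gt0// pi_gt0.
have [p0 [mp _]] := pY.
have ip := integrable_density pY.
have mpsh : measurable_fun setT (fun x : R => p (x + h)).
  exact: (measurableT_comp mp (measurable_shift h)).
have ipsh : mu.-integrable setT (EFin \o (fun x : R => p (x + h))).
  apply/integrableP; split; first exact/measurable_EFinP.
  under eq_integral => x _ do rewrite /= ger0_norm//.
  have -> : (\int[mu]_x (p (x + h))%:E = \int[mu]_x (p x)%:E)%E.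
    rewrite (@ge0_integral_shift _ (fun x => (p x)%:E) h setT)//.
    exact/measurable_EFinP.
  by rewrite (integral_density pY) ltry.
have ibd (q : R -> R) : mu.-integrable setT (EFin \o q) -> mu.-integrable setT (EFin \o (fun x => g x * q x)).
  move=> iq; have mq : measurable_fun setT q by apply/measurable_EFinP; exact: (measurable_int mu).
  apply: le_integrable iq => //; first by apply/measurable_EFinP; exact: measurable_funM.
  by move=> x _; rewrite lee_fin normrM -[leRHS]mul1r ler_wpM2r.
have E1 := Rintegral_density pY mg g1.
have E2 : \int[mu]_x (g x * p x) = - \int[mu]_x (g x * p (x + h)).
  (* Translation invariance is available for nonnegative functions, hence g + 1 in place of g; the
     integrals of p and of its translate then cancel. *)
  have S : (\int[mu]_x ((g x + 1) * p x)%:E = \int[mu]_x ((- g x + 1) * p (x + h))%:E)%E.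
    rewrite (@ge0_integral_shift _ (fun x => ((g x + 1) * p x)%:E) h)//.
    - by rewrite preimage_setT; apply: eq_integral => x _; rewrite gN.
    - by apply/measurable_EFinP; apply: measurable_funM => //; exact: measurable_funD.
    - move=> x; rewrite lee_fin mulr_ge0//.
      by have := g1 x; rewrite ler_norml => /andP[]; lra.
  have S1 : \int[mu]_x ((g x + 1) * p x) = \int[mu]_x ((- g x + 1) * p (x + h)).
    by rewrite /Rintegral S.
  have S2 : \int[mu]_x p x = \int[mu]_x p (x + h).
    rewrite /Rintegral (@ge0_integral_shift _ (fun x => (p x)%:E) h)//.
    exact/measurable_EFinP.
  move: S1.
  have -> : \int[mu]_x ((g x + 1) * p x) = \int[mu]_x (g x * p x) + \int[mu]_x p x.
    rewrite -RintegralD//; last exact: ibd.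
    by apply: eq_Rintegral => x _; rewrite mulrDl mul1r.
  have -> : \int[mu]_x ((- g x + 1) * p (x + h)) = \int[mu]_x p (x + h) - \int[mu]_x (g x * p (x + h)).
    rewrite -RintegralB//; last exact: ibd.
    by apply: eq_Rintegral => x _; rewrite mulrDl mul1r mulNr addrC.
  by rewrite S2 addrC => /addrI.
have E3 : 2 * \int[P]_w g (Y w) = \int[mu]_x (g x * (p x - p (x + h))).
  have -> : \int[mu]_x (g x * (p x - p (x + h))) = \int[mu]_x (g x * p x) - \int[mu]_x (g x * p (x + h)).
    rewrite -RintegralB//; [|exact: ibd|exact: ibd].
    by apply: eq_Rintegral => x _; rewrite mulrBr.
  have -> : \int[mu]_x (g x * p (x + h)) = - \int[mu]_x (g x * p x) by rewrite E2 opprK.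
  by rewrite E1; ring.
have iB : mu.-integrable setT (EFin \o (fun x : R => p x - p (x + h))).
  exact: (integrableB measurableT ip ipsh).
have B : `|2 * \int[P]_w g (Y w)| <= M * h.
  rewrite E3; apply: (le_trans (le_normr_Rintegral measurableT (ibd _ iB))).
  apply: (@le_trans _ _ (\int[mu]_x `|p (x + h) - p x|)).
    apply: le_Rintegral => //; first exact: integrable_norm (ibd _ iB).
      apply: eq_integrable (integrable_norm iB) => // x _.
      by rewrite /= distrC.
    by move=> x _; rewrite normrM [leRHS]distrC -[leRHS]mul1r ler_wpM2r.
  rewrite -lee_fin fineK; first exact: integral_increment_le.
  rewrite ge0_fin_numE; last by apply: integral_ge0 => x _; rewrite lee_fin.
  exact: le_lt_trans (integral_increment_le h0 mp BV) (ltry _).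
have M0 : 0 <= M by have := BV [::] isT; rewrite big_ord0.
move: B; rewrite normrM ger0_norm// /h mulrA.
have := normr_ge0 (\int[P]_w g (Y w)); lra.
Qed.

Lemma bounded_variation_moment_decay (M t : R) : 0 < t ->
  (forall s : seq R, sorted <%R s ->
    \sum_(k < (size s).-1) `|p (nth 0 s k.+1) - p (nth 0 s k)| <= M) ->
  `|cos_moment P Y 0 t| <= M * pi / t /\ `|sin_moment P Y 0 t| <= M * pi / t.
Proof.
move=> t0 BV; rewrite /cos_moment /sin_moment.
have tpi x : t * (x + pi / t) = t * x + pi by field; rewrite gt_eqF.
have mc : measurable_fun setT (fun x => cos (t * x)).
  by under eq_fun do rewrite mulrC; exact: measurable_cosM.
have ms : measurable_fun setT (fun x => sin (t * x)).
  by under eq_fun do rewrite mulrC; exact: measurable_sinM.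
under eq_Rintegral do rewrite expr0 mul1r.
under [X in _ /\ `|X| <= _]eq_Rintegral do rewrite expr0 mul1r.
split.
  apply: (antiperiodic_mean_le (g := fun x => cos (t * x))) => //.
    by move=> x; exact: cos_norm_le1.
  by move=> x; rewrite tpi cosDpi.
apply: (antiperiodic_mean_le (g := fun x => sin (t * x))) => //.
  by move=> x; exact: sin_norm_le1.
by move=> x; rewrite tpi sinDpi.
Qed.

End bounded_variation_decay.

(** * Lipschitz moduli: decay from integrability and back *)

Lemma sqrt_sqrD_lipschitz {R : realType} (a b c e : R) :
  Num.sqrt (a ^+ 2 + b ^+ 2) <= Num.sqrt (c ^+ 2 + e ^+ 2) + (`|a - c| + `|b - e|).
Proof.
have := le_normcD (c +i* e)%C ((a - c) +i* (b - e))%C.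
have -> : ((c +i* e) + ((a - c) +i* (b - e)) = a +i* b)%C.
  by apply/eqP; rewrite eq_complex /=; apply/andP; split; apply/eqP; ring.
move=> /le_trans; apply; rewrite lerD2l /=.
rewrite -[leRHS]ger0_norm ?addr_ge0// -sqrtr_sqr ler_wsqrtr//.
by rewrite [leRHS]sqrrD !real_normK ?num_real// lerD2r lerDl mulrn_wge0// mulr_ge0.
Qed.

Lemma cos_lipschitz {R : realType} (x y : R) : `|cos x - cos y| <= `|x - y|.
Proof.
have H (u v : R) : u <= v -> `|cos v - cos u| <= v - u.
  move=> uv; rewrite -[leRHS]mul1r.
  apply: (derive_bound_lipschitz (p' := fun x => - sin x)) => // z.
  by rewrite normrN sin_norm_le1.
have [xy|/ltW yx] := leP x y.
  by rewrite distrC [`|x - y|]distrC [leRHS]ger0_norm ?subr_ge0// H.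
by rewrite [leRHS]ger0_norm ?subr_ge0// H.
Qed.

Lemma sin_lipschitz {R : realType} (x y : R) : `|sin x - sin y| <= `|x - y|.
Proof.
have H (u v : R) : u <= v -> `|sin v - sin u| <= v - u.
  move=> uv; rewrite -[leRHS]mul1r.
  apply: (derive_bound_lipschitz (p' := fun x => cos x)) => // z.
  by rewrite cos_norm_le1.
have [xy|/ltW yx] := leP x y.
  by rewrite distrC [`|x - y|]distrC [leRHS]ger0_norm ?subr_ge0// H.
by rewrite [leRHS]ger0_norm ?subr_ge0// H.
Qed.

Lemma lipschitz_continuous {R : realType} (m : R -> R) (L : R) :
  (forall t u, `|m t - m u| <= L * `|t - u|) -> continuous m.
Proof.
move=> H t; apply/cvgrPdist_lt => e e0; near=> u.
apply: (le_lt_trans (H t u)).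
have L1 : 0 < `|L| + 1 by rewrite ltr_wpDl.
apply: (@le_lt_trans _ _ ((`|L| + 1) * `|t - u|)).
  by rewrite ler_wpM2r// (le_trans (ler_norm _))// lerDl.
rewrite mulrC -ltr_pdivlMr//; near: u.
by apply: (@cvgr_dist_lt _ _ _ _ _ (fun x : R => x)); rewrite ?divr_gt0//; exact: cvg_id.
Unshelve. all: by end_near. Qed.

(* If m(t) = a then m >= a/2 on an interval of length proportional to a. *)
Lemma lipschitz_integral_decay {R : realType} (m : R -> R) (L nu : R) :
  0 < nu -> 0 <= L -> (forall t, 0 <= m t) -> (forall t, m t <= 1) ->
  (forall t u, `|m t - m u| <= L * `|t - u|) ->
  (\int[lebesgue_measure]_t (m t `^ nu * `|t|)%:E < +oo)%E ->
  exists C : R, forall t : R, 1 <= t -> m t <= C * t `^ (- (1 + nu)^-1).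
Proof.
move=> nu0 L0 m0 m1 mL If.
pose F t := (m t `^ nu * `|t|)%:E.
have F0 t : (0 <= F t)%E by rewrite lee_fin mulr_ge0// powR_ge0.
have cm := lipschitz_continuous mL.
have mF : measurable_fun setT F.
  apply/measurable_EFinP; apply: measurable_funM => //.
  exact: (measurableT_comp (measurable_powR nu) (continuous_measurable_fun cm)).
pose I := fine (\int[lebesgue_measure]_t F t).
have IE : (\int[lebesgue_measure]_t F t = I%:E)%E by rewrite /I fineK// ge0_fin_numE// integral_ge0.
(* On an interval of length eta = m(t)/B the function m drops by at most L eta <= m(t)/2. The
   summand 2 keeps B positive when L = 0. *)
pose B := 2 * L + 2; have B0 : 0 < B by rewrite ltr_wpDl// mulr_ge0.
have nu1 : 0 < 1 + nu by rewrite addr_gt0.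
have nu1' : 1 + nu != 0 by rewrite gt_eqF.
have two : 0 < 2 `^ nu :> R by rewrite powR_gt0.
pose K := I * (B * 2 `^ nu).
exists (K `^ (1 + nu)^-1) => t t1.
have tp : 0 < t by exact: lt_le_trans t1.
have [->|mt0] := eqVneq (m t) 0; first by rewrite mulr_ge0// powR_ge0.
have mtp : 0 < m t by rewrite lt_neqAle eq_sym mt0 m0.
pose eta := m t / B; have eta0 : 0 < eta by rewrite divr_gt0.
have lower u : t <= u -> u <= t + eta -> m t / 2 <= m u.
  move=> tu ut.
  have := mL t u; rewrite distrC [`|t - u|]distrC (ger0_norm (_ : 0 <= u - t)) ?subr_ge0//.
  rewrite distrC => /(le_trans (ler_norm _)) h.
  have h2 : L * (u - t) <= L * eta by rewrite ler_wpM2l//; lra.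
  have h3 : L * eta <= m t / 2.
    rewrite /eta mulrCA ler_wpM2l// ler_pdivrMr// /B; lra.
  lra.
have step : (((m t / 2) `^ nu * t) * eta <= I).
  rewrite -lee_fin -IE.
  have sub : (\int[lebesgue_measure]_(u in `[t, (t + eta)%R]) F u <= \int[lebesgue_measure]_u F u)%E.
    exact: ge0_subset_integral.
  apply: (le_trans _ sub).
  have cst : ((((m t / 2) `^ nu * t) * eta)%:E =
      \int[lebesgue_measure]_(u in `[t, (t + eta)%R]) ((m t / 2) `^ nu * t)%:E)%E.
    have -> : (\int[lebesgue_measure]_(u in `[t, (t + eta)%R]) ((m t / 2) `^ nu * t)%:E =
        ((m t / 2) `^ nu * t)%:E * lebesgue_measure (`[t, (t + eta)%R]%classic : set R))%E.
      exact: integral_cst.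
    by rewrite lebesgue_measure_itv/= lte_fin ltrDl eta0 -EFinB -EFinM addrAC subrr add0r.
  rewrite cst; apply: ge0_le_integral => //.
  - by move=> u _; rewrite lee_fin mulr_ge0 ?powR_ge0// ltW.
  - exact: measurable_funTS.
  - move=> u /=; rewrite in_itv/= => /andP[tu ut]; rewrite lee_fin.
    apply: ler_pM; rewrite ?powR_ge0 ?(ltW tp)//; last by rewrite (le_trans tu)// ler_norm.
    by apply: ge0_ler_powR; rewrite ?nnegrE ?(ltW nu0) ?divr_ge0//; exact: lower.
(* The factor eta = m(t)/B in the lower bound for the integral supplies the extra power of m(t). *)
have key : m t `^ (1 + nu) <= K * t^-1.
  have -> : m t `^ (1 + nu) = m t * m t `^ nu.
    by rewrite powRD ?powRr1// (_ : 1 + nu == 0 = false)//; exact/negbTE.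
  move: step; rewrite powRM ?invr_ge0// -[2^-1](powR_inv1 (ler0n _ 2)) -powRrM mulN1r powRN.
  rewrite /eta /K => step; rewrite ler_pdivlMr//.
  have := ler_wpM2r (_ : 0 <= B * 2 `^ nu) step; rewrite mulr_ge0 ?(ltW B0) ?(ltW two)// => /(_ isT).
  apply: le_trans; rewrite le_eqVlt; apply/orP; left; apply/eqP; field.
  by rewrite !gt_eqF.
have K0 : 0 <= K.
  have := le_trans (powR_ge0 _ _) key; by rewrite pmulr_lge0 ?invr_gt0.
have -> : m t = (m t `^ (1 + nu)) `^ (1 + nu)^-1 by rewrite -powRrM mulfV// powRr1.
have -> : K `^ (1 + nu)^-1 * t `^ (- (1 + nu)^-1) = (K * t^-1) `^ (1 + nu)^-1.
  by rewrite [RHS]powRM ?invr_ge0 ?(ltW tp)// -[t^-1](powR_inv1 (ltW tp)) -powRrM mulN1r.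
apply: ge0_ler_powR => //; rewrite ?nnegrE ?powR_ge0 ?invr_ge0 ?(ltW nu1)//.
by rewrite mulr_ge0// invr_ge0 ltW.
Qed.

(** N powers of m give (1 + t^2)^-2, and |t| <= 1 + t^2 leaves the integrable (1 + t^2)^-1. One
    further power, harmless because m <= 1, makes the exponent positive even when N = 0. *)
Lemma even_decay_integral {R : realType} (m : R -> R) (N : nat) (K : R) : continuous m ->
  (forall t, 0 <= m t) -> (forall t, m t <= 1) -> (forall t, m (- t) = m t) ->
  (forall t, 0 <= t -> m t ^+ N <= K * (1 + t ^+ 2)^-1 ^+ 2) ->
  (\int[lebesgue_measure]_t (m t `^ N.+1%:R * `|t|)%:E < +oo)%E.
Proof.
move=> cm m0 m1 mN H.
have H' t : m t ^+ N <= K * (1 + t ^+ 2)^-1 ^+ 2.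
  have [|/ltW t0] := leP 0 t; first exact: H.
  by rewrite -mN -[t ^+ 2]sqrrN H// oppr_ge0.
have K0 : 0 <= K.
  have := H 0 (lexx 0); rewrite expr0n addr0 invr1 expr1n mulr1.
  by apply: le_trans; exact: exprn_ge0.
apply: le_lt_trans (integral_invD1sqr_lty K0).
apply: ge0_le_integral => //.
- by move=> t _; rewrite lee_fin mulr_ge0// powR_ge0.
- apply/measurable_EFinP; apply: measurable_funM => //.
  exact: (measurableT_comp (measurable_powR _) (continuous_measurable_fun cm)).
- by apply/measurable_EFinP; apply: measurable_funM => //; exact: measurable_invD1sqr.
move=> t _; rewrite lee_fin powR_mulrn// exprSr.
have t2 := oneDsqr_pos t.
apply: (@le_trans _ _ ((K * (1 + t ^+ 2)^-1 ^+ 2) * (1 + t ^+ 2))).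
  apply: ler_pM => //; first by rewrite mulr_ge0// exprn_ge0.
    rewrite -[leRHS]mulr1; apply: ler_pM => //; exact: exprn_ge0.
  by have := sqr_ge0 (`|t| - 1); rewrite sqrrB1 real_normK ?num_real//; have := sqr_ge0 t; lra.
by rewrite le_eqVlt; apply/orP; left; apply/eqP; field; rewrite gt_eqF.
Qed.

(** * The modulus of the characteristic function of X_1 *)

Section charfun_modulus.
Context {R : realType} {d : measure_display} {T : measurableType d}.
Variables (P : probability T R) (X : nat -> {RV P >-> R}).
Hypothesis Hind : mutually_independent P (fun n => X n : T -> R).
Hypothesis Hid : identically_distributed P (fun n => X n : T -> R).
Hypothesis iX2 : P.-integrable setT (EFin \o (fun w => X 0%N w ^+ 2)).

Lemma cmodulus_charfun t : cmodulus (charfun P (X 0%N) t) = modulus X t.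
Proof.
rewrite /cmodulus /charfun /modulus /= unlock.
congr (Num.sqrt (_ ^+ 2 + _ ^+ 2)); symmetry; exact: Rintegral_mul1.
Qed.

Lemma modulusN t : modulus X (- t) = modulus X t.
Proof.
have i0 : P.-integrable setT (EFin \o (fun w => X 0%N w ^+ 0)).
  exact: finite_measure_integrable_cst.
rewrite /modulus; congr (Num.sqrt (_ + _)).
  congr (_ ^+ 2); apply: eq_Rintegral => w _; by rewrite mulNr cosN.
have -> : sin_moment P (X 0%N) 0 (- t) = - sin_moment P (X 0%N) 0 t; last by rewrite sqrrN.
have [_ [js _]] := trig_moments_integrable i0 t.
rewrite /sin_moment -[RHS]mulN1r -RintegralZl//; apply: eq_Rintegral => w _.
by rewrite mulNr sinN mulrN mulN1r.
Qed.

(** Cosine and sine are 1-Lipschitz, so each of the two moments has Lipschitz constant E|X_1|, which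
    is finite because the second moment is. *)
Lemma modulus_lipschitz : exists2 L : R, 0 <= L & forall t u, `|modulus X t - modulus X u| <= L * `|t - u|.
Proof.
have i1 : P.-integrable setT (EFin \o (fun w => `|X 0%N w|)).
  exact: integrable_norm (@integrable_X0X _ _ _ _ _ iX2 1 isT).
have i0 : P.-integrable setT (EFin \o (fun w => X 0%N w ^+ 0)).
  exact: finite_measure_integrable_cst.
pose E := \int[P]_w `|X 0%N w|; have E0 : 0 <= E by exact: Rintegral_ge0.
exists (2 * E); first by rewrite mulr_ge0.
have lip (g : R -> R) t u : P.-integrable setT (EFin \o (fun w => X 0%N w ^+ 0 * g (t * X 0%N w))) ->
    P.-integrable setT (EFin \o (fun w => X 0%N w ^+ 0 * g (u * X 0%N w))) ->
    (forall x y, `|g x - g y| <= `|x - y|) ->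
    `|\int[P]_w (X 0%N w ^+ 0 * g (t * X 0%N w)) - \int[P]_w (X 0%N w ^+ 0 * g (u * X 0%N w))| <= E * `|t - u|.
  move=> ig ih gl; rewrite -RintegralB//.
  apply: (le_trans (le_normr_Rintegral measurableT (integrableB measurableT ig ih))).
  rewrite mulrC /E -RintegralZl//; apply: le_Rintegral => //.
  - exact: integrable_norm (integrableB measurableT ig ih).
  - exact: (integrableZl measurableT _ i1).
  - move=> w _; rewrite !expr0 !mul1r (le_trans (gl _ _))// -mulrBl normrM//.
have half t u : modulus X t - modulus X u <= 2 * E * `|t - u|.
  rewrite lerBlDl; apply: (le_trans (sqrt_sqrD_lipschitz _ _ (cos_moment P (X 0%N) 0 u) (sin_moment P (X 0%N) 0 u))).
  rewrite /modulus lerD2l.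
  have [[a1 _] [a2 _]] := trig_moments_integrable i0 t.
  have [[b1 _] [b2 _]] := trig_moments_integrable i0 u.
  have l1 := lip _ t u a1 b1 (@cos_lipschitz R); have l2 := lip _ t u a2 b2 (@sin_lipschitz R).
  by apply: (le_trans (lerD l1 l2)); rewrite -mulrA mulr2n mulrDl mul1r.
move=> t u; rewrite ler_norml half andbT lerNl opprB.
by rewrite distrC half.
Qed.

(** At t sqrt(n) the characteristic function of Z_n has modulus |f_1(t)|^n, so its O(1/t) bound
    becomes O(t^(-1/n)) for |f_1|. *)
Lemma bounded_variation_modulus_decay n (p : R -> R) : (0 < n)%N ->
  is_density P (normalized_sum (fun n => X n : T -> R) n) p -> bounded_total_variation p ->
  exists C : R, forall t : R, 1 <= t -> modulus X t <= C * t `^ (- n%:R^-1).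
Proof.
move=> n0 pZ [M BV].
have nR : 0 < n%:R :> R by rewrite ltr0n.
have sn : 0 < Num.sqrt n%:R :> R by rewrite sqrtr_gt0.
have M0 : 0 <= M by have := BV [::] isT; rewrite big_ord0.
(* The cosine and sine moments at t sqrt(n) each obey the bound in parentheses divided by t; the
   factor 2 covers the root of the sum of their squares. *)
pose B := 2 * (M * pi / Num.sqrt n%:R).
have B0 : 0 <= B by rewrite !mulr_ge0 ?pi_ge0// invr_ge0 ltW.
exists (B `^ n%:R^-1) => t t1.
have tp : 0 < t by exact: lt_le_trans t1.
have tn0 : 0 < t * Num.sqrt n%:R by rewrite mulr_gt0.
have [h1 h2] := @bounded_variation_moment_decay _ _ _ P (normalized_RV X n) p pZ M (t * Num.sqrt n%:R) tn0 BV.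
have := normalized_sum_modulus Hind Hid iX2 n (t * Num.sqrt n%:R).
rewrite mulfK ?gt_eqF// => E.
have m0 := modulus_ge0 X t.
have key : modulus X t ^+ n <= B * t^-1.
  rewrite -(@ler_pXn2r _ 2) ?nnegrE ?exprn_ge0 ?mulr_ge0 ?pi_ge0 ?invr_ge0 ?(ltW tp)//.
  rewrite exprAC -E.
  have sq (x b : R) : `|x| <= b -> x ^+ 2 <= b ^+ 2.
    move=> xb; rewrite -[leLHS]real_normK ?num_real// ler_pXn2r ?nnegrE//.
    exact: le_trans xb.
  have := lerD (sq _ _ h1) (sq _ _ h2); move=> /le_trans; apply.
  have -> : B * t^-1 = 2 * (M * pi / (t * Num.sqrt n%:R)) by rewrite /B; field; rewrite !gt_eqF.
  set z := M * pi / _; have := sqr_ge0 z.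
  have -> : (2 * z) ^+ 2 = 4 * z ^+ 2 by ring.
  lra.
have -> : modulus X t = (modulus X t ^+ n) `^ n%:R^-1.
  by rewrite -powR_mulrn// -powRrM mulfV ?gt_eqF// powRr1.
have -> : B `^ n%:R^-1 * t `^ (- n%:R^-1) = (B * t^-1) `^ n%:R^-1.
  by rewrite [RHS]powRM ?invr_ge0 ?(ltW tp)// -[t^-1](powR_inv1 (ltW tp)) -powRrM mulN1r.
apply: ge0_ler_powR => //; rewrite ?nnegrE ?invr_ge0 ?exprn_ge0 ?(ltW nR)//.
by rewrite mulr_ge0// invr_ge0 ltW.
Qed.

End charfun_modulus.

(** * Absolutely continuous functions *)

Lemma discrete_crossing {R : realType} (y : nat -> R) (x : R) n :
  y 0%N < x -> x <= y n -> exists2 k, (k < n)%N & y k < x <= y k.+1.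
Proof.
move=> y0; elim: n => [|n IH] xn; first by move: (lt_le_trans y0 xn); rewrite ltxx.
have [xn'|nx] := leP x (y n); last by exists n; rewrite ?nx.
by have [k kn h] := IH xn'; exists k => //; rewrite ltnS ltnW.
Qed.

Lemma path_intervals {R : realType} (u v : nat -> R) :
  (forall k, v k <= u k.+1) -> forall n k (s : R * R), s.2 <= u k ->
  path (fun u v : R * R => u.2 <= v.1) s [seq (u j, v j) | j <- iota k n].
Proof.
by move=> uv; elim=> [//|n IH] k s sk /=; rewrite sk IH//=.
Qed.

Section monotone_absolute_continuity.
Context {R : realType}.
Variables (a b : R) (F : R -> R).
Hypothesis ab : a < b.
Hypothesis F_nd : forall x y, a <= x -> x <= y -> y <= b -> F x <= F y.
Hypothesis F_ac : abs_continuous_on a b F.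

(** Extending [F] by constants outside [a, b] gives a monotone function on the whole line, from
    which a Lebesgue-Stieltjes measure can be built. *)
Let clamp (x : R) := Num.max a (Num.min x b).

Let clamp_ge x : a <= clamp x. Proof. by rewrite /clamp le_max lexx. Qed.
Let clamp_le x : clamp x <= b.
Proof. by rewrite /clamp ge_max (ltW ab) ge_min lexx orbT. Qed.
Let clamp_nd x y : x <= y -> clamp x <= clamp y.
Proof.
move=> xy; rewrite /clamp /Num.max /Num.min.
by repeat case: ifPn => //; rewrite -?leNgt; have := ab; lra.
Qed.
Let clamp_id x : a <= x -> x <= b -> clamp x = x.
Proof. by move=> ax xb; rewrite /clamp (min_idPl xb); exact/max_idPr. Qed.

Let Fc (x : R) := F (clamp x).

Let Fc_nd : nondecreasing Fc.
Proof. by move=> x y xy; apply: F_nd => //; exact: clamp_nd. Qed.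

Let clamp_contract x y : x <= y -> clamp y - clamp x <= y - x.
Proof.
move=> xy; rewrite /clamp.
have [xb|bx] := leP x b; have [yb|by_] := leP y b;
  have := ab; rewrite /Num.max; repeat case: ifPn => //; rewrite -?leNgt; lra.
Qed.

(** Absolute continuity for a family of one interval; clamping does not increase lengths. *)
Let Fc_rc : forall x, Fc y @[y --> x^'+] --> Fc x.
Proof.
move=> x; apply/cvgrPdist_lt => e e0.
have [dl dl0 H] := F_ac e0.
near=> y.
have xy : x <= y by near: y; exact: nbhs_right_ge.
have := H [:: (clamp x, clamp y)].
rewrite /= !big_cons !big_nil !addr0 clamp_ge clamp_le (clamp_nd xy) => /(_ isT isT).
rewrite distrC; apply; apply: (le_lt_trans (clamp_contract xy)).
by rewrite ltrBlDl; near: y; apply: nbhs_right_lt; rewrite ltrDl.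
Unshelve. all: by end_near. Qed.

#[local] HB.instance Definition _ := isCumulative.Build R _ R Fc Fc_nd Fc_rc.

Let mu := lebesgue_stieltjes_measure Fc.

Let mu_itv u v : u <= v -> mu `]u, v]%classic = (Fc v - Fc u)%:E.
Proof.
move=> uv; rewrite /mu /lebesgue_stieltjes_measure /measure_extension.
by rewrite measurable_mu_extE/=; [rewrite wlength_itv_bnd// | exact: is_ocitv].
Qed.

Let mD : measurable (`]a, b]%classic : set (measurableTypeR R)).
Proof. exact: measurable_itv. Qed.

Let muD : (mu `]a, b]%classic < +oo)%E.
Proof. by rewrite mu_itv ?ltry// ltW. Qed.

Let nu := mfrestr mD muD.

(* Once the mesh is small, the cells of a uniform grid contained in [U] cover any given
   point of [U]; those cells form a finite family to which absolute continuity applies. *)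
Let mu_small e : 0 < e -> exists2 dl : R, 0 < dl & forall U : set R, open U ->
  (lebesgue_measure U < dl%:E)%E -> (mu (U `&` `]a, b]%classic) <= e%:E)%E.
Proof.
move=> e0; have [dl dl0 H] := F_ac e0; exists dl => // U oU Udl.
pose x n k : R := a + (b - a) * k%:R / n.+1%:R.
have ba0 : 0 < b - a by rewrite subr_gt0.
have xS n k : x n k <= x n k.+1.
  by rewrite /x lerD2l ler_wpM2r ?invr_ge0// ler_wpM2l ?(ltW ba0)// ler_nat.
have xn n : x n n.+1 = b by rewrite /x mulfK ?pnatr_eq0// addrC subrK.
have x0 n : x n 0%N = a by rewrite /x mulr0 mul0r addr0.
have xge n k : a <= x n k by rewrite lerDl !mulr_ge0// ltW.
have xle n k : (k <= n.+1)%N -> x n k <= b.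
  move=> kn; rewrite -(xn n) /x lerD2l ler_wpM2r ?invr_ge0// ler_wpM2l ?(ltW ba0)//.
  by rewrite ler_nat.
(* A cell that is not contained in [U] is replaced by an empty interval, so the family keeps n + 1
   ordered members and no selection of indices is needed. *)
pose y n k := if `[< `]x n k, x n k.+1]%classic `<=` U >] then x n k.+1 else x n k.
have xy n k : x n k <= y n k by rewrite /y; case: ifP.
have yx n k : y n k <= x n k.+1 by rewrite /y; case: ifP.
pose J n k : set R := `]x n k, y n k]%classic.
have mJ n k : measurable (J n k) by exact: measurable_itv.
pose W n := \big[setU/set0]_(k < n.+1) J n k.
have mW n : measurable (W n : set R) by apply: bigsetU_measurable => k _; exact: mJ.
have JU n k : J n k `<=` U.
  rewrite /J /y; case: ifPn => [/asboolP//|_]; by rewrite set_itvxx.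
have tJ n : trivIset setT (J n).
  have H' i j : (i < j)%N -> J n i `&` J n j = set0.
    move=> ij; apply/seteqP; split => // z []; rewrite /J /= !in_itv/= => /andP[_ zi] /andP[jz _].
    suff : x n i.+1 <= x n j by have := yx n i; lra.
    by apply: (homo_leq (@lexx _ _) (@le_trans _ _) (xS n)).
  apply/trivIsetP => i j _ _; rewrite neq_lt => /orP[/H'//|/H'].
  by rewrite setIC.
have lJ n k : lebesgue_measure (J n k) = (y n k - x n k)%:E.
  rewrite /J lebesgue_measure_itv/= lte_fin; case: ltP => [_|yx']; first by rewrite EFinB.
  by congr EFin; apply/esym/eqP; rewrite subr_eq0 eq_le yx' xy.
have lW n : (\sum_(k < n.+1) (y n k - x n k))%:E = lebesgue_measure (W n).
  rewrite /W measure_semi_additive_ord_I//; last 3 first.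
    by move=> k _; exact: mJ.
    exact: sub_trivIset (tJ n).
    exact: mW.
  rewrite -sumEFin; apply: eq_bigr => k _.
  exact: esym (lJ n k).
have muW n : (mu (W n) <= e%:E)%E.
  apply: (le_trans (Boole_inequality _ _)) => [k _|]; first exact: mJ.
  have -> : (\sum_(k < n.+1) mu (J n k) = (\sum_(k < n.+1) (F (y n k) - F (x n k)))%:E)%E.
    rewrite -sumEFin; apply: eq_bigr => k _; rewrite /J mu_itv//.
    have kn : (k.+1 <= n.+1)%N by exact: ltn_ord.
    have yb : y n k <= b := le_trans (yx n k) (xle n k.+1 kn).
    have cx : clamp (x n k) = x n k := clamp_id (xge n k) (le_trans (xy n k) yb).
    have cy : clamp (y n k) = y n k := clamp_id (le_trans (xge n k) (xy n k)) yb.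
    by rewrite /Fc cx cy.
  rewrite lee_fin.
  pose s := [seq (x n j, y n j) | j <- iota 0 n.+1].
  have HS := H s; have sumE (f : R * R -> R) : \sum_(u <- s) f u = \sum_(k < n.+1) f (x n k, y n k).
    by rewrite /s big_map -[iota 0 n.+1]/(index_iota 0 n.+1) big_mkord.
  apply: (@le_trans _ _ (\sum_(u <- s) `|F u.2 - F u.1|)).
    by rewrite sumE; apply: ler_sum => k _; exact: ler_norm.
  apply: ltW; apply: HS.
  - by apply: path_intervals => //=; rewrite x0.
  - apply/allP => u /mapP[j]; rewrite mem_iota add0n => /andP[_ jn] -> /=.
    by rewrite xy (le_trans (yx _ _))// xle.
  - rewrite sumE /= -lte_fin lW; apply: le_lt_trans Udl.
    apply: le_measure; rewrite ?inE; [exact: mW|exact: open_measurable|].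
    by rewrite /W -bigcup_mkord => z [k _ /JU].
(* A point of U in ]a, b] lies in W n for all large n, but W n need not increase with n. The sets V
   m do, and they allow continuity of the measure from below. *)
pose V m := \bigcap_(n in [set n | (m <= n)%N]) W n.
have mV m : measurable (V m : set R) by apply: bigcap_measurableType => n _; exact: mW.
have muV m : (mu (V m) <= e%:E)%E.
  apply: le_trans (muW m); apply: le_measure; rewrite ?inE; [exact: mV|exact: mW|].
  by move=> z; apply => /=.
have mcV : measurable (\bigcup_m V m : set R) by exact: bigcup_measurable.
apply: (@le_trans _ _ (mu (\bigcup_m V m))).
  apply: le_measure; rewrite ?inE.
  - by apply: measurableI => //; exact: open_measurable.
  - exact: mcV.
  move=> z [Uz]; rewrite /= in_itv/= => /andP[az zb].
  have /nbhs_ballP[r /= r0 rU] : nbhs z U by exact: open_nbhs_nbhs.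
  pose m := Num.truncn ((b - a) / r).
  exists m => // n /= mn.
  have [k kn /andP[h1 h2]] : exists2 k, (k < n.+1)%N & x n k < z <= x n k.+1.
    by apply: discrete_crossing; rewrite ?x0 ?xn.
  have step : x n k.+1 - x n k < r.
    have -> : x n k.+1 - x n k = (b - a) / n.+1%:R.
      have N0 : n.+1%:R != 0 :> R by rewrite pnatr_eq0.
      by rewrite /x -[k.+1%:R]natr1; move: N0; set N : R := n.+1%:R => N0; field.
    rewrite ltr_pdivrMr// mulrC -ltr_pdivrMr//.
    apply: (lt_le_trans (truncnS_gt _)); by rewrite ler_nat ltnS.
  have sel : `]x n k, x n k.+1]%classic `<=` U.
    apply: subset_trans rU => w /=; rewrite in_itv/= /ball/= => /andP[w1 w2].
    by rewrite ltr_norml; apply/andP; split; lra.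
  rewrite /W -bigcup_mkord; exists k => //; rewrite /J /y.
  by case: ifPn => [_|/asboolPn//]; rewrite /= in_itv/= h1.
have cV : mu (V m) @[m --> \oo] --> mu (\bigcup_m V m).
  apply: nondecreasing_cvg_mu => // i j ij; apply/subsetPset => z Vz n /= jn.
  by apply: Vz => /=; exact: leq_trans jn.
rewrite -(cvg_lim _ cV)//; apply: lime_le; first by apply/cvg_ex; eexists; exact: cV.
by near=> m; exact: muV.
Unshelve. all: by end_near. Qed.

(** By outer regularity a null set lies in open sets of arbitrarily small Lebesgue measure, and
    [mu_small] makes their [mu] measure small inside ]a, b]. *)
Let nu_dominated : nu `<< (lebesgue_measure : {measure set (measurableTypeR R) -> \bar R}).
Proof.
apply/null_content_dominatesP => A mA A0; apply/eqP; rewrite eq_le measure_ge0 andbT.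
apply/lee_addgt0Pr => e e0; rewrite add0e.
have [dl dl0 H] := mu_small e0.
have [|U [oU AU UA]] := @lebesgue_regularity_outer R A dl mA _ dl0; first by rewrite A0 ltry.
apply: le_trans (H U oU _).
  rewrite /nu /= /mfrestr /mrestr; apply: le_measure; rewrite ?inE.
  - by apply: measurableI => //.
  - by apply: measurableI => //; exact: open_measurable.
  - by apply: setSI.
rewrite (_ : lebesgue_measure U = lebesgue_measure (U `\` A))//.
rewrite -[in LHS](setDUK AU) measureU//.
- by rewrite A0 add0e.
- by apply: measurableD => //; exact: open_measurable.
- exact: setDIK.
Qed.

Lemma nondecreasing_abs_continuous_density : exists g : R -> R,
  lebesgue_measure.-integrable setT (EFin \o g) /\
  forall x y, a <= x -> x <= y -> y <= b ->
    F y - F x = \int[lebesgue_measure]_(t in `]x, y]) g t.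
Proof.
pose h := Radon_Nikodym_SigmaFinite.f nu (lebesgue_measure : {sigma_finite_measure set (measurableTypeR R) -> \bar R}).
have hE : h = EFin \o (fine \o h).
  by apply/funext => x /=; rewrite fineK// Radon_Nikodym_SigmaFinite.f_fin_num.
have ih := Radon_Nikodym_SigmaFinite.f_integrable nu_dominated.
exists (fine \o h); split; first by rewrite -hE; exact: ih.
move=> x y ax xy yb; rewrite /Rintegral.
have -> : (\int[lebesgue_measure]_(t in `]x, y]) ((fine \o h) t)%:E = nu `]x, y]%classic)%E.
  have mI : measurable (`]x, y]%classic : set (measurableTypeR R)) by exact: measurable_itv.
  by have := Radon_Nikodym_SigmaFinite.f_integral nu_dominated mI; rewrite -/h {1}hE => e; exact: esym e.
rewrite /nu /= /mfrestr /mrestr setIidl; last by apply: subset_itv; rewrite bnd_simp.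
by rewrite mu_itv//= /Fc !clamp_id// ?(le_trans ax)// (le_trans xy).
Qed.

End monotone_absolute_continuity.

(** Rewrites a partition as the kind of interval family over which [abs_continuous_on]
    quantifies. *)
Fixpoint steps {R : realType} (a : R) (s : seq R) : seq (R * R) :=
  if s is x :: s' then (a, x) :: steps x s' else [::].

Lemma variation_steps {R : realType} (a b : R) (f : R -> R) s : itv_partition a b s ->
  variation a b f s = \sum_(u <- steps a s) `|f u.2 - f u.1|.
Proof.
move=> /variation_zip ->.
by elim: s a => [|x s IH] a; rewrite ?big_nil//= !big_cons IH.
Qed.

Lemma path_intervals_le {R : realType} (z w : R * R) s : z.2 <= w.2 ->
  path (fun u v : R * R => u.2 <= v.1) w s -> path (fun u v : R * R => u.2 <= v.1) z s.
Proof. by case: s => //= u s zw /andP[wu ->]; rewrite (le_trans zw). Qed.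

Lemma path_steps {R : realType} (b c : R) t : path (fun u v : R * R => u.2 <= v.1) (c, b) t ->
  forall s (a : R) (z : R * R), itv_partition a b s -> z.2 <= a ->
  path (fun u v : R * R => u.2 <= v.1) z (steps a s ++ t).
Proof.
move=> pt; elim=> [|x s IH] a z.
  by move=> /itv_partition_nil -> zb /=; exact: path_intervals_le pt.
by move=> /itv_partition_cons ps za /=; rewrite za IH.
Qed.

Lemma all_steps {R : realType} (b c : R) : b <= c -> forall s a, itv_partition a b s ->
  all (fun u : R * R => (u.1 <= u.2) && (u.2 <= c)) (steps a s).
Proof.
move=> bc; elim=> //= x s IH a /[dup] /itv_partition_cons ps [/= /andP[ax _] _].
by rewrite (ltW ax) IH// (le_trans (itv_partition_le ps)).
Qed.

Lemma sum_steps {R : realType} (b : R) s a : itv_partition a b s ->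
  \sum_(u <- steps a s) (u.2 - u.1) = b - a.
Proof.
elim: s a => [a /itv_partition_nil -> |x s IH a /itv_partition_cons ps] /=.
  by rewrite big_nil subrr.
by rewrite big_cons IH//= addrC addrA subrK.
Qed.

(** * Jordan decomposition and almost everywhere derivative *)

Section absolute_continuity.
Context {R : realType}.
Variables (a b : R) (f : R -> R).
Hypothesis ab : a < b.
Hypothesis f_ac : abs_continuous_on a b f.

(** On an interval shorter than [dl] every partition is an admissible family for e = 1, so the
    variation there is at most 1. Finitely many intervals of equal length below [dl] make up
    [a, b]. *)
Let BVf : total_variation a b f \is a fin_num.
Proof.
have [dl dl0 H] := f_ac ltr01.
have loc (u v : R) : a <= u -> u <= v -> v <= b -> v - u < dl -> (total_variation u v f <= 1)%E.
  move=> au uv vb vu; apply: ge_ereal_sup => _ [_ [s ps <-] <-]; rewrite lee_fin variation_steps//.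
  apply: ltW; apply: H.
  - by rewrite -[steps u s]cats0; apply: (@path_steps _ v u [::]) ps _.
  - exact: all_steps ps.
  - by rewrite (sum_steps ps).
rewrite ge0_fin_numE ?total_variation_ge0 ?(ltW ab)//.
pose N := Num.truncn ((b - a) / dl).
have ba0 : 0 < b - a by rewrite subr_gt0.
pose h := (b - a) / N.+1%:R.
have h0 : 0 < h by rewrite divr_gt0.
have hdl : h < dl by rewrite /h ltr_pdivrMr// mulrC -ltr_pdivrMr// truncnS_gt.
have hb : a + h * N.+1%:R = b by rewrite /h mulfVK ?pnatr_eq0// addrC subrK.
have step k : (k <= N.+1)%N -> (total_variation a (a + h * k%:R) f <= k%:R%:E)%E.
  elim: k => [_|k IH kN]; first by rewrite mulr0 addr0 total_variationxx.
  have h1 : a <= a + h * k%:R by rewrite lerDl mulr_ge0// ltW.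
  have h2 : a + h * k%:R <= a + h * k.+1%:R by rewrite lerD2l ler_wpM2l ?(ltW h0)// ler_nat.
  have -> : (k.+1%:R%:E = k%:R%:E + 1%:E :> \bar R)%E by rewrite -natr1 EFinD.
  rewrite (total_variationD f h1 h2); apply: leeD; first exact: IH (ltnW kN).
  apply: loc => //.
    by rewrite -hb lerD2l ler_wpM2l ?(ltW h0)// ler_nat.
  have -> : a + h * k.+1%:R - (a + h * k%:R) = h by rewrite -natr1; ring.
  exact: hdl.
by have := step N.+1 (leqnn _); rewrite hb => /le_lt_trans; apply; rewrite ltry.
Qed.

Let V x := fine (total_variation a x f).

Let TVfin u v : a <= u -> u <= v -> v <= b -> total_variation u v f \is a fin_num.
Proof.
move=> au uv vb; rewrite ge0_fin_numE ?total_variation_ge0//.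
have av := le_trans au uv; have ub := le_trans uv vb.
apply: (@le_lt_trans _ _ (total_variation a b f)); last first.
  by move: BVf; rewrite ge0_fin_numE// total_variation_ge0// ltW.
rewrite (total_variationD f av vb) (total_variationD f au uv).
rewrite (@le_trans _ _ (total_variation a u f + total_variation u v f)%E)//.
  by rewrite leeDr// total_variation_ge0.
by rewrite leeDl// total_variation_ge0.
Qed.

Let VB u v : a <= u -> u <= v -> v <= b -> V v - V u = fine (total_variation u v f).
Proof.
move=> au uv vb; have av := le_trans au uv; have ub := le_trans uv vb.
by rewrite /V (total_variationD f au uv) fineD ?TVfin// addrC addKr.
Qed.

Let V_ge u v : a <= u -> u <= v -> v <= b -> `|f v - f u| <= V v - V u.
Proof.
by move=> au uv vb; rewrite VB// -lee_fin fineK ?TVfin// total_variation_ge.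
Qed.

(* The intervals of the family are replaced one at a time by arbitrary partitions, and
   the supremum over the partition is taken at each stage. *)
Let V_ac : abs_continuous_on a b V.
Proof.
move=> e e0; have e2 : 0 < e / 2 by rewrite divr_gt0.
have [dl dl0 H] := f_ac e2; exists dl => // s ps als ls.
have key : forall r t, path (fun u v : R * R => u.2 <= v.1) (a, a) (t ++ r) ->
    all (fun u : R * R => (u.1 <= u.2) && (u.2 <= b)) (t ++ r) ->
    \sum_(u <- t ++ r) (u.2 - u.1) < dl ->
    \sum_(u <- t) `|f u.2 - f u.1| + \sum_(u <- r) `|V u.2 - V u.1| <= e / 2.
  elim=> [|u r IH] t.
    rewrite cats0 big_nil addr0 => *; apply: ltW; exact: H.
  move=> pt alt lt; rewrite big_cons.
  move: (pt); rewrite cat_path => /andP[pt1 /= /andP[tu pur]].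
  move: (alt); rewrite all_cat /= => /and3P[alt1 /andP[u12 u2b] altr].
  have au : a <= u.1.
    apply: le_trans tu; move: pt1 alt1; clear.
    have : a <= (a, a).2 by [].
    elim: t (a, a) => //= v t IH z az /andP[zv pv] /andP[/andP[v12 _] al].
    by apply: IH => //; rewrite (le_trans az)// (le_trans zv).
  have -> : `|V u.2 - V u.1| = fine (total_variation u.1 u.2 f).
    by rewrite VB// ger0_norm// fine_ge0// total_variation_ge0.
  suff : (total_variation u.1 u.2 f <=
      (e / 2 - \sum_(u <- t) `|f u.2 - f u.1| - \sum_(u <- r) `|V u.2 - V u.1|)%:E)%E.
    by rewrite -{1}(fineK (TVfin au u12 u2b)) lee_fin; lra.
  apply: ge_ereal_sup => _ [_ [l pl <-] <-]; rewrite lee_fin variation_steps//.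
  have := IH (t ++ steps u.1 l); rewrite -catA !big_cat /=.
  set S1 := \sum_(u <- t) `|_|; set S2 := \sum_(u <- steps _ _) `|_|; set S3 := \sum_(u <- r) `|_|.
  move=> IH'; suff : S1 + S2 + S3 <= e / 2 by lra.
  apply: IH'.
  - rewrite cat_path pt1 /=; apply: (@path_steps _ u.2 u.1) pl tu.
    by move: pur; rewrite -surjective_pairing.
  - by rewrite !all_cat alt1 altr (all_steps u2b)//.
  - move: lt; rewrite big_cat big_cons /= (sum_steps pl); lra.
have := key s [::] ps als ls; rewrite big_nil add0r => /le_lt_trans; apply; lra.
Qed.

Let Vf_ac : abs_continuous_on a b (fun x => V x - f x).
Proof.
move=> e e0; have e2 : 0 < e / 2 by rewrite divr_gt0.
have [d1 d10 H1] := f_ac e2; have [d2 d20 H2] := V_ac e2.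
exists (Num.min d1 d2); first by rewrite lt_min d10.
move=> s ps als; rewrite lt_min => /andP[l1 l2].
rewrite [e]splitr; apply: le_lt_trans (ltrD (H2 s ps als l2) (H1 s ps als l1)).
rewrite -big_split /=; apply: ler_sum => u _.
have -> : V u.2 - f u.2 - (V u.1 - f u.1) = (V u.2 - V u.1) - (f u.2 - f u.1) by ring.
exact: ler_normB.
Qed.

(** f is the difference of V and V - f, both nondecreasing and absolutely continuous, hence both
    indefinite integrals. *)
Lemma abs_continuous_density : exists g : R -> R,
  lebesgue_measure.-integrable setT (EFin \o g) /\
  forall x y, a <= x -> x <= y -> y <= b ->
    f y - f x = \int[lebesgue_measure]_(t in `]x, y]) g t.
Proof.
have V_nd u v : a <= u -> u <= v -> v <= b -> V u <= V v.
  by move=> au uv vb; rewrite -subr_ge0 (le_trans _ (V_ge au uv vb)).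
have Vf_nd u v : a <= u -> u <= v -> v <= b -> V u - f u <= V v - f v.
  by move=> au uv vb; have := le_trans (ler_norm _) (V_ge au uv vb); lra.
have [g1 [i1 E1]] := nondecreasing_abs_continuous_density ab V_nd V_ac.
have [g2 [i2 E2]] := nondecreasing_abs_continuous_density ab Vf_nd Vf_ac.
exists (fun x => g1 x - g2 x); split; first exact: (integrableB measurableT i1 i2).
move=> x y ax xy yb; rewrite RintegralB ?measurable_itv//.
- by rewrite -(E1 x y)// -(E2 x y)//; lra.
- exact: integrableS i1.
- exact: integrableS i2.
Qed.

(** Lebesgue differentiation identifies [g] almost everywhere with [derive1 f], the derivative that
    enters the Fisher information. *)
Lemma abs_continuous_derivative : exists g : R -> R,
  [/\ lebesgue_measure.-integrable setT (EFin \o g),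
    forall x y, a <= x -> x <= y -> y <= b ->
    f y - f x = \int[lebesgue_measure]_(t in `]x, y]) g t &
    {ae lebesgue_measure, forall x, a < x -> x < b -> derivable f x 1 /\ derive1 f x = g x}].
Proof.
have [g [ig E]] := abs_continuous_density; exists g; split=> //.
have int (y : R) : lebesgue_measure.-integrable [set` Interval (BRight a) (BRight y)] (EFin \o g).
  exact: integrableS ig.
have := FTC1 int (open_integrable_locally openT ig).
apply: filterS; first exact: (ae_filter_ringOfSetsType lebesgue_measure).
move=> x Hx ax xb.
have [dF F'] := Hx (ax : (BRight a < BRight x)%O).
set F := (fun x : R => _) in dF F'.
(* f is an indefinite integral on [a, b] only, so the identity is local; that is enough to transfer
   the derivative at an interior point. *)
have fE : {near x, (fun y => f a + F y) =1 f}.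
  have xab : x \in `]a, b[ by rewrite in_itv/= ax.
  apply: filterS (near_in_itvoo xab) => y; rewrite in_itv/= => /andP[ay yb].
  by rewrite /F -(E a y (lexx a) (ltW ay) (ltW yb)) addrC subrK.
have dG : is_derive x (1 : R) (fun y => f a + F y) (0 + g x).
  apply: is_deriveD; by rewrite -F' derive1E; exact: derivableP.
have [df fg] := near_eq_is_derive fE dG.
by rewrite derive1E fg add0r.
Qed.

End absolute_continuity.

(** Meant for the zeros of a nonnegative density. The difference quotients from the left are
    nonpositive and those from the right nonnegative. *)
Lemma derive1_at_global_min {R : realType} (p : R -> R) (c : R) :
  (forall x, p c <= p x) -> derivable p c 1 -> derive1 p c = 0.
Proof.
move=> pc dp; rewrite derive1E.
pose q (h : R) : R := h^-1 *: ((p \o shift c) (h *: (1 : R)) - p c).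
have cr : q @ 0^'+ --> 'D_1 p c.
  apply: cvg_trans dp; apply: cvg_app => A [e e0 Ae].
  by exists e => // x xe x0; apply: Ae => //; exact: lt0r_neq0.
have cl : q @ 0^'- --> 'D_1 p c.
  apply: cvg_trans dp; apply: cvg_app => A [e e0 Ae].
  by exists e => // x xe x0; apply: Ae => //; exact: ltr0_neq0.
have q0 h : 0 <= (p \o shift c) (h *: (1 : R)) - p c by rewrite subr_ge0; exact: pc.
apply/eqP; rewrite eq_le; apply/andP; split.
  rewrite -(cvg_lim _ cl)//; apply: limr_le; first by apply/cvg_ex; eexists; exact: cl.
  by near=> h; rewrite /q mulr_le0_ge0// invr_le0; near: h; exact: nbhs_left_le.
rewrite -(cvg_lim _ cr)//; apply: limr_ge; first by apply/cvg_ex; eexists; exact: cr.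
by near=> h; rewrite /q mulr_ge0// invr_ge0; near: h; exact: nbhs_right_ge.
Unshelve. all: by end_near. Qed.

(* The Fisher integrand need not be measurable where [p] is not differentiable; the
   integral is still monotone as a supremum over simple functions below the integrand. *)
Lemma ge0_le_integral_nonmeasurable {d} {T : measurableType d} {R : realType}
  (mu : {measure set T -> \bar R}) (f g : T -> \bar R) :
  (forall x, 0 <= f x)%E -> (forall x, f x <= g x)%E ->
  (\int[mu]_x f x <= \int[mu]_x g x)%E.
Proof.
move=> f0 fg; have g0 x : (0 <= g x)%E by exact: le_trans (fg x).
rewrite !ge0_integralTE//; apply: ereal_sup_le => _ [h hf <-] /=.
by exists h => // x; exact: le_trans (fg x).
Qed.

Lemma fisher_bounded_variation {R : realType} (p : R -> R) :
  (forall x, 0 <= p x) -> measurable_fun setT p ->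
  (\int[lebesgue_measure]_x (p x)%:E < +oo)%E -> abs_continuous p ->
  (\int[lebesgue_measure]_(x in [set x | (0 < p x)%R])
      ((derive1 p x) ^+ 2 / p x)%R%:E < +oo)%E ->
  bounded_total_variation p.
Proof.
move=> p0 mp ip acp.
set D := [set x | 0 < p x]; set h := (fun x : R => (_ / p x)%:E) => ih.
have mD : measurable (D : set R).
  have := mp measurableT `]0, +oo[%classic (measurable_itv _); rewrite setTI.
  by congr measurable; apply/seteqP; split => x /=; rewrite in_itv/= andbT.
(* The bound is fixed before the points are given: the function g below depends on a window
   containing them, and C must not. *)
pose C := (\int[lebesgue_measure]_(x in D) h x + \int[lebesgue_measure]_x (p x)%:E)%E.
have h0 x : D x -> (0 <= h x)%E by move=> Dx; rewrite lee_fin divr_ge0 ?sqr_ge0.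
have Cfin : C \is a fin_num.
  have C0 : (0 <= C)%E by apply: adde_ge0; apply: integral_ge0 => // x _; rewrite lee_fin.
  by rewrite ge0_fin_numE// lte_add_pinfty.
exists (fine C) => s ss; rewrite -lee_fin fineK//.
have [A [B [AB sAB]]] := seq_in_itv s.
have [g [ig gE [N [mN N0 subN]]]] := abs_continuous_derivative AB (acp A B).
have mg : measurable_fun setT g by apply/measurable_EFinP; exact: measurable_int ig.
(* [N] is a measurable null set containing every point where differentiability or the equality with
   g fails, so [E] is measurable and g is the true derivative on it. *)
pose E := `]A, B[%classic `\` N.
have mE : measurable (E : set R) by exact: measurableD.
have Eg x : E x -> derivable p x 1 /\ derive1 p x = g x.
  move=> [/=]; rewrite in_itv/= => /andP[Ax xB] Nx; apply: contrapT => H; apply: Nx.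
  by apply: subN => /= H'; exact: H (H' Ax xB).
pose G := (fun x => (`|g x|)%:E) \_ E.
have mabs : measurable_fun setT (fun x => (`|g x|)%:E).
  by apply/measurable_EFinP; exact: measurableT_comp.
have mG : measurable_fun setT G.
  by apply/(measurable_restrictT _ _).1 => //; exact: measurable_funTS.
have G0 x : (0 <= G x)%E by rewrite /G patchE; case: ifPn => // _; rewrite lee_fin.
pose H := (fun x => (g x ^+ 2 / p x)%:E) \_ (E `&` D).
have H0 x : (0 <= H x)%E.
  by rewrite /H patchE; case: ifPn => // _; rewrite lee_fin divr_ge0 ?sqr_ge0.
have mH : measurable_fun setT H.
  apply/(measurable_restrictT _ _).1 => //; first exact: measurableI.
  apply: measurable_funTS; apply/measurable_EFinP; apply: measurable_funM; first exact: measurable_funX.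
  rewrite (_ : (fun x => _) = (fun x => p x `^ (- 1))); last by apply/funext => x; rewrite powR_inv1.
  exact: (measurableT_comp (measurable_powR (- 1)) mp).
apply: (@le_trans _ _ (\int[lebesgue_measure]_z G z)%E).
  apply: (@variation_le_integral _ p G A B) => // x y Ax xy yB.
  rewrite (gE x y Ax (ltW xy) yB).
  have igxy : lebesgue_measure.-integrable `]x, y] (EFin \o g) by exact: integrableS ig.
  have <- : (\int[lebesgue_measure]_(z in `]x, y]) (`|g z|)%:E = \int[lebesgue_measure]_(z in `]x, y]) G z)%E.
    apply: ge0_ae_eq_integral => //; try exact: measurable_funTS.
    (* [E] omits the right end of the window, which ]x, y] may contain; this adds one point to the
       exceptional set. *)
    exists (N `|` [set B]); split; first exact: measurableU.
      have E0 := measureU0 mN (measurable_set1 B) (lebesgue_measure_set1 B : _ = 0%E).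
      exact: etrans E0 N0.
    move=> z /not_implyP[]; rewrite /= in_itv/= => /andP[xz zy] nG.
    have [->|zB] := eqVneq z B; [by right|left]; apply: contrapT => Nz; apply: nG.
    rewrite /G patchE mem_set//; split => //=.
    by rewrite in_itv/= (le_lt_trans Ax xz) lt_neqAle zB (le_trans zy).
  have Rfin : (\int[lebesgue_measure]_(z in `]x, y]) (g z)%:E)%E \is a fin_num.
    exact: integrable_fin_num igxy.
  rewrite -abse_EFin /Rintegral fineK//.
  apply: (le_abse_integral lebesgue_measure (f := EFin \o g)) => //.
  by case/integrableP: igxy.
apply: (@le_trans _ _ (\int[lebesgue_measure]_z (H z + (p z)%:E))%E).
  apply: ge0_le_integral => //.
    by apply: emeasurable_funD => //; exact/measurable_EFinP.
  move=> z _; rewrite /G /H !patchE; case: ifPn => zE; last first.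
    by case: ifPn => _; rewrite -?EFinD lee_fin ?addr_ge0// divr_ge0 ?sqr_ge0.
  have {}zE := set_mem zE.
  case: ifPn => zD.
    have [_ pz] := set_mem zD; rewrite -EFinD lee_fin.
    have pz' : p z != 0 by rewrite gt_eqF.
    have -> : g z ^+ 2 / p z + p z = (g z ^+ 2 + p z ^+ 2) / p z by field.
    rewrite ler_pdivlMr// -[g z ^+ 2]real_normK ?num_real//.
    have := sqr_ge0 (`|g z| - p z); have := mulr_ge0 (normr_ge0 (g z)) (p0 z); nra.
  have pz : p z = 0.
    apply/eqP; rewrite eq_le p0 andbT leNgt; apply/negP => pz.
    by move/negP: zD; apply; exact/mem_set.
  have [dp <-] := Eg z zE; rewrite (derive1_at_global_min _ dp) ?normr0 ?pz ?adde0// => x; rewrite pz.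
rewrite ge0_integralD//; [|by move=> x _; rewrite lee_fin|exact/measurable_EFinP].
rewrite /C leeD2r//.
(* [H] is the Fisher integrand on the part of [D] inside [E] and zero elsewhere, hence below it
   everywhere. *)
rewrite [leRHS]integral_mkcond; apply: ge0_le_integral_nonmeasurable => // x.
rewrite /H !patchE; case: ifPn => [/set_mem[xE xD]|_]; last by case: ifPn => // /set_mem /h0.
by rewrite mem_set// /h; have [_ ->] := Eg x xE.
Qed.

Lemma abs_continuous_continuous {R : realType} (f : R -> R) : abs_continuous f -> continuous f.
Proof.
move=> acf x; apply/cvgrPdist_lt => e e0.
have [dl dl0 H] := acf (x - 1) (x + 1) e e0.
pose r := Num.min dl 1; have r0 : 0 < r by rewrite lt_min dl0 ltr01.
have close u v : x - 1 <= u -> u <= v -> v <= x + 1 -> v - u < dl -> `|f v - f u| < e.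
  move=> u1 uv v1 vu; have := H [:: (u, v)].
  by rewrite /= !big_cons !big_nil !addr0 u1 uv v1 => /(_ isT isT vu).
exists r => //= y; rewrite /ball/= lt_min => /andP[yd y1].
move: yd y1; have [xy|/ltW yx] := leP x y.
  rewrite distrC ger0_norm ?subr_ge0// => yd y1; rewrite distrC; apply: close => //; lra.
rewrite ger0_norm ?subr_ge0// => yd y1; apply: close => //; lra.
Qed.

(** * The five equivalent conditions *)

Unset Implicit Arguments.

Theorem theorem1p3 (R : realType) (d : measure_display) (T : measurableType d)
    (P : probability T R) (X : nat -> {RV P >-> R})
    (Hind : mutually_independent P (fun n => X n : T -> R))
    (Hid : identically_distributed P (fun n => X n : T -> R))
    (H2 : (\int[P]_w ((X 0%N w) ^+ 2)%:E < +oo)%E) :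
  let Z := normalized_sum (fun n => X n : T -> R) in
  let f1 := charfun P (X 0%N) in
  [<-> (* (a) *) exists2 n0 : nat, (0 < n0)%N & finite_fisher_information P (Z n0);
       (* (b) *) exists2 n0 : nat, (0 < n0)%N &
                   exists p : R -> R, [/\ is_density P (Z n0) p,
                     between_one_sided_limits p & bounded_total_variation p];
       (* (c) *) exists2 n0 : nat, (0 < n0)%N &
                   exists p : R -> R, [/\ is_density P (Z n0) p,
                     (forall x, derivable p x 1), continuous (derive1 p) &
                     (\int[lebesgue_measure]_x (`|derive1 p x|)%:E < +oo)%E];
       (* (d) *) exists2 eps : R, 0 < eps &
                   exists C t0 : R, forall t : R, t0 <= t ->
                     cmodulus (f1 t) <= C * t `^ (- eps);
       (* (e) *) exists2 nu : R, 0 < nu &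
                   (\int[lebesgue_measure]_t ((cmodulus (f1 t)) `^ nu * `|t|)%:E < +oo)%E].
Proof.
move=> Z f1.
have iX2 : P.-integrable setT (EFin \o (fun w => X 0%N w ^+ 2)).
  apply/integrableP; split.
    by apply/measurable_EFinP; apply: measurable_funX; exact: measurable_funPT.
  by under eq_integral => w _ do rewrite /= ger0_norm ?sqr_ge0//.
have mE t : cmodulus (f1 t) = modulus X t by exact: cmodulus_charfun.
have m0 t : 0 <= modulus X t by exact: modulus_ge0.
have m1 t : modulus X t <= 1 by exact: modulus_le1.
have [L L0 mL] := modulus_lipschitz iX2.
have cm := lipschitz_continuous mL.
(* Any power decay of |f_1| yields a smooth density. Stated once, it serves both the step from (b)
   to (c) and the step from (e) to (a). *)
have smooth : (exists eps C t0 : R, 0 < eps /\ forall t, t0 <= t -> modulus X t <= C * t `^ (- eps)) ->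
    exists2 n0 : nat, (0 < n0)%N &
    exists p p' p'' : R -> R, exists L : R, [/\ is_density P (Z n0) p,
    forall x : R, is_derive x 1 p (p' x), forall x : R, is_derive x 1 p' (p'' x) &
    forall x, `|p' x| <= L * (1 + x ^+ 2)^-1 /\ `|p'' x| <= L * (1 + x ^+ 2)^-1].
  move=> [eps [C [t0 [eps0 H]]]].
  have [N [K HNK]] := powR_decay eps0 m0 m1 H.
  exact: (smooth_normalized_sum Hind Hid iX2 HNK).
have BV_decay n p : (0 < n)%N -> is_density P (Z n) p -> bounded_total_variation p ->
    exists eps C t0 : R, 0 < eps /\ forall t, t0 <= t -> modulus X t <= C * t `^ (- eps).
  move=> n0 pZ BV; have [C HC] := bounded_variation_modulus_decay Hind Hid iX2 n0 pZ BV.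
  by exists n%:R^-1, C, 1; rewrite invr_gt0 ltr0n.
tfae.
- move=> [n n0 [p [pZ [acp fp]]]]; exists n => //; exists p.
  have [p0 [mp int_p]] := pZ.
  split => //; last first.
    apply: fisher_bounded_variation => //.
    by rewrite (@integral_density _ _ _ P (normalized_RV X n) p pZ) ltry.
  exact: continuous_between (abs_continuous_continuous acp).
- move=> [n n0 [p [pZ _ BV]]].
  (* The step goes through the decay in (d): the density [p] itself need not be smooth, and the
     smooth one belongs to an index k that may differ from n. *)
  have [k k0 [p1 [p' [p'' [L' [dens dp dp' H]]]]]] := smooth (BV_decay _ _ n0 pZ BV).
  have pE : derive1 p1 = p'.
    by apply/funext => x; rewrite derive1E; exact: (@derive_val _ _ _ _ _ _ _ (dp x)).
  exists k => //; exists p1; rewrite pE; split => //; first exact: is_derive1_continuous dp'.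
  have L'0 : 0 <= L'.
    have [+ _] := H 0; rewrite expr0n addr0 invr1 mulr1; exact: le_trans.
  apply: le_lt_trans (integral_invD1sqr_lty L'0); apply: ge0_le_integral => //.
  + apply/measurable_EFinP; apply: measurableT_comp => //.
    exact: continuous_measurable_fun (is_derive1_continuous dp').
  + by apply/measurable_EFinP; apply: measurable_funM => //; exact: measurable_invD1sqr.
  + by move=> x _; rewrite lee_fin; have [] := H x.
- move=> [n n0 [p [pZ dp cp' ip']]].
  have [eps [C [t0 [eps0 H]]]] := BV_decay _ _ n0 pZ (C1_bounded_variation dp cp' ip').
  by exists eps => //; exists C, t0 => t tt0; rewrite mE; exact: H.
- move=> [eps eps0 [C [t0 H]]].
  have H' t : t0 <= t -> modulus X t <= C * t `^ (- eps) by rewrite -mE; exact: H.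
  have [N [K HNK]] := powR_decay eps0 m0 m1 H'.
  exists N.+1%:R; first by rewrite ltr0n.
  under eq_integral do rewrite mE.
  exact: even_decay_integral cm m0 m1 (@modulusN _ _ _ P X) HNK.
- move=> [nu nu0]; under eq_integral do rewrite mE; move=> inu.
  (* The decay in (d), with exponent 1/(1 + nu), is recovered first; the smooth density that it
     provides then has finite Fisher information. *)
  have [C HC] := lipschitz_integral_decay nu0 L0 m0 m1 mL inu.
  have [|n n0 [p [p' [p'' [L' [dens dp dp' H]]]]]] := smooth _.
    by exists (1 + nu)^-1, C, 1; rewrite invr_gt0 addr_gt0.
  exists n => //; exists p; split => //; have [p0 [mp _]] := dens; split.
    apply: (@lipschitz_abs_continuous _ _ L') => x y.
    apply: derive_bound_lipschitz dp _ _ _ => z.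
    have [/le_trans + _] := H z; apply.
    have L'0 : 0 <= L'.
      have [+ _] := H 0; rewrite expr0n addr0 invr1 mulr1; exact: le_trans.
    by rewrite ler_piMr// invf_le1 ?oneDsqr_pos// lerDl sqr_ge0.
  exact: (fisher_integral_lty mp p0 dp dp' H).
Qed.
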